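(* For $(z,\theta),(z_0,\theta_0)\in\bigwedge_\infty$ such that $0<|(z_0)_B|<|z_B|$, we have $$\big((z_0+z+\theta_0\theta,\theta+\theta_0);\mathbf 0,(1,\mathbf 0),(1,\mathbf 0)\big)=\big((z,\theta);\mathbf 0,(1,\mathbf 0),(1,\mathbf 0)\big)\;{}_1\infty_0\;\big((A(-z_0,1),M(-\theta_0,1/2)),(1,\mathbf 0)\big).$$
   Context: Grassmann algebra: $\bigwedge_\infty$ is the complex Grassmann algebra on anticommuting generators $\zeta_1,\zeta_2,\ldots$, with even/odd parts $\bigwedge_\infty^0,\bigwedge_\infty^1$, body/soul decomposition $a=a_B+a_S$, ${}^\times$ = invertible elements ($a_B\ne0$); points are written $(z,\theta)$ ($z$ even, $\theta$ odd). DeWitt open sets: $\{a:a_B\in V\}$, $V\subset\mathbb C$ open; $\mathcal B_0^r=\{a:|a_B|<r\}$, $\bar{\mathcal B}_0^r$ closed analogue. A function $H(w,\rho)=(f+\rho\xi,\psi+\rho g)$ ($f,g$ even, $\xi,\psi$ odd, analytic in $w$, Taylor extended from the body) is superconformal if $\xi=g\psi$, $g^2=f'+\psi\psi'$, $g+\rho\psi'\not\equiv0$. For $j\in\mathbb Z$: $L_j(x,\varphi)=-(x^{j+1}\partial_x+\frac{j+1}2\varphi x^j\partial_\varphi)$, $G_{j-1/2}(x,\varphi)=-x^j(\partial_\varphi-\varphi\partial_x)$; $b^{\mp2L_0}$ sends $c\varphi^mx^n$ to $c\,b^{\pm(2n+m)}\varphi^mx^n$. For sequences $(A,M)=\{(A_j,M_{j-1/2})\}_{j\ge1}$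 (even, odd) and $a\in(\bigwedge_\infty^0)^\times$: $\tilde E(A,M)=\exp(-\sum_{j\ge1}(A_jL_j+M_{j-1/2}G_{j-1/2}))\cdot(x,\varphi)$, $\hat E(a,A,M)=\exp(-\sum_{j\ge1}(A_jL_j+M_{j-1/2}G_{j-1/2}))\cdot a^{-2L_0}\cdot(x,\varphi)$. $\mathcal H$ = set of $(A,M)$ with $\tilde E(A,M)$ absolutely convergent near $0$; $\mathbf0$ = zero sequences. $(A(a,k),M(m,l-1/2))$ is the pair of sequences with $A_k=a$, $A_j=0$ for $j\ne k$, $M_{l-1/2}=m$, $M_{j-1/2}=0$ for $j\ne l$. $I(w,\rho)=(1/w,i\rho/w)$, $s_{(z,\theta)}(w,\rho)=(w-z-\rho\theta,\rho-\theta)$. A supersphere is a super-Riemann surface over $\bigwedge_\infty$ (charts onto DeWitt open subsets of $\bigwedge_\infty$, superconformal transitions) whose body is a connected compact genus-zero Riemann surface; with $1+n$ tubes: one negatively oriented puncture $p_0$, $n$ positively oriented ordered punctures, distinct bodies, superconformal local coordinates vanishing at the punctures, considered up to superconformal isomorphisms matching punctures and coordinate germs. $S\hat{\mathbb C}$ is the super-Riemann sphere with charts $\Delta,\Upsilon$ onto $\bigwedge_\infty$, $\Delta\circ\Upsilon^{-1}=I$. For $n\ge1$, $SK(n)=SM^{n-1}\times\mathcal H\times((\bigwedge_\infty^0)^\times\times\mathcal H)^n$ ($SM^{n-1}$: $(n-1)$-tuples of points of $\bigwedge_\infty^\times$ with distinct bodies) is identified with the set of equivalence classes of superspheres with $1+n$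 tubes: $((z_k,\theta_k)_{k<n};(A^{(0)},M^{(0)}),(a^{(k)},A^{(k)},M^{(k)})_{k\le n})$ is the class of $S\hat{\mathbb C}$ with punctures $\infty=\Upsilon^{-1}(0)$ (negative), $(z_k,\theta_k)$ and $(z_n,\theta_n)=0$, with coordinates $\tilde E(A^{(0)},-iM^{(0)})\circ I$, equivalently $\exp(\sum_{j\ge1}(A^{(0)}_jL_{-j}(w,\rho)+M^{(0)}_{j-1/2}G_{-j+1/2}(w,\rho)))\cdot(1/w,i\rho/w)$, at $\infty$ and $\hat E(a^{(k)},A^{(k)},M^{(k)})\circ s_{(z_k,\theta_k)}$ at the $k$-th puncture (in the chart $\Delta$). Sewing: for $(S_1;p_0,\ldots,p_m;\Omega_k)$ and $(S_2;q_0,\ldots,q_n;\Xi_l)$ such that for some $r>0$ the images of $\Omega_i$, $\Xi_0$ contain $\bar{\mathcal B}_0^r$, $\bar{\mathcal B}_0^{1/r}$ and $p_i$, $q_0$ are the only punctures in their preimages, $S_1\,{}_i\infty_0\,S_2$ is obtained, for $r_2<r<r_1$ close to $r$, by gluing $S_1\smallsetminus\Omega_i^{-1}(\bar{\mathcal B}_0^{r_2})$ and $S_2\smallsetminus\Xi_0^{-1}(\bar{\mathcal B}_0^{1/r_1})$ via $p\sim\Xi_0^{-1}\circ I\circ\Omega_i(p)$ on $\Omega_i^{-1}(\mathcal B_0^{r_1}\smallsetminus\bar{\mathcal B}_0^{r_2})$, with punctures $p_0,\ldots,p_{i-1},q_1,\ldots,q_n,p_{i+1},\ldots,p_m$ and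 restricted coordinates. This induces the partial operation ${}_i\infty_0:SK(m)\times SK(n)\to SK(m+n-1)$. *)

(* Defs.v *)
From HB Require Import structures.
From mathcomp Require Import all_boot all_order all_algebra.
From mathcomp Require Import finmap complex monalg.
From mathcomp Require Import all_classical all_reals all_analysis.

Set Implicit Arguments.
Unset Strict Implicit.
Unset Printing Implicit Defensive.

Import Order.TTheory GRing.Theory Num.Theory numFieldNormedType.Exports.

Local Open Scope classical_set_scope.
Local Open Scope ring_scope.

(* Finite sums [\sum_I a_I zeta_I], where [I] is a finite set of naturals and
   [zeta_I] is the product of the generators [zeta_i], [i \in I], in increasing
   order; [a@_I] is the coefficient [a_I]. *)
Definition grassmann (K : fieldType) : Type := {malg K[{fset nat}]}.

HB.instance Definition _ (K : fieldType) := Choice.on (grassmann K).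

(* The operations are those of [{malg _}], locked: unlocked, unification may
   unfold them down to the finite maps. *)
HB.lock Definition gzero (K : fieldType) : grassmann K :=
  0 : {malg K[{fset nat}]}.
HB.lock Definition gopp (K : fieldType) (a : grassmann K) : grassmann K :=
  - (a : {malg K[{fset nat}]}).
HB.lock Definition gadd (K : fieldType) (a b : grassmann K) : grassmann K :=
  (a : {malg K[{fset nat}]}) + b.
HB.lock Definition gscale (K : fieldType) (k : K) (a : grassmann K) :
  grassmann K := k *: (a : {malg K[{fset nat}]}).

Section GrassmannLmodule.
Variable K : fieldType.
Local Notation G := (grassmann K).

Fact gaddA : associative (@gadd K).
Proof. by move=> a b c; rewrite gadd.unlock addrA. Qed.
Fact gaddC : commutative (@gadd K).
Proof. by move=> a b; rewrite gadd.unlock addrC. Qed.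
Fact gadd0 : left_id (gzero K) (@gadd K).
Proof. by move=> a; rewrite gadd.unlock gzero.unlock add0r. Qed.
Fact gaddN : left_inverse (gzero K) (@gopp K) (@gadd K).
Proof.
by move=> a; rewrite gadd.unlock gopp.unlock gzero.unlock addNr.
Qed.

HB.instance Definition _ := GRing.isZmodule.Build G gaddA gaddC gadd0 gaddN.

Fact gscaleA (k l : K) (a : G) : gscale k (gscale l a) = gscale (k * l) a.
Proof. by rewrite gscale.unlock scalerA. Qed.
Fact gscale1 : left_id 1 (@gscale K).
Proof. by move=> a; rewrite gscale.unlock scale1r. Qed.
Fact gscaleDr : right_distributive (@gscale K) +%R.
Proof.
move=> k a b; rewrite -[LHS]/(gscale k (gadd a b)) -[RHS]/(gadd _ _).
by rewrite gscale.unlock gadd.unlock scalerDr.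
Qed.
Fact gscaleDl (a : G) : {morph (gscale (K := K))^~ a : k l / k + l}.
Proof.
move=> k l; rewrite -[RHS]/(gadd _ _).
by rewrite gscale.unlock gadd.unlock scalerDl.
Qed.

HB.instance Definition _ := GRing.Zmodule_isLmodule.Build K G
  gscaleA gscale1 gscaleDr gscaleDl.

Lemma gcoef0 I : (0 : G)@_I = 0.
Proof. by rewrite -[0 : G]/(gzero K) gzero.unlock mcoeff0. Qed.
Lemma gcoefN (a : G) I : (- a)@_I = - a@_I.
Proof. by rewrite -[- a]/(gopp a) gopp.unlock mcoeffN. Qed.
Lemma gcoefD (a b : G) I : (a + b)@_I = a@_I + b@_I.
Proof. by rewrite -[a + b]/(gadd a b) gadd.unlock mcoeffD. Qed.
Lemma gcoefZ (k : K) (a : G) I : (k *: a)@_I = k * a@_I.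
Proof. by rewrite -[k *: a]/(gscale k a) gscale.unlock mcoeffZ. Qed.
Lemma grassmannP (a b : G) : (forall I, a@_I = b@_I) -> a = b.
Proof. by move/malgP. Qed.
Lemma gcoef_sum (T : Type) (r : seq T) (P : pred T) (F : T -> G) I :
  (\sum_(t <- r | P t) F t)@_I = \sum_(t <- r | P t) (F t)@_I.
Proof.
exact: (big_morph (fun a : G => a@_I) (fun a b => gcoefD a b I) (gcoef0 I)).
Qed.
Lemma msupp_gadd (a b : G) : (msupp (a + b) `<=` msupp a `|` msupp b)%fset.
Proof. rewrite -[a + b]/(gadd a b) gadd.unlock; exact: msuppD_le. Qed.
Lemma msupp_gscale (k : K) (a : G) : (msupp (k *: a) `<=` msupp a)%fset.
Proof. rewrite -[k *: a]/(gscale k a) gscale.unlock; exact: msuppZ_le. Qed.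

End GrassmannLmodule.

HB.lock Definition zeta (K : fieldType) (I : {fset nat}) : grassmann K :=
  << I >>.

Definition inversions (I J : {fset nat}) : nat :=
  \sum_(i <- I) \sum_(j <- J) (j < i)%N.

Definition zeta_mul (K : fieldType) (I J : {fset nat}) : grassmann K :=
  if [disjoint I & J]%fset
  then (-1) ^+ inversions I J *: zeta K (I `|` J)%fset else 0.

HB.lock Definition gmul (K : fieldType) (a b : grassmann K) : grassmann K :=
  \sum_(I <- msupp a) \sum_(J <- msupp b) (a@_I * b@_J) *: zeta_mul K I J.

Section GrassmannRing.
Variable K : fieldType.
Local Notation G := (grassmann K).
Local Notation zeta := (zeta K).
Local Notation zmul := (zeta_mul K).
Implicit Types (I J : {fset nat}) (a b c : G).

Lemma gcoef_zeta I J : (zeta I)@_J = (I == J)%:R.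
Proof. by rewrite zeta.unlock mcoeffU. Qed.

Lemma gmulEw (d1 d2 : {fset {fset nat}}) a b :
  (msupp a `<=` d1)%fset -> (msupp b `<=` d2)%fset ->
  gmul a b = \sum_(I <- d1) \sum_(J <- d2) (a@_I * b@_J) *: zmul I J.
Proof.
move=> le1 le2; rewrite gmul.unlock (big_fset_incl _ le1) /=; last first.
  by move=> I _ /mcoeff_outdom aI; rewrite big1// => J _; rewrite aI mul0r scale0r.
apply/eq_bigr => I _; apply/big_fset_incl => // J _ /mcoeff_outdom ->.
by rewrite mulr0 scale0r.
Qed.

Lemma gmulDl : left_distributive (@gmul K) +%R.
Proof.
move=> a b c.
rewrite (gmulEw (msupp_gadd a b) (fsubset_refl _)).
rewrite (gmulEw (fsubsetUl _ (msupp b)) (fsubset_refl (msupp c))).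
rewrite (gmulEw (fsubsetUr (msupp a) _) (fsubset_refl (msupp c))).
rewrite -big_split; apply/eq_bigr => I _; rewrite -big_split.
by apply/eq_bigr => J _; rewrite gcoefD mulrDl scalerDl.
Qed.

Lemma gmulDr : right_distributive (@gmul K) +%R.
Proof.
move=> c a b.
rewrite (gmulEw (fsubset_refl _) (msupp_gadd a b)).
rewrite (gmulEw (fsubset_refl (msupp c)) (fsubsetUl _ (msupp b))).
rewrite (gmulEw (fsubset_refl (msupp c)) (fsubsetUr (msupp a) _)).
rewrite -big_split; apply/eq_bigr => I _; rewrite -big_split.
by apply/eq_bigr => J _; rewrite gcoefD mulrDr scalerDl.
Qed.

Lemma gmulZl (k : K) a b : k *: gmul a b = gmul (k *: a) b.
Proof.
rewrite (gmulEw (msupp_gscale k a) (fsubset_refl (msupp b))).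
rewrite [in LHS]gmul.unlock scaler_sumr.
apply/eq_bigr => I _; rewrite scaler_sumr; apply/eq_bigr => J _.
by rewrite scalerA gcoefZ mulrA.
Qed.

Lemma gmulZr (k : K) a b : k *: gmul a b = gmul a (k *: b).
Proof.
rewrite (gmulEw (fsubset_refl (msupp a)) (msupp_gscale k b)).
rewrite [in LHS]gmul.unlock scaler_sumr.
apply/eq_bigr => I _; rewrite scaler_sumr; apply/eq_bigr => J _.
by rewrite scalerA gcoefZ mulrCA.
Qed.

Lemma gmul0 a : gmul a 0 = 0.
Proof. by rewrite -[0 in LHS](scale0r (0 : G)) -gmulZr scale0r. Qed.

Lemma g0mul a : gmul 0 a = 0.
Proof. by rewrite -[0 in LHS](scale0r (0 : G)) -gmulZl scale0r. Qed.

Lemma gmulUU I J : gmul (zeta I) (zeta J) = zmul I J.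
Proof.
rewrite zeta.unlock (gmulEw msuppU_le msuppU_le) !big_seq_fset1 !mcoeffUU.
by rewrite mul1r scale1r.
Qed.

Lemma grassmannE a : a = \sum_(I <- msupp a) a@_I *: zeta I.
Proof.
apply/grassmannP => J; rewrite gcoef_sum {1}[a]monalgE raddf_sum /=.
by apply: eq_bigr => I _; rewrite gcoefZ mcoeffU gcoef_zeta mulr_natr.
Qed.

Lemma gmul_suml (T : Type) (r : seq T) (F : T -> G) b :
  gmul (\sum_(i <- r) F i) b = \sum_(i <- r) gmul (F i) b.
Proof. by rewrite (big_morph (fun x : G => gmul x b) (fun x y => gmulDl x y b) (g0mul b)). Qed.

Lemma gmul_sumr (T : Type) (r : seq T) (F : T -> G) a :
  gmul a (\sum_(i <- r) F i) = \sum_(i <- r) gmul a (F i).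
Proof. by rewrite (big_morph (fun x : G => gmul a x) (gmulDr a) (gmul0 a)). Qed.

Lemma big_fsetU_disjoint (I J : {fset nat}) (F : nat -> nat) :
  [disjoint I & J]%fset ->
  (\sum_(i <- (I `|` J)%fset) F i = \sum_(i <- I) F i + \sum_(i <- J) F i)%N.
Proof.
move=> dIJ; rewrite -big_cat; apply: perm_big; apply: uniq_perm.
- exact: fset_uniq.
- rewrite cat_uniq !fset_uniq andbT /=; apply/hasPn => j jJ /=.
  by apply/negP => jI; move/fdisjointP : dIJ => /(_ _ jI); rewrite jJ.
- by move=> j; rewrite mem_cat inE.
Qed.

Lemma inversionsUl I J L : [disjoint I & J]%fset ->
  inversions (I `|` J)%fset L = (inversions I L + inversions J L)%N.
Proof. exact: big_fsetU_disjoint. Qed.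

Lemma inversionsUr I J L : [disjoint J & L]%fset ->
  inversions I (J `|` L)%fset = (inversions I J + inversions I L)%N.
Proof.
move=> dJL; rewrite /inversions -big_split /=; apply: eq_bigr => i _.
exact: big_fsetU_disjoint.
Qed.

Lemma zeta_mulA I J L :
  gmul (zeta I) (zmul J L) = gmul (zmul I J) (zeta L).
Proof.
rewrite /zeta_mul.
case: (boolP [disjoint J & L]%fset) => dJL;
  case: (boolP [disjoint I & J]%fset) => dIJ;
  rewrite ?gmul0 ?g0mul -?gmulZr -?gmulZl ?gmulUU /zeta_mul.
- rewrite fdisjointUX fdisjointXU dIJ dJL andbT /=.
  case: ifP => dIL; last by rewrite !scaler0.
  rewrite !scalerA -!exprD fsetUA.
  rewrite inversionsUl // inversionsUr //; congr (_ ^+ _ *: _).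
  by rewrite addnC -addnA.
- by rewrite fdisjointXU (negbTE dIJ) scaler0.
- by rewrite fdisjointUX (negbTE dJL) andbF scaler0.
- by [].
Qed.

Lemma gmulA : associative (@gmul K).
Proof.
move=> a b c; rewrite [a]grassmannE [b]grassmannE [c]grassmannE.
rewrite !gmul_suml; apply: eq_bigr => I _.
rewrite [LHS]gmul_sumr [in RHS](gmul_sumr (msupp b)) [RHS]gmul_suml.
apply: eq_bigr => J _.
rewrite !gmul_sumr; apply: eq_bigr => L _.
rewrite -!gmulZl -!gmulZr -?gmulZl !gmulUU zeta_mulA.
by congr (_ *: _); rewrite !scalerA mulrC.
Qed.

Lemma gmul1 : right_id (zeta fset0) (@gmul K).
Proof.
move=> a; rewrite [a in LHS]grassmannE gmul_suml [RHS]grassmannE.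
apply: eq_bigr => I _; rewrite -gmulZl gmulUU /zeta_mul fdisjointX0 fsetU0.
rewrite /inversions big1 ?expr0 ?scale1r // => i _.
by rewrite big_seq_fset0.
Qed.

Lemma g1mul : left_id (zeta fset0) (@gmul K).
Proof.
move=> a; rewrite [a in LHS]grassmannE gmul_sumr [RHS]grassmannE.
apply: eq_bigr => I _; rewrite -gmulZr gmulUU /zeta_mul fdisjoint0X fset0U.
by rewrite /inversions big_seq_fset0 expr0 scale1r.
Qed.

Lemma gone_neq0 : zeta fset0 != 0.
Proof.
apply/eqP => /(congr1 (mcoeff fset0))/eqP.
by rewrite gcoef_zeta gcoef0 eqxx oner_eq0.
Qed.

HB.instance Definition _ := GRing.Zmodule_isNzRing.Build G
  gmulA g1mul gmul1 gmulDl gmulDr gone_neq0.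
HB.instance Definition _ := GRing.Lmodule_isLalgebra.Build K G gmulZl.
HB.instance Definition _ := GRing.Lalgebra_isAlgebra.Build K G gmulZr.

Definition gunit : pred G := fun a => `[< exists b, b * a = 1 /\ a * b = 1 >].

Definition ginv a : G :=
  if pselect (exists b, b * a = 1 /\ a * b = 1) is left h then projT1 (cid h)
  else a.

Lemma gmulVr : {in gunit, left_inverse 1 ginv *%R}.
Proof.
by move=> a /asboolP ua; rewrite /ginv; case: pselect => // h; case: cid => b [].
Qed.

Lemma gdivrr : {in gunit, right_inverse 1 ginv *%R}.
Proof.
by move=> a /asboolP ua; rewrite /ginv; case: pselect => // h; case: cid => b [].
Qed.

Lemma gunitP a b : b * a = 1 /\ a * b = 1 -> gunit a.
Proof. by move=> ab; apply/asboolP; exists b. Qed.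

Lemma ginv_out : {in [predC gunit], ginv =1 id}.
Proof.
move=> a; rewrite inE => /asboolPn nu.
by rewrite /ginv; case: pselect.
Qed.

HB.instance Definition _ := GRing.NzRing_hasMulInverse.Build G
  gmulVr gdivrr gunitP ginv_out.

End GrassmannRing.

Definition Cx (R : realType) : numClosedFieldType := R[i].
Notation Lam R := (grassmann (Cx R)).

Section Superpoints.
Variable R : realType.
Local Notation C := (Cx R).
Local Notation Lam := (Lam R).
Implicit Types (a : Lam) (V : set C) (r : C).

Definition is_even a := forall I : {fset nat}, odd #|` I| -> a@_I = 0.
Definition is_odd a := forall I : {fset nat}, ~~ odd #|` I| -> a@_I = 0.
Definition evpart a : Lam :=
  \sum_(I <- msupp a | ~~ odd #|` I|) a@_I *: zeta C I.
Definition odpart a : Lam :=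
  \sum_(I <- msupp a | odd #|` I|) a@_I *: zeta C I.
Definition body a : C := a@_fset0.
Definition soul a : Lam := a - (body a)%:A.

(* The point [(w, rho)] of [Lam = Lam^0 (+) Lam^1] is the element [w + rho]:
   conversely [w = evpart a] and [rho = odpart a]. *)
Definition spoint (w rho : Lam) : Lam := w + rho.

Definition dewitt V : set Lam := [set a | V (body a)].

(* Radii are elements of [C]: there [0 < r] entails that [r] is real. *)
Definition sball r : set Lam := dewitt [set c | `|c| < r].
Definition scball r : set Lam := dewitt [set c | `|c| <= r].

(* [f n] is the [n]-th derivative of the Lam-valued function [f 0] on [V];
   differentiation is complex differentiation of each coefficient. *)
Definition analytic V (f : nat -> C -> Lam) : Prop :=
  forall n c, V c -> forall I : {fset nat},
    is_derive c (1 : C) (fun x : C => (f n x)@_I : C) ((f n.+1 c)@_I : C).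

(* Taylor extension of [f 0] to even arguments. Distinct even monomials commute
   and square to 0, hence [soul w ^+ n = 0] for [n > #|` msupp w|] and the sum
   below is the whole Taylor series. *)
Definition taylor (f : nat -> C -> Lam) (w : Lam) : Lam :=
  \sum_(n < #|` msupp w|.+1) (n`!%:R)^-1 *: (f n (body w) * soul w ^+ n).

(* H(w, rho) = (f + rho xi, psi + rho g). The equations between analytic
   functions are required on the body, which determines their extensions. *)
Definition superconformal V (H : Lam -> Lam) : Prop :=
  exists f xi psi g : nat -> C -> Lam,
  [/\ analytic V f /\ analytic V xi, analytic V psi /\ analytic V g,
      forall c, V c -> [/\ is_even (f 0%N c), is_odd (xi 0%N c),
                           is_odd (psi 0%N c) & is_even (g 0%N c)],
      forall a, dewitt V a -> let w := evpart a in let rho := odpart a in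
        H a = spoint (taylor f w + rho * taylor xi w)
                     (taylor psi w + rho * taylor g w) &
      [/\ forall c, V c -> xi 0%N c = g 0%N c * psi 0%N c,
          forall c, V c -> g 0%N c ^+ 2 = f 1%N c + psi 0%N c * psi 1%N c &
          (* only the empty function is exempt, which occurs as the transition
             between disjoint charts *)
          V !=set0 -> exists2 a, dewitt V a &
            taylor g (evpart a) +
              odpart a * taylor (fun n => psi n.+1) (evpart a) != 0]].

(* I(w, rho) = (1/w, i rho/w) and its inverse (I is not an involution) *)
Definition sinv a : Lam :=
  spoint (evpart a)^-1 ('i *: (odpart a * (evpart a)^-1)).
Definition sinv_inv a : Lam :=
  spoint (evpart a)^-1 (- 'i *: (odpart a * (evpart a)^-1)).

(* s_p for p = (z, theta) *)
Definition sshift (p a : Lam) : Lam :=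
  spoint (evpart a - evpart p - odpart a * odpart p) (odpart a - odpart p).

End Superpoints.

Section Series.
Variable R : realType.
Local Notation C := (Cx R).
Local Notation Lam := (Lam R).

(* [(f, psi)] stands for the formal series [\sum_n (f_n + phi psi_n) x^n]. *)
Definition sseries := ((nat -> Lam) * (nat -> Lam))%type.
Implicit Types (s : sseries) (c a : Lam).

Definition xser : sseries := (fun n => (n == 1%N)%:R, fun=> 0).
Definition phiser : sseries := (fun=> 0, fun n => (n == 0%N)%:R).

(* left multiplication by c; moving c past phi changes the sign of odpart c *)
Definition ser_scale c s : sseries :=
  (fun n => c * s.1 n, fun n => (evpart c - odpart c) * s.2 n).

Definition mulX (j : nat) (u : nat -> Lam) : nat -> Lam :=
  fun n => if (j <= n)%N then u (n - j)%N else 0.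
Definition dX (u : nat -> Lam) : nat -> Lam := fun n => n.+1%:R *: u n.+1.

(* L_j = - (x^(j+1) d/dx + (j+1)/2 phi x^j d/dphi) *)
Definition Lop (j : nat) s : sseries :=
  (fun n => - mulX j.+1 (dX s.1) n,
   fun n => - (mulX j.+1 (dX s.2) n + (j.+1%:R / 2) *: mulX j s.2 n)).

(* G_(j-1/2) = - x^j (d/dphi - phi d/dx) *)
Definition Gop (j : nat) s : sseries :=
  (fun n => - mulX j s.2 n, fun n => mulX j (dX s.1) n).

(* (A, M) with [A k] = A_(k+1) and [M k] = M_(k+1-1/2) *)
Definition coeffs := ((nat -> Lam) * (nat -> Lam))%type.
Definition coeffs0 : coeffs := (fun=> 0, fun=> 0).
(* (A(a,k), M(m,l-1/2)) *)
Definition csingle a (k : nat) (m : Lam) (l : nat) : coeffs :=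
  (fun j => if j.+1 == k then a else 0, fun j => if j.+1 == l then m else 0).

(* - \sum_(j >= 1) (A_j L_j + M_(j-1/2) G_(j-1/2)); the terms with j > n do not
   contribute to the coefficients of x^n and phi x^n. *)
Definition expo (AM : coeffs) s : sseries :=
  (fun n => - \sum_(k < n) ((ser_scale (AM.1 k) (Lop k.+1 s)).1 n +
                            (ser_scale (AM.2 k) (Gop k.+1 s)).1 n),
   fun n => - \sum_(k < n) ((ser_scale (AM.1 k) (Lop k.+1 s)).2 n +
                            (ser_scale (AM.2 k) (Gop k.+1 s)).2 n)).

(* exp(expo AM): with x of weight 2 and phi of weight 1, [expo AM] raises the
   weight, so that iterates of order > 2n+1 do not contribute to the
   coefficients of x^n and phi x^n. *)
Definition exp_expo (AM : coeffs) s : sseries :=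
  (fun n => \sum_(k < (2 * n)%N.+2) (k`!%:R)^-1 *: (iter k (expo AM) s).1 n,
   fun n => \sum_(k < (2 * n)%N.+2) (k`!%:R)^-1 *: (iter k (expo AM) s).2 n).

(* b^(-2L_0) : c phi^m x^n |-> c b^(2n+m) phi^m x^n, for b even *)
Definition pow_2L0 (b : Lam) s : sseries :=
  (fun n => s.1 n * b ^+ (2 * n)%N, fun n => s.2 n * b ^+ (2 * n)%N.+1).

Definition Etilde (AM : coeffs) : sseries * sseries :=
  (exp_expo AM xser, exp_expo AM phiser).
Definition Ehat (b : Lam) (AM : coeffs) : sseries * sseries :=
  (exp_expo AM (pow_2L0 b xser), exp_expo AM (pow_2L0 b phiser)).

(* The series u is absolutely convergent, coefficient by coefficient, and its sum
   l is in Lam. *)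
Definition abs_sum (u : nat -> Lam) (l : Lam) : Prop :=
  forall I : {fset nat},
    cvgn (series (fun n => `|(u n)@_I : C|)) /\
    series (fun n => (u n)@_I : C) @ \oo --> (l@_I : C).

Definition ser_value s a (l : Lam) : Prop :=
  abs_sum (fun n => (s.1 n + odpart a * s.2 n) * evpart a ^+ n) l.

(* q is the value at the point a of the map E *)
Definition map_value (E : sseries * sseries) (a q : Lam) : Prop :=
  ser_value E.1 a (evpart q) /\ ser_value E.2 a (odpart q).

Definition in_H (AM : coeffs) : Prop :=
  [/\ forall k, is_even (AM.1 k), forall k, is_odd (AM.2 k) &
      exists2 r : C, 0 < r &
        forall a, sball r a -> exists q, map_value (Etilde AM) a q].

End Series.

Arguments coeffs0 {R}.

Section SuperRiemannSurfaces.
Variable R : realType.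
Local Notation C := (Cx R).
Local Notation Lam := (Lam R).

Record srs_data := SRSData {
  carrier :> Type;
  chart : Type;
  cdom : chart -> set carrier;
  cmap : chart -> carrier -> Lam }.
Arguments cdom {s} _ _.
Arguments cmap {s} _ _.

Implicit Types S : srs_data.

(* h is a superconformal function on the open set D of S *)
Definition superconformal_on S (D : set S) (h : S -> Lam) : Prop :=
  forall al : chart S, exists V : set C,
    [/\ open V, cmap al @` (D `&` cdom al) = dewitt V &
        exists2 H, superconformal V H &
          {in D `&` cdom al, forall p, h p = H (cmap al p)}].

(* For [al = be] the last condition says that charts have DeWitt open images.
   The topology of S is the one for which the charts are homeomorphisms. *)
Definition super_riemann_surface S : Prop :=
  [/\ forall p : S, exists al, cdom al p,
      forall al : chart S, {in cdom al &, injective (cmap al)} &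
      forall be : chart S, superconformal_on (cdom be) (cmap be)].

Definition srs_open S (A : set S) : Prop :=
  forall al : chart S, exists2 V : set C, open V &
    cmap al @` (A `&` cdom al) = dewitt V.

(* The body of S is the quotient of S by [same_body], with the quotient
   topology. *)
Definition same_body S (p q : S) : Prop :=
  exists al, [/\ cdom al p, cdom al q & body (cmap al p) = body (cmap al q)].

(* h induces a homeomorphism from the body of S to the 2-sphere: for a surface,
   this amounts to being connected, compact and of genus zero. *)
Definition genus_zero_body S : Prop :=
  exists h : S -> one_point_compactification C,
    [/\ forall x, exists p, h p = x,
        forall p q, h p = h q <-> same_body p q &
        forall B, open B <-> srs_open (h @^-1` B)].

Definition supersphere S : Prop :=
  super_riemann_surface S /\ genus_zero_body S.

(* 1 + n tubes: puncture 0 is the negatively oriented one, punctures 1, ..., n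
   are the positively oriented ones; [tmap k] is the local coordinate at the
   k-th puncture, defined on [tdom k]. *)
Record tubes_data (n : nat) := TubesData {
  tsurf :> srs_data;
  tpt : 'I_n.+1 -> tsurf;
  tdom : 'I_n.+1 -> set tsurf;
  tmap : 'I_n.+1 -> tsurf -> Lam }.
Arguments tpt {n} t _.
Arguments tdom {n} t _ _.
Arguments tmap {n} t _ _.

Definition supersphere_with_tubes n (T : tubes_data n) : Prop :=
  [/\ supersphere T,
      forall j k, j <> k -> ~ same_body (tpt T j) (tpt T k) &
      forall k, [/\ tdom T k (tpt T k), tmap T k (tpt T k) = 0,
                    {in tdom T k &, injective (tmap T k)},
                    exists2 V : set C, open V & tmap T k @` tdom T k = dewitt V &
                    superconformal_on (tdom T k) (tmap T k)]].

Definition superconformal_map S S' (F : S -> S') : Prop :=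
  forall be : chart S', superconformal_on (F @^-1` cdom be) (cmap be \o F).

Definition tubes_equiv n (T T' : tubes_data n) : Prop :=
  exists (F : T -> T') (F' : T' -> T),
  [/\ cancel F F', cancel F' F,
      superconformal_map F, superconformal_map F' &
      forall k, F (tpt T k) = tpt T' k /\
        exists W : set T, [/\ srs_open W, W (tpt T k) &
          forall p, W p -> [/\ tdom T k p, tdom T' k (F p) &
                               tmap T' k (F p) = tmap T k p]]].

(* The super-Riemann sphere. [inl a] is the point with Delta = a; [inr q], with
   [body q = 0], is the point with Upsilon = q, which is over infinity. *)
Definition ssphere_pt : Type := (Lam + {q : Lam | body q == 0})%type.

Definition Delta_dom : set ssphere_pt :=
  [set x | if x is inl _ then True else False].
Definition Delta (x : ssphere_pt) : Lam := if x is inl a then a else 0.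
Definition Upsilon_dom : set ssphere_pt :=
  [set x | if x is inl a then body a != 0 else True].
Definition Upsilon (x : ssphere_pt) : Lam :=
  match x with inl a => sinv_inv a | inr q => val q end.

Fact body0 : body (0 : Lam) == 0.
Proof. by rewrite /body gcoef0. Qed.
Definition ssphere_oo : ssphere_pt := inr (exist _ 0 body0).

Definition ssphere : srs_data :=
  {| carrier := ssphere_pt; chart := bool;
     cdom := fun b => if b then Delta_dom else Upsilon_dom;
     cmap := fun b => if b then Delta else Upsilon |}.

End SuperRiemannSurfaces.

Arguments cdom {R s} _ _.
Arguments cmap {R s} _ _.
Arguments tpt {R n} t _.
Arguments tdom {R n} t _ _.
Arguments tmap {R n} t _ _.

Section ModuliSpace.
Variable R : realType.
Local Notation C := (Cx R).
Local Notation Lam := (Lam R).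
Local Notation sphere := (ssphere R).

Record SKdata (n : nat) := SKData {
  skpts : n.-1.-tuple Lam;
  skinf : coeffs R;
  skloc : n.-tuple (Lam * coeffs R) }.

Definition in_SK n (Q : SKdata n) : Prop :=
  [/\ (0 < n)%N,
      forall j, body (tnth (skpts Q) j) != 0,
      forall j k, j <> k ->
        body (tnth (skpts Q) j) <> body (tnth (skpts Q) k),
      in_H (skinf Q) &
      forall k, let: (b, AM) := tnth (skloc Q) k in
        [/\ is_even b, b \is a GRing.unit & in_H AM]].

(* the (k+1)-st positive puncture in the chart Delta, (z_n, theta_n) being 0 *)
Definition skcenter n (Q : SKdata n) (k : 'I_n) : Lam := nth 0 (skpts Q) k.

(* The representative of Q on the super-Riemann sphere. The formulas for the
   local coordinates are required near the punctures. At infinity they are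
   required off the fiber over infinity, where Delta is not defined; the values
   on that fiber follow by analyticity. *)
Definition canonical n (Q : SKdata n) (T : tubes_data R n) : Prop :=
  exists (P : 'I_n.+1 -> sphere) (D : 'I_n.+1 -> set sphere)
         (Om : 'I_n.+1 -> sphere -> Lam),
  [/\ T = TubesData P D Om,
      P ord0 = ssphere_oo R,
      forall k : 'I_n, P (lift ord0 k) = inl (skcenter Q k),
      exists2 r : C, 0 < r & forall a,
        dewitt [set c | r < `|c|] a ->
        D ord0 (inl a) /\
        map_value (Etilde ((skinf Q).1, fun k => - 'i *: (skinf Q).2 k))
          (sinv a) (Om ord0 (inl a)) &
      forall k : 'I_n, exists2 r : C, 0 < r & forall a,
        dewitt [set c | `|c - body (skcenter Q k)| < r] a ->
        D (lift ord0 k) (inl a) /\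
        map_value (Ehat (tnth (skloc Q) k).1 (tnth (skloc Q) k).2)
          (sshift (skcenter Q k) a) (Om (lift ord0 k) (inl a))].

(* the equivalence class of superspheres with tubes identified with Q *)
Definition SKclass n (Q : SKdata n) (T : tubes_data R n) : Prop :=
  supersphere_with_tubes T /\
  exists T0, [/\ canonical Q T0, supersphere_with_tubes T0 & tubes_equiv T T0].

End ModuliSpace.

Section Sewing.
Variable R : realType.
Local Notation C := (Cx R).
Local Notation Lam := (Lam R).

Section Gluing.
Variables (m n : nat) (T1 : tubes_data R m) (T2 : tubes_data R n).
(* the tube number i of T1 and the tube number 0 of T2 *)
Variables (i : 'I_m.+1) (r1 r2 : C).

Definition tube_preim k (T : tubes_data R k) (j : 'I_k.+1) (B : set Lam) :
  set T := tdom T j `&` tmap T j @^-1` B.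

Definition kept (x : T1 + T2) : Prop :=
  match x with
  | inl p => ~ tube_preim i (scball r2) p
  | inr q => ~ tube_preim ord0 (scball r1^-1) q
  end.

Definition glued (p : T1) (q : T2) : Prop :=
  [/\ tube_preim i (sball r1 `\` scball r2) p, tdom T2 ord0 q &
      tmap T2 ord0 q = sinv (tmap T1 i p)].

(* an equivalence relation, since local coordinates are injective *)
Definition glue_rel (x y : T1 + T2) : Prop :=
  match x, y with
  | inl p, inl p' => p = p'
  | inr q, inr q' => q = q'
  | inl p, inr q | inr q, inl p => glued p q
  end.

Definition glue_class (x : T1 + T2) : set (T1 + T2) :=
  [set y | kept y /\ glue_rel x y].

Definition sewn_pt : Type :=
  {A : set (T1 + T2) | exists2 x, kept x & A = glue_class x}.

(* restriction to the sewn surface of a function f with domain D *)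
Definition sewn_dom (D : set (T1 + T2)) : set sewn_pt :=
  [set A | sval A `&` D !=set0].
Definition sewn_map (D : set (T1 + T2)) (f : T1 + T2 -> Lam) (A : sewn_pt) :
  Lam := xget 0 (f @` (sval A `&` D)).

Definition on_left X (f : T1 -> X) (x0 : X) (x : T1 + T2) : X :=
  if x is inl p then f p else x0.
Definition on_right X (f : T2 -> X) (x0 : X) (x : T1 + T2) : X :=
  if x is inr q then f q else x0.

Definition sewn_srs : srs_data R :=
  {| carrier := sewn_pt;
     chart := (chart T1 + chart T2)%type;
     cdom := fun c => match c with
       | inl al => sewn_dom (inl @` cdom al)
       | inr be => sewn_dom (inr @` cdom be)
       end;
     cmap := fun c => match c with
       | inl al => sewn_map (inl @` cdom al) (on_left (cmap al) 0)
       | inr be => sewn_map (inr @` cdom be) (on_right (cmap be) 0)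
       end |}.

(* p_0, ..., p_(i-1), q_1, ..., q_n, p_(i+1), ..., p_m *)
Definition sewn_index (k : nat) : 'I_m.+1 + 'I_n.+1 :=
  if (k < i)%N then inl (inord k)
  else if (k < i + n)%N then inr (inord (k - i)%N.+1)
  else inl (inord (k - n)%N.+1).

Definition sewn_puncture (k : nat) : T1 + T2 :=
  match sewn_index k with inl j => inl (tpt T1 j) | inr j => inr (tpt T2 j) end.

(* the sewn surface, P being the classes of the [sewn_puncture]s *)
Definition sewn_tubes (P : 'I_(m + n - 1).+1 -> sewn_pt) :
    tubes_data R (m + n - 1) :=
  @TubesData R _ sewn_srs P
    (fun k => match sewn_index k with
       | inl j => sewn_dom (inl @` tdom T1 j)
       | inr j => sewn_dom (inr @` tdom T2 j)
       end)
    (fun k => match sewn_index k with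
       | inl j => sewn_map (inl @` tdom T1 j) (on_left (tmap T1 j) 0)
       | inr j => sewn_map (inr @` tdom T2 j) (on_right (tmap T2 j) 0)
       end).

End Gluing.

Arguments sewn_pt {m n} T1 T2 i r1 r2.

(* The image of the coordinate at the puncture j contains the closed ball of
   radius r, whose preimage contains no other puncture. *)
Definition tube_ball k (T : tubes_data R k) (j : 'I_k.+1) (r : C) : Prop :=
  scball r `<=` tmap T j @` tdom T j /\
  forall l, tube_preim j (scball r) (tpt T l) -> l = j.

(* [U] is obtained by sewing tube i of [T1] with tube 0 of [T2] *)
Definition sewing m n (i : nat) (T1 : tubes_data R m) (T2 : tubes_data R n)
    (U : tubes_data R (m + n - 1)) : Prop :=
  (0 < i <= m)%N /\
  exists r r1 r2 : C,
  [/\ 0 < r2 /\ r2 < r < r1,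
      tube_ball T1 (inord i) r /\ tube_ball T2 ord0 r^-1,
      (* r1 and r2 are close to r *)
      tube_ball T1 (inord i) r1 /\ tube_ball T2 ord0 r2^-1 &
      exists2 P : 'I_(m + n - 1).+1 -> sewn_pt T1 T2 (inord i) r1 r2,
        forall k, sval (P k) = glue_class (inord i) r1 r2
                                 (sewn_puncture T1 T2 (inord i) k) &
        U = sewn_tubes P].

(* Graph of the partial operation induced by [sewing] on the equivalence
   classes: [Q1 i_oo_0 Q2] is defined and equal to [Q]. *)
Definition SK_sewing m n (i : nat) (Q1 : SKdata R m) (Q2 : SKdata R n)
    (Q : SKdata R (m + n - 1)) : Prop :=
  [/\ in_SK Q1, in_SK Q2, in_SK Q &
      exists T1 T2 U,
        [/\ SKclass Q1 T1, SKclass Q2 T2, sewing i T1 T2 U & SKclass Q U]].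

End Sewing.

(* Main.v *)
(** Let [F_p] be the extension of the translation [s_p], [p = (z, theta)], to
    the super-Riemann sphere: in the chart at infinity it is
    [(x, phi) |-> (x, phi + i theta x) / (1 - z x - i phi theta)], and
    [F_p' o F_p = F_p''] for [p'' = (z + z' + theta' theta, theta + theta')].
    The exponentials of [A L_1 + M G_(1/2)] have a closed form, by which the
    coordinate at infinity of the second sphere is [I o s_(-z0, -theta0)].
    Pulled back by [F_q], [q = (z0 + z + theta0 theta, theta + theta0)], the
    second sphere carries the coordinates [I o s_(z, theta)] at infinity and
    [s_q] at its positive puncture. The gluing relation [Xi_0 = I o Omega_1]
    then is equality of points, so that the sewn surface is the super-Riemann
    sphere itself, with its charts restricted to two open sets that cover it. *)

(* The translation by [q] is not a guess: translations compose by a noncommutative law, and [q] is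
   the solution of [s_(-z0, -theta0) o s_q = s_(z, theta)]. Pulling the second sphere back by [F_q]
   therefore centres its negative tube at the same [(z, theta)] as the first positive tube of the
   first sphere. In this picture the sewing annulus surrounds [z] and has to separate the puncture
   over [0], at distance [|z|], from the one over [z0 + z], at distance [|z0|]; this is where the
   inequality of the bodies enters.

   An equivalence class retains only the germs of the local coordinates, so the domains of the tubes
   that survive the sewing may be shrunk until they avoid the discs that are removed. The restricted
   coordinates on the sewn surface are then whole tubes of the sphere.

   Every transition map and every coordinate in the proof is one of a few superconformal Moebius
   maps. Superconformality is verified once for that family, through explicit sequences of
   derivatives, because [superconformal] asks for Taylor extensions and not just for values. *)
Require Import Defs.
From mathcomp Require Import all_boot all_order all_algebra.
From mathcomp Require Import finmap complex monalg.
From mathcomp Require Import all_classical all_reals all_analysis.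
From mathcomp Require Import zify ring lra.

Set Implicit Arguments.
Unset Strict Implicit.
Unset Printing Implicit Defensive.

Import Order.TTheory GRing.Theory Num.Theory numFieldNormedType.Exports.

Local Open Scope classical_set_scope.
Local Open Scope ring_scope.

(** * The Grassmann algebra *)

Section GrassmannCoefficients.
Variable K : fieldType.
Local Notation G := (grassmann K).
Implicit Types (I J L : {fset nat}) (a b : G).

Lemma zeta_mul_coef_subset I J L :
  (zeta_mul K J L)@_I != 0 -> (J `<=` I)%fset && (L `<=` I)%fset.
Proof.
rewrite /zeta_mul; case: ifP => _; last by rewrite gcoef0 eqxx.
rewrite gcoefZ gcoef_zeta; case: (_ =P I) => [<-|_]; last by rewrite mulr0 eqxx.
by rewrite fsubsetUl fsubsetUr.
Qed.

Lemma zeta_mul_coef_card I J L :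
  (zeta_mul K J L)@_I != 0 -> #|` I| = (#|` J| + #|` L|)%N.
Proof.
rewrite /zeta_mul; case: ifP => [dJL|_]; last by rewrite gcoef0 eqxx.
rewrite gcoefZ gcoef_zeta; case: (_ =P I) => [<- _|_]; last by rewrite mulr0 eqxx.
by rewrite cardfsU; move/eqP: dJL => ->; rewrite cardfs0 subn0.
Qed.

(** A product of monomials is a multiple of the monomial of the union, so only subsets of [I]
    contribute. The index set of this finite sum does not depend on [a] and [b], which allows
    derivatives and limits to be taken coefficient by coefficient. *)
Lemma gcoefM a b I : (a * b)@_I =
  \sum_(J <- fpowerset I) \sum_(L <- fpowerset I)
    a@_J * b@_L * (zeta_mul K J L)@_I.
Proof.
rewrite -[a * b]/(gmul a b).
rewrite (gmulEw (fsubsetUl _ (fpowerset I)) (fsubsetUl _ (fpowerset I))).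
rewrite gcoef_sum; apply/esym.
rewrite (big_fset_incl _ (fsubsetUr (msupp a) (fpowerset I))) /=; last first.
  move=> J _; rewrite fpowersetE => nJ; rewrite big1// => L _.
  by have [->|/zeta_mul_coef_subset/andP[]] := eqVneq (zeta_mul K J L)@_I 0;
    rewrite ?mulr0// (negbTE nJ).
apply: eq_bigr => J _.
rewrite (big_fset_incl _ (fsubsetUr (msupp b) (fpowerset I))) /=; last first.
  move=> L _; rewrite fpowersetE => nL.
  by have [->|/zeta_mul_coef_subset/andP[_]] := eqVneq (zeta_mul K J L)@_I 0;
    rewrite ?mulr0// (negbTE nL).
by rewrite gcoef_sum; apply: eq_bigr => L _; rewrite gcoefZ.
Qed.

(** Disjointness excludes [i = j], so each pair is counted once, in exactly one of the two sums. *)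
Lemma inversions_sym I J : [disjoint I & J]%fset ->
  (inversions I J + inversions J I)%N = (#|` I| * #|` J|)%N.
Proof.
move=> /fdisjointP dIJ; rewrite /inversions [X in (_ + X)%N]exchange_big /=.
rewrite -big_split /= -[X in (X * _)%N]sum1_size big_distrl /=.
rewrite big_seq [RHS]big_seq; apply: eq_bigr => i iI.
rewrite -big_split /= mul1n -sum1_size big_seq [RHS]big_seq.
apply: eq_bigr => j jJ; have := dIJ i iI.
by case: ltngtP => // <-; rewrite jJ.
Qed.

Lemma zeta_mulC I J :
  zeta_mul K I J = (-1) ^+ (#|` I| * #|` J|) *: zeta_mul K J I.
Proof.
rewrite /zeta_mul fdisjoint_sym; case: ifPn => [dJI|]; last by rewrite scaler0.
rewrite scalerA fsetUC; congr (_ *: _).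
rewrite -(inversions_sym (I := I)) 1?fdisjoint_sym// exprD -mulrA.
by rewrite -expr2 sqrr_sign mulr1.
Qed.


Lemma gcoef1 I : (1 : G)@_I = (I == fset0)%:R.
Proof. by rewrite -[1 : G]/(zeta K fset0) gcoef_zeta eq_sym. Qed.

End GrassmannCoefficients.

(** * Parity, even and odd parts, body *)

Section Parity.
Variable R : realType.
Local Notation Lam := (Lam R).
Local Notation C := (Cx R).
Implicit Types (a b c : Lam) (k : C) (I J L : {fset nat}).

Lemma is_even0 : is_even (0 : Lam). Proof. by move=> I _; rewrite gcoef0. Qed.
Lemma is_odd0 : is_odd (0 : Lam). Proof. by move=> I _; rewrite gcoef0. Qed.
Lemma is_even1 : is_even (1 : Lam).
Proof.
by move=> I; rewrite gcoef1; case: eqP => // ->; rewrite cardfs0.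
Qed.
Lemma is_evenD a b : is_even a -> is_even b -> is_even (a + b).
Proof. by move=> ea eb I oI; rewrite gcoefD ea ?eb ?addr0. Qed.
Lemma is_oddD a b : is_odd a -> is_odd b -> is_odd (a + b).
Proof. by move=> ea eb I oI; rewrite gcoefD ea ?eb ?addr0. Qed.
Lemma is_evenN a : is_even a -> is_even (- a).
Proof. by move=> ea I oI; rewrite gcoefN ea ?oppr0. Qed.
Lemma is_oddN a : is_odd a -> is_odd (- a).
Proof. by move=> ea I oI; rewrite gcoefN ea ?oppr0. Qed.
Lemma is_evenZ k a : is_even a -> is_even (k *: a).
Proof. by move=> ea I oI; rewrite gcoefZ ea ?mulr0. Qed.
Lemma is_oddZ k a : is_odd a -> is_odd (k *: a).
Proof. by move=> ea I oI; rewrite gcoefZ ea ?mulr0. Qed.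

Lemma gcoefM_eq0 a b I :
  (forall J L, #|` I| = (#|` J| + #|` L|)%N -> a@_J * b@_L = 0) -> (a * b)@_I = 0.
Proof.
move=> h; rewrite gcoefM big1// => J _; rewrite big1// => L _.
have [->|/zeta_mul_coef_card cI] := eqVneq (zeta_mul C J L)@_I 0.
  by rewrite mulr0.
by rewrite h ?mul0r.
Qed.

Lemma is_evenM a b : is_even a -> is_even b -> is_even (a * b).
Proof.
move=> ea eb I oI; apply: gcoefM_eq0 => J L cI; move: oI; rewrite cI oddD.
case oJ : (odd #|` J|) => /= oL; first by rewrite ea ?mul0r.
by rewrite eb ?mulr0.
Qed.
Lemma is_oddM a b : is_odd a -> is_odd b -> is_even (a * b).
Proof.
move=> ea eb I oI; apply: gcoefM_eq0 => J L cI; move: oI; rewrite cI oddD.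
case oJ : (odd #|` J|) => /= oL; first by rewrite eb ?mulr0.
by rewrite ea ?mul0r ?oJ.
Qed.
Lemma is_even_oddM a b : is_even a -> is_odd b -> is_odd (a * b).
Proof.
move=> ea eb I oI; apply: gcoefM_eq0 => J L cI; move: oI; rewrite cI oddD.
case oJ : (odd #|` J|) => /= oL; first by rewrite ea ?mul0r.
by rewrite eb ?mulr0.
Qed.
Lemma is_odd_evenM a b : is_odd a -> is_even b -> is_odd (a * b).
Proof.
move=> ea eb I oI; apply: gcoefM_eq0 => J L cI; move: oI; rewrite cI oddD.
case oJ : (odd #|` J|) => /= oL; first by rewrite eb ?mulr0// -[odd _]negbK.
by rewrite ea ?mul0r ?oJ.
Qed.

Lemma even_comm a b : is_even a -> a * b = b * a.
Proof.
move=> ea; apply/grassmannP => I; rewrite !gcoefM exchange_big /=.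
apply: eq_bigr => J _; apply: eq_bigr => L _.
have [oL|eL] := boolP (odd #|` L|); first by rewrite ea// !(mul0r, mulr0).
by rewrite zeta_mulC -signr_odd oddM (negbTE eL) expr0 scale1r [_ * b@_J]mulrC.
Qed.

Lemma odd_anticomm a b : is_odd a -> is_odd b -> a * b = - (b * a).
Proof.
move=> oa ob; apply/grassmannP => I; rewrite gcoefN !gcoefM exchange_big /=.
rewrite -sumrN; apply: eq_bigr => J _; rewrite -sumrN; apply: eq_bigr => L _.
have [oL|eL] := boolP (odd #|` L|); last by rewrite oa// !(mul0r, mulr0) oppr0.
have [oJ|eJ] := boolP (odd #|` J|); last by rewrite ob// !(mul0r, mulr0) oppr0.
rewrite zeta_mulC -signr_odd oddM oL oJ expr1 scaleN1r gcoefN mulrN.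
by rewrite [_ * b@_J]mulrC.
Qed.

Lemma odd_sqr a : is_odd a -> a * a = 0.
Proof.
move=> oa; have /eqP := odd_anticomm oa oa; rewrite -addr_eq0 -mulr2n.
rewrite -scaler_nat scaler_eq0 => /orP[|/eqP//].
by rewrite pnatr_eq0.
Qed.

Lemma evpart_coef a I : (evpart a)@_I = if odd #|` I| then 0 else a@_I.
Proof.
rewrite /evpart gcoef_sum; under eq_bigr do rewrite gcoefZ gcoef_zeta.
have [oI|eI] := boolP (odd #|` I|).
  rewrite big1// => J eJ; case: (_ =P I) => [JI|]; last by rewrite mulr0.
  by rewrite JI oI in eJ.
have [Ia|Ia] := boolP (I \in msupp a); last first.
  rewrite (mcoeff_outdom Ia) big_seq_cond big1// => J /andP[Ja _].
  by case: (_ =P I) => [JI|_]; [rewrite -JI Ja in Ia|rewrite mulr0].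
rewrite big_mkcond (big_fsetD1 _ Ia) /= eI eqxx mulr1 big_seq_cond big1 ?addr0// => J.
by rewrite !inE => /andP[/andP[/negbTE -> _]]; rewrite mulr0 if_same.
Qed.

Lemma odpart_coef a I : (odpart a)@_I = if odd #|` I| then a@_I else 0.
Proof.
rewrite /odpart gcoef_sum; under eq_bigr do rewrite gcoefZ gcoef_zeta.
have [oI|eI] := boolP (odd #|` I|); last first.
  rewrite big1// => J eJ; case: (_ =P I) => [JI|]; last by rewrite mulr0.
  by rewrite JI (negbTE eI) in eJ.
have [Ia|Ia] := boolP (I \in msupp a); last first.
  rewrite (mcoeff_outdom Ia) big_seq_cond big1// => J /andP[Ja _].
  by case: (_ =P I) => [JI|_]; [rewrite -JI Ja in Ia|rewrite mulr0].
rewrite big_mkcond (big_fsetD1 _ Ia) /= oI eqxx mulr1 big_seq_cond big1 ?addr0// => J.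
by rewrite !inE => /andP[/andP[/negbTE -> _]]; rewrite mulr0 if_same.
Qed.

Lemma is_even_evpart a : is_even (evpart a).
Proof. by move=> I oI; rewrite evpart_coef oI. Qed.
Lemma is_odd_odpart a : is_odd (odpart a).
Proof. by move=> I oI; rewrite odpart_coef (negbTE oI). Qed.

Lemma spoint_parts a : spoint (evpart a) (odpart a) = a.
Proof.
apply/grassmannP => I; rewrite /spoint gcoefD evpart_coef odpart_coef.
by case: ifP; rewrite ?addr0 ?add0r.
Qed.

Lemma evpart_spoint a b : is_even a -> is_odd b -> evpart (spoint a b) = a.
Proof.
move=> ea ob; apply/grassmannP => I; rewrite evpart_coef.
by case: ifPn => oI; [rewrite ea|rewrite /spoint gcoefD ob ?addr0].
Qed.

Lemma odpart_spoint a b : is_even a -> is_odd b -> odpart (spoint a b) = b.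
Proof.
move=> ea ob; apply/grassmannP => I; rewrite odpart_coef.
by case: ifPn => oI; [rewrite /spoint gcoefD ea ?add0r|rewrite ob].
Qed.

Lemma evpart_even a : is_even a -> evpart a = a.
Proof.
move=> ea; rewrite -[X in evpart X]addr0 -/(spoint a 0) evpart_spoint//.
exact: is_odd0.
Qed.
Lemma odpart_odd a : is_odd a -> odpart a = a.
Proof.
move=> ea; rewrite -[X in odpart X]add0r -/(spoint 0 a) odpart_spoint//.
exact: is_even0.
Qed.
Lemma odpart_even a : is_even a -> odpart a = 0.
Proof.
move=> ea; rewrite -[X in odpart X]addr0 -/(spoint a 0) odpart_spoint//.
exact: is_odd0.
Qed.
Lemma evpart_odd a : is_odd a -> evpart a = 0.
Proof.
move=> ea; rewrite -[X in evpart X]add0r -/(spoint 0 a) evpart_spoint//.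
exact: is_even0.
Qed.

Lemma bodyD a b : body (a + b) = body a + body b. Proof. exact: gcoefD. Qed.
Lemma bodyN a : body (- a) = - body a. Proof. exact: gcoefN. Qed.
Lemma bodyB a b : body (a - b) = body a - body b.
Proof. by rewrite bodyD bodyN. Qed.
Lemma bodyZ k a : body (k *: a) = k * body a. Proof. exact: gcoefZ. Qed.
Lemma body_0 : body (0 : Lam) = 0. Proof. exact: gcoef0. Qed.
Lemma body1 : body (1 : Lam) = 1. Proof. by rewrite /body gcoef1 eqxx. Qed.
Lemma bodyM a b : body (a * b) = body a * body b.
Proof.
rewrite /body gcoefM fpowerset0 !big_seq_fset1.
by rewrite -gmulUU gmul1 gcoef_zeta eqxx mulr1.
Qed.
Lemma body_odd a : is_odd a -> body a = 0.
Proof. by move=> oa; apply: oa; rewrite cardfs0. Qed.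
Lemma body_evpart a : body (evpart a) = body a.
Proof. by rewrite /body evpart_coef cardfs0. Qed.
Lemma body_spoint a b : is_odd b -> body (spoint a b) = body a.
Proof. by move=> ob; rewrite /spoint bodyD (body_odd ob) addr0. Qed.

End Parity.

(** * Nilpotent souls and inverses of even elements *)

Section Inverses.
Variable R : realType.
Local Notation Lam := (Lam R).
Local Notation C := (Cx R).
Implicit Types (a b c w : Lam) (k : C) (I J L : {fset nat}).

Lemma is_even_sum (T : Type) (r : seq T) (P : pred T) (F : T -> Lam) :
  (forall t, P t -> is_even (F t)) -> is_even (\sum_(t <- r | P t) F t).
Proof.
by move=> eF; elim/big_ind: _ => //; [exact: is_even0|exact: is_evenD].
Qed.

Lemma is_evenX a n : is_even a -> is_even (a ^+ n).
Proof.
move=> ea; elim: n => [|n IH]; first by rewrite expr0; exact: is_even1.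
by rewrite exprS; exact: is_evenM.
Qed.

(** In the binomial expansion of [F t] plus the remaining sum, terms with [F t] at least twice
    vanish; the other two contain a power of the remaining sum that is 0 by induction. *)
Lemma sum_sqr0_nilpotent (T : Type) (r : seq T) (F : T -> Lam) :
  (forall t, is_even (F t)) -> (forall t, F t * F t = 0) ->
  (\sum_(t <- r) F t) ^+ (size r).+1 = 0.
Proof.
move=> eF F2; elim: r => [|t r IH]; first by rewrite big_nil expr0n.
rewrite big_cons /= exprDn_comm; last exact: even_comm.
rewrite 2!big_ord_recr big1 => [|i _] /=.
  by rewrite [(\sum_(_ <- _) _) ^+ _.+2]exprS IH !(mulr0, mul0rn, addr0).
have -> : ((size r).+2 - i)%N = (size r - i).+2 by rewrite !subSn ?leqW// -ltnS ltn_ord.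
by rewrite 2!exprS mulrA F2 !mul0r mul0rn.
Qed.

Lemma is_even_alg k : is_even (k%:A : Lam).
Proof. by apply: is_evenZ; exact: is_even1. Qed.

Lemma is_even_soul w : is_even w -> is_even (soul w).
Proof. by move=> ew; apply: is_evenD => //; apply: is_evenN; exact: is_even_alg. Qed.

Lemma body_alg k : body (k%:A : Lam) = k.
Proof. by rewrite bodyZ body1 mulr1. Qed.

Lemma zeta_sqr0 I : I != fset0 -> zeta C I * zeta C I = 0.
Proof.
move=> /fset0Pn[i iI]; rewrite -[LHS]/(gmul _ _) gmulUU /zeta_mul; case: ifP => //.
by move=> /fdisjointP/(_ i iI); rewrite iI.
Qed.

(** The sum still runs over all of [msupp w], with a zero term at [fset0], so that the order of
    nilpotency obtained from it is the number of terms used by [taylor]. *)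
Lemma soulE w :
  soul w = \sum_(I <- msupp w) (if I == fset0 then 0 else w@_I *: zeta C I).
Proof.
rewrite /soul {1}[w]grassmannE.
rewrite [X in X - _](eq_bigr (fun I => (if I == fset0 then 0 else w@_I *: zeta C I) +
  (if I == fset0 then w@_I *: zeta C I else 0))); last first.
  by move=> I _; case: ifP; rewrite ?addr0 ?add0r.
rewrite big_split -addrA -[RHS]addr0; congr (_ + _).
apply/eqP; rewrite subr_eq0; apply/eqP.
rewrite -big_mkcond /=.
have [w0|w0] := boolP (fset0 \in msupp w).
  rewrite big_mkcond (big_fsetD1 _ w0) /= big_seq_cond big1 ?addr0// => I.
  by rewrite !inE => /andP[/andP[/negbTE ->]].
rewrite /body (mcoeff_outdom w0) scale0r big_seq_cond big1// => I /andP[Iw /eqP I0].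
by rewrite -I0 Iw in w0.
Qed.

Lemma soul_nilpotent w n : is_even w -> (#|` msupp w| < n)%N -> soul w ^+ n = 0.
Proof.
move=> ew /subnK <-; rewrite exprD soulE.
rewrite [X in _ * X]sum_sqr0_nilpotent ?mulr0// => [I|I].
  case: eqP => _; first exact: is_even0.
  have [oI|eI] := boolP (odd #|` I|).
    by rewrite ew// scale0r; exact: is_even0.
  apply: is_evenZ => J oJ; rewrite gcoef_zeta; case: eqP => // IJ.
  by rewrite IJ oJ in eI.
case: eqP => [_|/eqP I0]; first by rewrite mulr0.
by rewrite -scalerAl -scalerAr zeta_sqr0// !scaler0.
Qed.

(** Geometric series: [w] is [body w] times [1 - x], with [x] a nilpotent multiple of the soul. *)
Lemma mul_even_geometric w N : is_even w -> body w != 0 -> soul w ^+ N = 0 ->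
  w * (\sum_(i < N) ((body w)^-1 * (- (body w)^-1) ^+ i) *: soul w ^+ i) = 1.
Proof.
move=> ew w0 wN; set v := \sum_(i < N) _; set x := (- (body w)^-1) *: soul w.
have xN : x ^+ N = 0 by rewrite exprZn wN scaler0.
have -> : v = (body w)^-1 *: \sum_(i < N) x ^+ i.
  by rewrite scaler_sumr; apply: eq_bigr => i _; rewrite exprZn scalerA.
have wE : w = body w *: (1 - x).
  rewrite /x scalerBr scalerA mulrN mulfV// scaleN1r opprK /soul.
  by rewrite addrC subrK.
rewrite {1}wE -scalerAl -scalerAr scalerA mulfV// scale1r.
by apply: oppr_inj; rewrite -mulNr opprB -subrX1 xN sub0r.
Qed.

Lemma even_unit w : is_even w -> body w != 0 -> w \is a GRing.unit.
Proof.
move=> ew w0; have wv := mul_even_geometric ew w0 (soul_nilpotent ew (ltnSn _)).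
by apply/asboolP; eexists; split; [rewrite -even_comm//; exact: wv|exact: wv].
Qed.

(** The length [N] is free, so that one formula can serve for a whole family of elements [w], as
    differentiation requires. *)
Lemma inv_evenE w N : is_even w -> body w != 0 -> soul w ^+ N = 0 ->
  w^-1 = \sum_(i < N) ((body w)^-1 * (- (body w)^-1) ^+ i) *: soul w ^+ i.
Proof.
move=> ew w0 wN; rewrite -[RHS](mulKr (even_unit ew w0)).
by rewrite mul_even_geometric// mulr1.
Qed.

Lemma is_evenV w : is_even w -> is_even w^-1.
Proof.
move=> ew; have [w0|w0] := eqVneq (body w) 0.
  (* An element of body 0 is not a unit, and [^-1] is the identity on non-units. *)
  rewrite invr_out//; apply/negP => uw.
  by have /eqP := body1 R; rewrite -(mulrV uw) bodyM w0 mul0r eq_sym oner_eq0.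
rewrite (inv_evenE ew w0 (soul_nilpotent ew (ltnSn _))).
by apply: is_even_sum => i _; apply: is_evenZ; apply: is_evenX; exact: is_even_soul.
Qed.

Lemma body_inv w : is_even w -> body w != 0 -> body w^-1 = (body w)^-1.
Proof.
move=> ew w0; apply: (mulfI w0).
by rewrite -bodyM mulrV ?even_unit// body1 mulfV.
Qed.

End Inverses.

(** * Differentiation of Grassmann-valued functions *)

Lemma near_affine_neq0 (K : numFieldType) (c u : K) :
  \forall x \near c, 1 + (x - c) * u != 0.
Proof.
have : {for c, continuous (fun x : K => 1 + (x - c) * u : K)}.
  apply: (@continuousD K K K (cst 1) (fun x : K => (x - c) * u) c) => //.
    exact: cst_continuous.
  apply: (@continuousM K K (fun x : K => x - c) (cst u) c).
    apply: (@continuousB K K K id (cst c) c) => //.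
    exact: cst_continuous.
  exact: cst_continuous.
rewrite /prop_for /continuous_at subrr mul0r addr0 => /cvgr_neq0; apply.
exact: oner_neq0.
Qed.

(** With [u] the body of [(c *: a + b)^-1 * a], these are the scalar factors in the expansion of
    [(x *: a + b)^-1] around [c]. *)
Lemma derivable_geometric_term (K : numFieldType) (c u : K) (i : nat) :
  derivable (fun x : K =>
    (1 + (x - c) * u)^-1 * (- (1 + (x - c) * u)^-1) ^+ i * (x - c) ^+ i) c 1.
Proof.
have dM (f g : K -> K) : derivable f c 1 -> derivable g c 1 ->
    derivable (fun x => f x * g x) c 1 by exact: derivableM.
have dN (f : K -> K) : derivable f c 1 -> derivable (fun x => - f x) c 1.
  exact: derivableN.
have dX (f : K -> K) n : derivable f c 1 -> derivable (fun x => f x ^+ n) c 1.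
  move=> df; elim: n => [|n IH]; first exact: derivable_cst.
  by under eq_fun do rewrite exprS; exact: dM.
have d0 : derivable (fun x : K => x - c) c 1.
  by apply: (@derivableB K K K id (cst c)); [exact: derivable_id|exact: derivable_cst].
have dq : derivable (fun x => 1 + (x - c) * u) c 1.
  apply: (@derivableD K K K (cst 1) (fun x => (x - c) * u)); first exact: derivable_cst.
  by apply: (dM) => //; exact: derivable_cst.
have dV : derivable (fun x => (1 + (x - c) * u)^-1) c 1.
  by apply: derivableV => //; rewrite subrr mul0r addr0 oner_eq0.
apply: (dM); last exact: dX.
by apply: (dM) => //; apply: dX; exact: dN.
Qed.

Section GrassmannDerivative.
Variable R : realType.
Local Notation Lam := (Lam R).
Local Notation C := (Cx R).
Implicit Types (a b d w l : Lam) (c k : C) (I J L : {fset nat}) (f g h : C -> Lam).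

(** The condition that [analytic] imposes between two consecutive derivatives. *)
Definition gderive f c l : Prop := forall I,
  is_derive c (1 : C) (fun x : C => (f x)@_I : C) (l@_I : C).

Lemma gderive_unique f c l l' : gderive f c l -> gderive f c l' -> l = l'.
Proof.
move=> fl fl'; apply/grassmannP => I.
by have [_ <-] := fl I; have [_ <-] := fl' I.
Qed.

Lemma gderive_cst a c : gderive (fun=> a) c 0.
Proof. by move=> I; rewrite gcoef0; exact: is_derive_cst. Qed.

Lemma gderiveD f g c l l' : gderive f c l -> gderive g c l' ->
  gderive (fun x => f x + g x) c (l + l').
Proof.
move=> fl gl I; rewrite gcoefD.
under [X in is_derive _ _ X _]eq_fun do rewrite gcoefD.
exact: is_deriveD.
Qed.

Lemma gderive_alg (k : C -> C) c k' a : is_derive c (1 : C) k k' ->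
  gderive (fun x => k x *: a) c (k' *: a).
Proof.
move=> dk I; rewrite gcoefZ.
under [X in is_derive _ _ X _]eq_fun do rewrite gcoefZ mulrC.
by rewrite mulrC; exact: is_deriveZ.
Qed.

Lemma is_derive_big (T : Type) (r : seq T) (F : T -> C -> C) (F' : T -> C) c :
  (forall t, is_derive c (1 : C) (F t) (F' t)) ->
  is_derive c (1 : C) (fun x => \sum_(t <- r) F t x) (\sum_(t <- r) F' t).
Proof.
move=> dF; elim: r => [|t r IH].
  under [X in is_derive _ _ X _]eq_fun do rewrite big_nil.
  by rewrite big_nil; exact: is_derive_cst.
under [X in is_derive _ _ X _]eq_fun do rewrite big_cons.
by rewrite big_cons; exact: is_deriveD.
Qed.

Lemma gderiveM f g c l l' : gderive f c l -> gderive g c l' ->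
  gderive (fun x => f x * g x) c (l * g c + f c * l').
Proof.
move=> fl gl I; rewrite gcoefD !gcoefM -big_split /=.
under [X in is_derive _ _ X _]eq_fun do rewrite gcoefM.
apply: is_derive_big => J; rewrite -big_split /=; apply: is_derive_big => L.
under [X in is_derive _ _ X _]eq_fun do rewrite mulrC.
rewrite -mulrDl mulrC; apply: is_deriveZ.
apply: is_derive_eq; first exact: (is_deriveM (fl J) (gl L)).
by rewrite addrC; congr (_ + _); exact: mulrC.
Qed.

Lemma gderive_sum (T : Type) (r : seq T) (F : T -> C -> Lam) (F' : T -> Lam) c :
  (forall t, gderive (F t) c (F' t)) ->
  gderive (fun x => \sum_(t <- r) F t x) c (\sum_(t <- r) F' t).
Proof.
move=> dF I; rewrite gcoef_sum.
under [X in is_derive _ _ X _]eq_fun do rewrite gcoef_sum.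
by apply: is_derive_big => t; exact: dF.
Qed.

Lemma near_eq_gderive f g c l : (\near c, f c = g c) ->
  gderive f c l -> gderive g c l.
Proof.
move=> fg fl I; apply: near_eq_is_derive (fl I).
by near=> x; rewrite (near fg x).
Unshelve. all: by end_near. Qed.

Lemma gderive_affine a b c : gderive (fun x => x *: a + b) c a.
Proof.
rewrite -[X in gderive _ _ X]addr0; apply: gderiveD; last exact: gderive_cst.
by rewrite -[X in gderive _ _ X]scale1r; apply: gderive_alg; exact: is_derive_id.
Qed.

Lemma soulZ k w : soul (k *: w) = k *: soul w.
Proof. by rewrite /soul bodyZ scalerBr scalerA. Qed.

Lemma soul_alg k : soul (k%:A : Lam) = 0.
Proof. by rewrite /soul body_alg subrr. Qed.

Lemma soul1 : soul (1 : Lam) = 0.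
Proof. by rewrite -[1 in LHS]scale1r soul_alg. Qed.

Lemma soulD a b : soul (a + b) = soul a + soul b.
Proof. by rewrite /soul bodyD scalerDl opprD addrACA. Qed.

(* The inverse is a finite geometric series in the nilpotent part of
   [(x - c) u], hence derivable; its derivative is read off [D * D^-1 = 1]. *)
Lemma gderive_inv_affine a b c : is_even a -> is_even b -> body (c *: a + b) != 0 ->
  gderive (fun x => (x *: a + b)^-1) c (- (a * (c *: a + b)^-1 ^+ 2)).
Proof.
move=> ea eb; set d := c *: a + b => d0.
have ed : is_even d by apply: is_evenD => //; exact: is_evenZ.
have ud := even_unit ed d0.
set u := d^-1 * a.
have eu : is_even u by apply: is_evenM => //; exact: is_evenV.
have near1 : \forall x \near c, body (1 + (x - c) *: u) != 0.
  near=> x; rewrite bodyD body1 bodyZ; near: x; exact: near_affine_neq0.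
have DE x : x *: a + b = d * (1 + (x - c) *: u).
  rewrite mulrDr mulr1 -scalerAr mulrA mulrV// mul1r /d scalerBl.
  by rewrite [RHS]addrC addrA subrK.
have eW x : is_even (1 + (x - c) *: u).
  by apply: is_evenD; [exact: is_even1|exact: is_evenZ].
(* The soul of [1 + (x - c) *: u] is a scalar multiple of [soul u], so this [N] bounds the length of
   the geometric series for every [x]. *)
set N := #|` msupp u|.+1.
have uN : soul u ^+ N = 0 by apply: soul_nilpotent.
pose q x := (1 + (x - c) * body u : C).
have qE x : body (1 + (x - c) *: u) = q x by rewrite bodyD body1 bodyZ.
pose p (i : nat) x := (q x)^-1 * (- (q x)^-1) ^+ i * (x - c) ^+ i.
have dp i : is_derive c (1 : C) (p i) ('D_1 (p i) c).
  by apply: derivableP; exact: derivable_geometric_term.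
have dl := gderiveM (gderive_cst d^-1 c)
  (gderive_sum (index_enum _) (fun i : 'I_N => gderive_alg (soul u ^+ i) (dp i))).
have {}dl := near_eq_gderive _ dl.
have {dl} [l dl] : exists l, gderive (fun x => (x *: a + b)^-1) c l.
  eexists; apply: dl; near=> x.
  have qx : q x != 0 by rewrite -qE; near: x.
  rewrite DE invrM// ?even_unit ?qE//.
  rewrite [RHS]even_comm; last exact: is_evenV.
  congr (_ * _); rewrite (inv_evenE (N := N)) ?qE//; last first.
    by rewrite soulD soulZ soul1 add0r exprZn uN scaler0.
  apply: eq_bigr => i _.
  by rewrite soulD soulZ soul1 add0r exprZn scalerA.
have near0 : \forall x \near c, 1 = (x *: a + b) * (x *: a + b)^-1.
  near=> x; have qx : q x != 0 by rewrite -qE; near: x.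
  by rewrite mulrV// DE unitrMl// even_unit ?qE.
have := near_eq_gderive near0 (gderive_cst _ _).
move=> /gderive_unique/(_ (gderiveM (gderive_affine a b c) dl)) /esym/eqP.
rewrite addrC addr_eq0 => /eqP dE.
have lE : l = - (a * d^-1 ^+ 2).
  rewrite -[LHS](mulKr ud) dE mulrN; congr (- _).
  rewrite [LHS]even_comm; last exact: is_evenV.
  by rewrite expr2 mulrA.
by rewrite -lE.
Unshelve. all: by end_near. Qed.

End GrassmannDerivative.

(** * Superconformal Moebius maps *)

Section Jets.
Variable R : realType.
Local Notation Lam := (Lam R).
Local Notation C := (Cx R).
Implicit Types (a b d e w : Lam) (c : C) (V : set C) (f g h : nat -> C -> Lam).

(** An analytic function is given with all its derivatives, so a product has to supply them too. *)
Definition leibniz f g : nat -> C -> Lam := fun n c =>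
  \sum_(k < n.+1) 'C(n, k)%:R *: (f k c * g (n - k)%N c).

Lemma gderiveZ k (F : C -> Lam) c l :
  gderive F c l -> gderive (fun x => k *: F x) c (k *: l).
Proof.
move=> dF; have := gderiveM (gderive_cst k%:A c) dF.
rewrite mul0r add0r mulr_algl; congr gderive.
by apply/funext => x; rewrite mulr_algl.
Qed.

(** The product rule in each term, regrouped by Pascal's rule. *)
Lemma analytic_leibniz V f g :
  analytic V f -> analytic V g -> analytic V (leibniz f g).
Proof.
move=> af ag n c Vc; pose F k := f k c; pose G k := g k c.
have -> : leibniz f g n.+1 c = \sum_(k < n.+1)
    'C(n, k)%:R *: (F k.+1 * G (n - k)%N + F k * G (n - k).+1).
  under [RHS]eq_bigr do rewrite scalerDr.
  rewrite big_split /= /leibniz big_ord_recl bin0 subn0 /=.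
  under eq_bigr => i _.
    rewrite /bump /= ?add1n binS natrD scalerDl subSS; over.
  rewrite big_split /= addrA addrC; congr (_ + _).
  rewrite big_ord_recr /= bin_small// scale0r addr0.
  rewrite [RHS]big_ord_recl bin0 subn0; congr (_ + _).
  by apply: eq_bigr => i _; rewrite /bump /= ?add1n subnSK.
apply: gderive_sum => k; apply: gderiveZ; apply: gderiveM.
  exact: af.
exact: ag.
Qed.

Lemma taylorE f w M : is_even w -> (#|` msupp w| < M)%N ->
  taylor f w = \sum_(n < M) (n`!%:R)^-1 *: (f n (body w) * soul w ^+ n).
Proof.
move=> ew wM; rewrite /taylor -(subnKC wM) big_split_ord /= [X in _ + X]big1 ?addr0// => i _.
by rewrite soul_nilpotent ?mulr0 ?scaler0// leq_addr.
Qed.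

(** Taylor extensions are values at the soul of polynomials over the algebra. The soul commutes with
    everything, so evaluation is multiplicative, and being nilpotent it kills the part of the
    product polynomial beyond the truncation. *)
Lemma taylor_leibniz f g w : is_even w ->
  taylor (leibniz f g) w = taylor f w * taylor g w.
Proof.
move=> ew; set s := soul w; set N := #|` msupp w|.+1.
pose F f := \poly_(n < N) ((n`!%:R)^-1 *: f n (body w)).
have FE h : taylor h w = (F h).[s].
  by rewrite horner_poly; apply: eq_bigr => i _; rewrite scalerAl.
have es : is_even s by exact: is_even_soul.
rewrite (FE f) (FE g) -hornerM_comm; last exact: even_comm.
have szFG : (size (F f * F g)%R <= N + N)%N.
  apply: leq_trans (size_polyMleq _ _) _; apply: leq_trans (leq_pred _) _.
  by apply: leq_add; exact: size_poly.
rewrite (horner_coef_wide _ szFG) big_split_ord /= [X in _ = _ + X]big1 ?addr0; last first.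
  by move=> i _; rewrite [s ^+ _]soul_nilpotent ?mulr0// leq_addr.
apply: eq_bigr => n _; rewrite coefM scalerAl; congr (_ * _).
rewrite /leibniz scaler_sumr; apply: eq_bigr => k _.
have kN : (k < N)%N := leq_trans (ltn_ord k) (ltn_ord n).
have nkN : (n - k < N)%N := leq_ltn_trans (leq_subr _ _) (ltn_ord n).
rewrite !coef_poly kN nkN.
rewrite -scalerAl -scalerAr !scalerA; congr (_ *: _).
have kn : (k <= n)%N by rewrite -ltnS.
have nF m : (m`!%:R : C) != 0 by rewrite pnatr_eq0 -lt0n fact_gt0.
by rewrite -(bin_fact kn) !natrM; field; rewrite !nF pnatr_eq0 -lt0n bin_gt0 kn.
Qed.

Definition linjet a b : nat -> C -> Lam := fun n c =>
  if n is m.+1 then (if m is 0%N then a else 0) else c *: a + b.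

Lemma analytic_linjet V a b : analytic V (linjet a b).
Proof.
move=> [|[|n]] c _; first exact: gderive_affine.
  exact: gderive_cst.
exact: gderive_cst.
Qed.

Lemma taylor_linjet a b w : is_even w -> taylor (linjet a b) w = w * a + b.
Proof.
move=> ew; rewrite (taylorE _ ew (leqnSn _)) 2!big_ord_recl big1 => [|i _] /=.
  rewrite addr0 expr0 mulr1 expr1 fact0 /bump /= invr1 !scale1r.
  rewrite addrAC -(even_comm a (is_even_soul ew)); congr (_ + _).
  by rewrite -mulr_algl -mulrDl addrC /soul subrK.
by rewrite mul0r scaler0.
Qed.

Definition invjet a b : nat -> C -> Lam := fun n c =>
  ((-1) ^+ n * n`!%:R) *: (a ^+ n * (c *: a + b)^-1 ^+ n.+1).

Lemma gderive_invX a b c n : is_even a -> is_even b -> body (c *: a + b) != 0 ->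
  gderive (fun x => (x *: a + b)^-1 ^+ n) c (- n%:R *: (a * (c *: a + b)^-1 ^+ n.+1)).
Proof.
move=> ea eb d0; elim: n => [|n IH].
  rewrite oppr0 scale0r; under [X in gderive X _ _]eq_fun do rewrite expr0.
  exact: gderive_cst.
under [X in gderive X _ _]eq_fun do rewrite exprS.
have := gderiveM (gderive_inv_affine ea eb d0) IH; congr gderive.
rewrite /=; set h := (c *: a + b)^-1.
have eh : is_even h by apply: is_evenV; apply: is_evenD => //; exact: is_evenZ.
have hE : h * (a * h ^+ n.+1) = a * h ^+ n.+2.
  by rewrite mulrA (even_comm a eh) -mulrA -exprS.
rewrite -[- _ * _](_ : - (a * h ^+ n.+2) = _); last first.
  by rewrite mulNr -!mulrA -!exprS.
rewrite -scalerAr hE -scaleN1r -scalerDl; congr (_ *: _).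
by rewrite mulrS opprD.
Qed.

Lemma analytic_invjet V a b : is_even a -> is_even b ->
  (forall c, V c -> body (c *: a + b) != 0) -> analytic V (invjet a b).
Proof.
move=> ea eb Vd n c Vc.
have := gderiveZ ((-1) ^+ n * n`!%:R)
  (gderiveM (gderive_cst (a ^+ n) c) (gderive_invX n.+1 ea eb (Vd c Vc))).
congr gderive; rewrite mul0r add0r -scalerAr scalerA /invjet mulrA -exprSr.
by congr (_ *: _); rewrite factS natrM exprS; ring.
Qed.

(** The value is not summed from the series: it is forced by multiplicativity of [taylor], applied
    to [D * D^-1 = 1]. *)
Lemma taylor_invjet a b w : is_even a -> is_even b -> is_even w ->
  body (w * a + b) != 0 -> taylor (invjet a b) w = (w * a + b)^-1.
Proof.
move=> ea eb ew d0; set d := w * a + b.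
have ed : is_even d by apply: is_evenD => //; exact: is_evenM.
set x := body w; have xE : body (x *: a + b) = body d.
  by rewrite bodyD bodyZ bodyD bodyM.
have exd : is_even (x *: a + b) by apply: is_evenD => //; exact: is_evenZ.
have uxd : x *: a + b \is a GRing.unit by rewrite even_unit// xE.
set D := x *: a + b in exd uxd *.
(* The Leibniz product of the two jets is the jet of 1. *)
have lin_inv n : leibniz (linjet a b) (invjet a b) n.+1 x = 0.
  rewrite /leibniz 2!big_ord_recl big1 => [|j _]; last by rewrite /= mul0r scaler0.
  rewrite addr0 /= /bump /= ?add1n subn0 subSS subn0 bin0 bin1 /invjet -/D scale1r.
  set t := a ^+ n.+1 * D^-1 ^+ n.+1.
  have -> : D * (((-1) ^+ n.+1 * n.+1`!%:R) *: (a ^+ n.+1 * D^-1 ^+ n.+2)) =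
      (- ((-1) ^+ n * n.+1`!%:R)) *: t.
    rewrite -scalerAr exprS mulN1r mulNr; congr (_ *: _).
    rewrite mulrA (even_comm (a ^+ n.+1) exd) -mulrA; congr (_ * _).
    by rewrite [D^-1 ^+ n.+2]exprS mulVKr.
  have -> : a * (((-1) ^+ n * n`!%:R) *: (a ^+ n * D^-1 ^+ n.+1)) =
      ((-1) ^+ n * n`!%:R) *: t.
    by rewrite -scalerAr mulrA -exprS.
  rewrite scalerA -scalerDl factS natrM.
  by rewrite [X in X *: _](_ : _ = 0) ?scale0r//; ring.
have : taylor (leibniz (linjet a b) (invjet a b)) w = 1.
  rewrite /taylor big_ord_recl big1 => [|i _].
    rewrite addr0 /leibniz big_ord1 subnn /= /invjet !expr0 expr1 mulr1 mul1r fact0.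
    by rewrite invr1 !scale1r mul1r -/x mulrV.
  by rewrite -/x lin_inv mul0r scaler0.
rewrite taylor_leibniz// taylor_linjet// -/d => dv.
by rewrite -[LHS](mulKr (even_unit ed d0)) dv mulr1.
Qed.

End Jets.

Section Mobius.
Variable R : realType.
Local Notation Lam := (Lam R).
Local Notation C := (Cx R).
Implicit Types (V : set C).

(** The superconformal function with [f = (w a + b) / D], [psi = (w gam + del) / D], [g = e / D] and
    [xi = g psi], where [D = w c + d]. Translations and their composites with [I] have this form. *)
Definition mobius (a b c d gam del e p : Lam) : Lam :=
  let w := evpart p in let rho := odpart p in
  let D := (w * c + d)^-1 in
  spoint ((w * a + b) * D + rho * (e * D * ((w * gam + del) * D)))
         ((w * gam + del) * D + rho * (e * D)).

Variables (a b c d gam del e : Lam).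
Hypotheses (ea : is_even a) (eb : is_even b) (ec : is_even c) (ed : is_even d)
  (ogam : is_odd gam) (odel : is_odd del) (ee : is_even e).
Hypothesis e2 : e ^+ 2 = a * d - b * c + del * gam.
Hypothesis e0 : body e != 0.

(** Here [f' = (a d - b c) / D^2], and [psi psi' = del gam / D^2] because odd elements square to 0;
    so hypothesis [e2] is exactly [g^2 = f' + psi psi']. *)
Lemma superconformal_mobius V :
  (forall x, V x -> body (x *: c + d) != 0) ->
  superconformal V (mobius a b c d gam del e).
Proof.
move=> Vd.
pose inv := invjet c d.
pose f := leibniz (linjet a b) inv; pose psi := leibniz (linjet gam del) inv.
pose g := leibniz (linjet 0 e) inv; pose xi := leibniz g psi.
have ainv : analytic V inv by exact: analytic_invjet.
have af : analytic V f by apply: analytic_leibniz => //; exact: analytic_linjet.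
have apsi : analytic V psi by apply: analytic_leibniz => //; exact: analytic_linjet.
have ag : analytic V g by apply: analytic_leibniz => //; exact: analytic_linjet.
have leib0 (F G : nat -> C -> Lam) x : leibniz F G 0%N x = F 0%N x * G 0%N x.
  by rewrite /leibniz big_ord1 subnn bin0 scale1r.
have inv0 x : inv 0%N x = (x *: c + d)^-1.
  by rewrite /inv /invjet expr0 mul1r expr0 mul1r expr1 fact0 scale1r.
have eD x : is_even (x *: c + d) by apply: is_evenD => //; exact: is_evenZ.
have eDV x : is_even (x *: c + d)^-1 by exact: is_evenV.
have eN x : is_even (x *: a + b) by apply: is_evenD => //; exact: is_evenZ.
have oP x : is_odd (x *: gam + del) by apply: is_oddD => //; exact: is_oddZ.
have g0 x : g 0%N x = e * (x *: c + d)^-1.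
  by rewrite [LHS]leib0 inv0 /= scaler0 add0r.
have tinv w : is_even w -> V (body w) -> taylor inv w = (w * c + d)^-1.
  move=> ew Vw; apply: taylor_invjet => //.
  by have := Vd _ Vw; rewrite !bodyD bodyZ bodyM.
have tf w : is_even w -> V (body w) -> taylor f w = (w * a + b) * (w * c + d)^-1.
  by move=> ew Vw; rewrite taylor_leibniz// taylor_linjet// tinv.
have tpsi w : is_even w -> V (body w) ->
    taylor psi w = (w * gam + del) * (w * c + d)^-1.
  by move=> ew Vw; rewrite taylor_leibniz// taylor_linjet// tinv.
have tg w : is_even w -> V (body w) -> taylor g w = e * (w * c + d)^-1.
  by move=> ew Vw; rewrite taylor_leibniz// taylor_linjet// tinv// mulr0 add0r.
exists f, xi, psi, g; split.
- by split => //; apply: analytic_leibniz.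
- by [].
- move=> x Vx; split.
  + by rewrite [f _ _]leib0 inv0; apply: is_evenM; [exact: eN|exact: eDV].
  + rewrite [xi _ _]leib0 g0 [psi _ _]leib0 inv0; apply: is_even_oddM.
      by apply: is_evenM => //; exact: eDV.
    by apply: is_odd_evenM; [exact: oP|exact: eDV].
  + by rewrite [psi _ _]leib0 inv0; apply: is_odd_evenM; [exact: oP|exact: eDV].
  + by rewrite g0; apply: is_evenM => //; exact: eDV.
- move=> p Vp w rho.
  have ew : is_even w by exact: is_even_evpart.
  have Vw : V (body w) by rewrite body_evpart.
  by rewrite /mobius tf// taylor_leibniz// tg// tpsi.
- split.
  + by move=> x Vx; rewrite [LHS]leib0.
  + move=> x Vx; set N := x *: a + b; set D := x *: c + d; set P := x *: gam + del.
    have uD : D \is a GRing.unit by apply: even_unit; [exact: eD|exact: Vd].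
    have leib1 (F : nat -> C -> Lam) : leibniz F inv 1%N x =
        F 1%N x * D^-1 - F 0%N x * (c * D^-1 ^+ 2).
      rewrite /leibniz 2!big_ord_recl big_ord0 addr0 /= /bump /= ?add1n subn0 subnn.
      rewrite bin0 binn !scale1r inv0 /inv /invjet expr1 addrC; congr (_ + _).
      by rewrite mulr1 scaleN1r mulrN expr1.
    rewrite g0 [f 1 _]leib1 [psi 1 _]leib1 [psi 0 _]leib0 inv0 /= -/N -/D -/P.
    set D' := D^-1; have eD' : is_even D' by exact: eDV.
    have -> : (e * D') ^+ 2 = e ^+ 2 * D' ^+ 2.
      by rewrite exprMn_comm//; exact: even_comm.
    have -> : a * D' = a * D * D' ^+ 2 by rewrite expr2 mulrA mulrK.
    have -> : P * D' * (gam * D' - P * (c * D' ^+ 2)) = P * gam * D' ^+ 2.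
      rewrite -(even_comm P eD') mulrBr.
      rewrite [_ * _ * (P * _)]mulrA -[D' * P * P]mulrA odd_sqr//; last exact: oP.
      rewrite mulr0 mul0r subr0 mulrA -[D' * P * gam]mulrA (even_comm _ eD').
      by rewrite -[LHS]mulrA -expr2.
    rewrite [N * (c * _)]mulrA -mulrBl -mulrDl e2; congr (_ * _).
    rewrite /D /N /P !mulrDl !mulrDr -!scalerAl -!scalerAr (odd_sqr ogam) scaler0 add0r.
    by rewrite opprD addrACA subrr add0r.
  (* At a point without soul the odd coordinate is 0 and only [g = e / D] remains, whose body is
     nonzero. *)
  + move=> [x Vx]; exists (x%:A); first by rewrite /dewitt /= body_alg.
    rewrite odpart_even; last exact: is_even_alg.
    rewrite mul0r addr0 evpart_even; last exact: is_even_alg.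
    rewrite tg ?body_alg//; last exact: is_even_alg.
    rewrite mulr_algl; apply/eqP => h.
    have /eqP := congr1 (@body R) h; rewrite bodyM body_0 mulf_eq0 (negbTE e0) /=.
    by rewrite body_inv ?Vd// invr_eq0 (negbTE (Vd _ Vx)).
Qed.

End Mobius.

(* Identities between linear combinations hold if they hold coefficientwise. *)
Ltac glin := apply/grassmannP => ?; rewrite ?(gcoefD, gcoefN, gcoefZ, gcoef0); ring.

(** * Translations and inversion in coordinates *)

Section Translations.
Variable R : realType.
Local Notation Lam := (Lam R).
Local Notation C := (Cx R).
Implicit Types (a p q : Lam) (u : C).

Lemma inv_add_sqr0 (d n : Lam) : is_even d -> is_even n -> body d != 0 ->
  n * n = 0 -> (d + n)^-1 = d^-1 - n * (d^-1 * d^-1).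
Proof.
move=> ed en d0 n2; have ud := even_unit ed d0.
have bn : body n = 0.
  by apply/eqP; have /eqP := congr1 (@body R) n2; rewrite bodyM body_0 mulf_eq0 orbb.
have udn : d + n \is a GRing.unit.
  by apply: even_unit; [exact: is_evenD|rewrite bodyD bn addr0].
rewrite -[RHS](mulKr udn) [X in _ * X](_ : _ = 1) ?mulr1//.
rewrite mulrBr !mulrDl mulrV// [n * (n * _)]mulrA n2 mul0r addr0.
rewrite [d * (n * _)]mulrA (even_comm n ed) -mulrA mulrA mulrA.
by rewrite -[n * d * _]mulrA mulrV// mulr1 addrK.
Qed.

Lemma odd_mul_sqr0 a p : is_odd a -> is_odd p -> a * p * (a * p) = 0.
Proof.
move=> oa op; rewrite {1}(odd_anticomm oa op) mulNr -mulrA [a * (a * p)]mulrA.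
by rewrite odd_sqr// mul0r mulr0 oppr0.
Qed.

(** The product [r t] is annihilated by [r - t], so it may be dropped from the denominator. *)
Lemma odd_sub_mul_inv (d r t : Lam) : is_even d -> body d != 0 ->
  is_odd r -> is_odd t -> (r - t) * (d - r * t)^-1 = (r - t) * d^-1.
Proof.
move=> ed d0 or ot; rewrite inv_add_sqr0 ?mulrNN ?odd_mul_sqr0//; last first.
  by apply: is_evenN; exact: is_oddM.
rewrite mulNr opprK mulrDr mulrA (_ : (r - t) * (r * t) = 0) ?mul0r ?addr0//.
rewrite mulrBl mulrA odd_sqr// mul0r sub0r (odd_anticomm or ot) mulrN opprK.
by rewrite mulrA odd_sqr// mul0r.
Qed.

(** A common form of [I] ([u = i]) and of its inverse ([u = -i]). *)
Definition sinv_scaled u a : Lam :=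
  spoint (evpart a)^-1 (u *: (odpart a * (evpart a)^-1)).

Lemma is_even_evpart_shift p a :
  is_even (evpart a - evpart p - odpart a * odpart p).
Proof.
apply: is_evenD; last by apply: is_evenN; apply: is_oddM; exact: is_odd_odpart.
by apply: is_evenD; [|apply: is_evenN]; exact: is_even_evpart.
Qed.

Lemma evpart_sshift p a :
  evpart (sshift p a) = evpart a - evpart p - odpart a * odpart p.
Proof.
rewrite /sshift evpart_spoint//; first exact: is_even_evpart_shift.
by apply: is_oddD; [|apply: is_oddN]; exact: is_odd_odpart.
Qed.

Lemma odpart_sshift p a : odpart (sshift p a) = odpart a - odpart p.
Proof.
rewrite /sshift odpart_spoint//; first exact: is_even_evpart_shift.
by apply: is_oddD; [|apply: is_oddN]; exact: is_odd_odpart.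
Qed.

Lemma body_sshift p a : body (sshift p a) = body a - body p.
Proof.
rewrite -body_evpart evpart_sshift !bodyB !body_evpart bodyM.
by rewrite (body_odd (is_odd_odpart _)) mul0r subr0.
Qed.

Lemma evpart_sinv_scaled u a : evpart (sinv_scaled u a) = (evpart a)^-1.
Proof.
rewrite evpart_spoint//; first exact/is_evenV/is_even_evpart.
apply: is_oddZ; apply: is_odd_evenM; first exact: is_odd_odpart.
exact/is_evenV/is_even_evpart.
Qed.

Lemma odpart_sinv_scaled u a :
  odpart (sinv_scaled u a) = u *: (odpart a * (evpart a)^-1).
Proof.
rewrite odpart_spoint//; first exact/is_evenV/is_even_evpart.
apply: is_oddZ; apply: is_odd_evenM; first exact: is_odd_odpart.
exact/is_evenV/is_even_evpart.
Qed.

Lemma body_sinv_scaled u a : body a != 0 -> body (sinv_scaled u a) = (body a)^-1.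
Proof.
move=> a0; rewrite -body_evpart evpart_sinv_scaled body_inv ?body_evpart//.
exact: is_even_evpart.
Qed.

Lemma sshift_mobius p a :
  sshift p a = mobius 1 (- evpart p) 0 1 0 (- odpart p) 1 a.
Proof.
rewrite /mobius /sshift !mulr0 !add0r invr1 !mulr1 !mul1r mulrN.
by rewrite [- odpart p + _]addrC.
Qed.

Lemma sinv_sshift_mobius u p a : u ^+ 2 = -1 -> body a != body p ->
  sinv_scaled u (sshift p a) =
  mobius 0 1 1 (- evpart p) 0 (- (u *: odpart p)) u%:A a.
Proof.
move=> u2 ap; rewrite /sinv_scaled evpart_sshift odpart_sshift.
set w := evpart a; set z := evpart p; set r := odpart a; set t := odpart p.
have ew : is_even w := is_even_evpart _; have ez : is_even z := is_even_evpart _.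
have or : is_odd r := is_odd_odpart _; have ot : is_odd t := is_odd_odpart _.
have ed : is_even (w - z) by apply: is_evenD => //; exact: is_evenN.
have d0 : body (w - z) != 0 by rewrite bodyB !body_evpart subr_eq0.
rewrite odd_sub_mul_inv// /mobius -/w -/r !mulr0 mulr1 !add0r mul1r; set D := (w - z)^-1.
have eD : is_even D by exact: is_evenV.
congr spoint; last first.
  by rewrite mulr_algl mulNr -scalerAl -scalerAr -scalerN -scalerDr mulrBl addrC.
rewrite inv_add_sqr0//; last 2 first.
- by apply: is_evenN; exact: is_oddM.
- by rewrite mulrNN odd_mul_sqr0.
rewrite mulNr opprK; congr (_ + _).
rewrite mulr_algl mulNr -!scalerAl mulrN scalerN mulrN -!scalerAr scalerA -[u * u]expr2.
rewrite u2 scaleN1r opprK.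
by rewrite [D * (t * D)]mulrA (even_comm t eD) -!mulrA.
Qed.

Lemma sshift_sinv_mobius p q : body q != 0 ->
  sshift p (sinv q) =
  mobius (- evpart p) 1 1 0 (- odpart p) 0 'i%:A q.
Proof.
move=> q0; rewrite /sshift evpart_sinv_scaled odpart_sinv_scaled /mobius.
set w := evpart q; set z := evpart p; set r := odpart q; set t := odpart p.
have ew : is_even w := is_even_evpart _; have ez : is_even z := is_even_evpart _.
have or : is_odd r := is_odd_odpart _; have ot : is_odd t := is_odd_odpart _.
have uw : w \is a GRing.unit by apply: even_unit => //; rewrite body_evpart.
rewrite !mulr1 !addr0; set D := w^-1.
have eD : is_even D by exact: is_evenV.
have wtD : w * - t * D = - t.
  by rewrite (even_comm _ ew) -mulrA mulrV// mulr1.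
have -> : (w * - z + 1) * D = D - z.
  by rewrite mulrDl mul1r (even_comm _ ew) -mulrA mulrV// mulr1 addrC.
rewrite wtD mulr_algl; congr spoint.
  congr (_ + _); rewrite -!scalerAl mulrN scalerN mulrN -scalerAr; congr (- (_ *: _)).
  by rewrite mulrA.
by rewrite -scalerAr addrC.
Qed.

(* [I^-1 o s_p o I], extended over the point at infinity *)
Definition shift_oo p : Lam -> Lam :=
  mobius 1 0 (- evpart p) 1 ('i *: odpart p) 0 1.

(** In [mobius] the odd variable stays out of the denominator. Absorbing it gives this common
    denominator of both components, for which composition is a computation with numerators and
    denominators. *)
Definition shift_den p q : Lam :=
  1 - evpart p * evpart q - 'i *: (odpart q * odpart p).

(** The term [i r t] of the denominator has square 0. To first order it yields the odd correction of
    the even component, and it does not affect the odd component, since [(r + i t w) r t = 0]. *)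
Lemma shift_ooE p q : body (shift_den p q) != 0 ->
  shift_oo p q = spoint (evpart q * (shift_den p q)^-1)
    ((odpart q + 'i *: (odpart p * evpart q)) * (shift_den p q)^-1).
Proof.
rewrite /shift_den /shift_oo /mobius.
set w := evpart q; set z := evpart p; set r := odpart q; set t := odpart p.
have ew : is_even w := is_even_evpart _; have ez : is_even z := is_even_evpart _.
have or : is_odd r := is_odd_odpart _; have ot : is_odd t := is_odd_odpart _.
have ed : is_even (1 - z * w).
  by apply: is_evenD; [exact: is_even1|apply: is_evenN; exact: is_evenM].
rewrite bodyB bodyZ bodyM (body_odd or) mul0r mulr0 subr0 => d0.
rewrite !addr0 !mul1r !mulr1 mulrN (even_comm z ew) [_ + 1]addrC; set d := 1 - z * w.
rewrite (@inv_add_sqr0 d (- ('i *: (r * t))))//; last 2 first.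
- by apply: is_evenN; apply: is_evenZ; exact: is_oddM.
- by rewrite mulrNN -scalerAl -scalerAr odd_mul_sqr0// !scaler0.
set D := d^-1; have eD : is_even D by exact: is_evenV.
rewrite mulNr opprK -(scalerAr _ w t) -!scalerAl.
congr spoint.
  rewrite mulrDr -!scalerAr; congr (_ + _ *: _).
  rewrite (even_comm t ew) -[t * w * D]mulrA [D * (t * _)]mulrA (even_comm t eD).
  rewrite -[t * D * _]mulrA [D * (w * D)]mulrA (even_comm w eD) -[w * D * D]mulrA.
  by rewrite [LHS]mulrA [LHS]mulrA -(even_comm (r * t) ew) -mulrA.
rewrite mulrDr -scalerAr [X in _ = _ + X](_ : _ = 0) ?addr0.
  by rewrite mulrDl -scalerAl (even_comm t ew) addrC.
rewrite mulrA [X in X * _](_ : _ = 0) ?mul0r ?scaler0//.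
rewrite mulrDl mulrA odd_sqr// mul0r add0r -scalerAl -mulrA (odd_anticomm or ot).
by rewrite mulrA -(even_comm t ew) -mulrA mulrN [t * (t * r)]mulrA odd_sqr// mul0r
  oppr0 mulr0 scaler0.
Qed.

Lemma is_even_shift_den p q : is_even (shift_den p q).
Proof.
apply: is_evenD; last first.
  by apply: is_evenN; apply: is_evenZ; apply: is_oddM; exact: is_odd_odpart.
apply: is_evenD; [exact: is_even1|apply: is_evenN; apply: is_evenM];
  exact: is_even_evpart.
Qed.

Lemma body_shift_den p q : body (shift_den p q) = 1 - body p * body q.
Proof.
rewrite !bodyB body1 bodyZ !bodyM !body_evpart (body_odd (is_odd_odpart _)).
by rewrite mul0r mulr0 subr0.
Qed.

Lemma is_odd_shift_num p q : is_odd (odpart q + 'i *: (odpart p * evpart q)).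
Proof.
apply: is_oddD; first exact: is_odd_odpart.
by apply: is_oddZ; apply: is_odd_evenM; [exact: is_odd_odpart|exact: is_even_evpart].
Qed.

Lemma evpart_shift_oo p q : body (shift_den p q) != 0 ->
  evpart (shift_oo p q) = evpart q * (shift_den p q)^-1.
Proof.
move=> /shift_ooE ->; rewrite evpart_spoint//.
  by apply: is_evenM; [exact: is_even_evpart|exact/is_evenV/is_even_shift_den].
by apply: is_odd_evenM; [exact: is_odd_shift_num|exact/is_evenV/is_even_shift_den].
Qed.

Lemma odpart_shift_oo p q : body (shift_den p q) != 0 ->
  odpart (shift_oo p q) =
  (odpart q + 'i *: (odpart p * evpart q)) * (shift_den p q)^-1.
Proof.
move=> /shift_ooE ->; rewrite odpart_spoint//.
  by apply: is_evenM; [exact: is_even_evpart|exact/is_evenV/is_even_shift_den].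
by apply: is_odd_evenM; [exact: is_odd_shift_num|exact/is_evenV/is_even_shift_den].
Qed.

Lemma body_shift_oo p q : body (shift_den p q) != 0 ->
  body (shift_oo p q) = body q * (1 - body p * body q)^-1.
Proof.
move=> d0; rewrite -body_evpart evpart_shift_oo// bodyM body_evpart body_inv//.
  by rewrite body_shift_den.
exact: is_even_shift_den.
Qed.

Definition spt_add p p' : Lam :=
  spoint (evpart p + evpart p' + odpart p' * odpart p) (odpart p + odpart p').

Lemma evpart_spt_add p p' :
  evpart (spt_add p p') = evpart p + evpart p' + odpart p' * odpart p.
Proof.
have ev := is_even_evpart; have od := is_odd_odpart.
rewrite evpart_spoint//; last exact: is_oddD.
by apply: is_evenD; [exact: is_evenD|exact: is_oddM].
Qed.

Lemma odpart_spt_add p p' : odpart (spt_add p p') = odpart p + odpart p'.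
Proof.
have ev := is_even_evpart; have od := is_odd_odpart.
rewrite odpart_spoint//; last exact: is_oddD.
by apply: is_evenD; [exact: is_evenD|exact: is_oddM].
Qed.

Lemma body_spt_add p p' : body (spt_add p p') = body p + body p'.
Proof.
rewrite -body_evpart evpart_spt_add !bodyD !body_evpart bodyM.
by rewrite (body_odd (is_odd_odpart _)) mul0r addr0.
Qed.

Lemma sshift_comp p p' a : sshift p' (sshift p a) = sshift (spt_add p p') a.
Proof.
rewrite /(sshift p') /(sshift (spt_add _ _)) evpart_sshift odpart_sshift.
rewrite evpart_spt_add odpart_spt_add; congr spoint; last by rewrite opprD addrA.
rewrite mulrBl mulrDr (odd_anticomm (is_odd_odpart p) (is_odd_odpart p')).
set x := odpart a * _; set y := odpart a * _; set v := odpart p' * _.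
by glin.
Qed.

(** The denominators form a cocycle: they multiply under composition of translations. *)
Lemma shift_den_comp p p' q : body (shift_den p q) != 0 ->
  shift_den p' (shift_oo p q) * shift_den p q = shift_den (spt_add p p') q.
Proof.
move=> d0; have ud := even_unit (@is_even_shift_den p q) d0.
rewrite {1}/shift_den evpart_shift_oo// odpart_shift_oo//.
set G := shift_den p q in d0 ud *; have eG : is_even G^-1 by exact/is_evenV/is_even_shift_den.
have -> (x y : Lam) : (1 - x * (evpart q * G^-1) - 'i *: (y * G^-1 * odpart p')) * G =
    G - x * evpart q - 'i *: (y * odpart p').
  rewrite !mulrBl mul1r -scalerAl [x * (_ * _)]mulrA mulrVK//.
  by rewrite -[y * _ * _]mulrA (even_comm (odpart p') eG) mulrA mulrVK.
rewrite /G /shift_den evpart_spt_add odpart_spt_add.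
set w := evpart q; set r := odpart q; set t := odpart p; set t' := odpart p'.
have ew : is_even w := is_even_evpart _.
have ot : is_odd t := is_odd_odpart _; have ot' : is_odd t' := is_odd_odpart _.
rewrite [in RHS]mulrDr !mulrDl -!scalerAl -[t * w * t']mulrA (even_comm t' ew).
rewrite [t * (t' * w)]mulrA (odd_anticomm ot ot') mulNr !scalerDr !scalerN scalerA.
(* The two factors [i], one from each odd translation, produce the summand [theta' theta] of
   [spt_add]. *)
rewrite -expr2 sqrCi scaleN1r; glin.
Qed.

(** Over infinity all the denominators have body 1. At the other points of the sphere, translations
    are composed in the chart [Delta]. *)
Lemma shift_oo_comp p p' q : body q = 0 ->
  shift_oo p' (shift_oo p q) = shift_oo (spt_add p p') q.
Proof.
move=> q0; have d1 p1 q1 : body q1 = 0 -> body (shift_den p1 q1) != 0.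
  by move=> q10; rewrite body_shift_den q10 mulr0 subr0 oner_neq0.
have dq : body (shift_den p q) != 0 by exact: d1.
have dq' : body (shift_den p' (shift_oo p q)) != 0.
  by rewrite d1// body_shift_oo// q0 mul0r.
have dq'' : body (shift_den (spt_add p p') q) != 0 by exact: d1.
have uG := even_unit (@is_even_shift_den p q) dq.
have uG' := even_unit (@is_even_shift_den p' _) dq'.
have GE : (shift_den p q)^-1 * (shift_den p' (shift_oo p q))^-1 =
    (shift_den (spt_add p p') q)^-1.
  by rewrite -invrM// shift_den_comp.
rewrite (shift_ooE dq') (shift_ooE dq'') evpart_shift_oo// odpart_shift_oo//.
rewrite -GE odpart_spt_add; congr spoint; first by rewrite mulrA.
rewrite [RHS]mulrA; congr (_ * _).
rewrite [odpart p' * (_ * _)]mulrA [X in _ + X = _]scalerAl -mulrDl; congr (_ * _).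
by rewrite mulrDl scalerDr addrA.
Qed.

Lemma shift_oo0 q : shift_oo 0 q = q.
Proof.
rewrite /shift_oo /mobius (evpart_even (@is_even0 R)) (odpart_even (@is_even0 R)).
rewrite oppr0 scaler0 !mulr0 !(addr0, add0r) invr1 !mulr1 ?(mul0r, mulr0) ?(addr0, add0r).
exact: spoint_parts.
Qed.

Lemma sshift0 a : sshift 0 a = a.
Proof.
rewrite /sshift (evpart_even (@is_even0 R)) (odpart_even (@is_even0 R)).
by rewrite mulr0 !subr0 spoint_parts.
Qed.

Lemma sinv_sshift_sinv p q : body q != 0 -> body (shift_den p q) != 0 ->
  sinv_inv (sshift p (sinv q)) = shift_oo p q.
Proof.
move=> q0 d0; rewrite shift_ooE//.
rewrite /sinv_inv evpart_sshift odpart_sshift evpart_sinv_scaled odpart_sinv_scaled.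
set G := shift_den p q in d0 *; have eG : is_even G^-1 by exact/is_evenV/is_even_shift_den.
set w := evpart q; set z := evpart p; set r := odpart q; set t := odpart p.
have ew : is_even w := is_even_evpart _.
have uw : w \is a GRing.unit by apply: even_unit => //; rewrite body_evpart.
have uG : G \is a GRing.unit by exact: even_unit (@is_even_shift_den p q) d0.
have eV : is_even w^-1 by exact: is_evenV.
have -> : w^-1 - z - 'i *: (r * w^-1) * t = G * w^-1.
  rewrite /G /shift_den -/w -/z -/r -/t !mulrBl mul1r mulrK// -!scalerAl -!mulrA.
  by rewrite (even_comm t eV).
rewrite invrM ?unitrV// invrK; congr spoint.
rewrite mulrBl scalerBr -!scalerAl scalerA mulNr -expr2 sqrCi opprK scale1r.
rewrite !mulrA mulrVK// mulrDl -scalerAl -scaleNr.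
by rewrite opprK.
Qed.

Lemma sinv_scaledK u v a : u * v = 1 -> body a != 0 ->
  sinv_scaled v (sinv_scaled u a) = a.
Proof.
move=> uv a0; rewrite {1}/sinv_scaled evpart_sinv_scaled odpart_sinv_scaled invrK.
rewrite -scalerAl scalerA [v * u]mulrC uv scale1r mulrVK ?spoint_parts//.
by apply: even_unit; [exact: is_even_evpart|rewrite body_evpart].
Qed.

End Translations.

(** * The super-Riemann sphere *)

Section ComplexPlane.

Lemma open_disc (K : numFieldType) (z r : K) : open [set c : K | `|c - z| < r].
Proof.
rewrite openE => c /= cr; rewrite /interior; apply/nbhs_ballP.
exists (r - `|c - z|) => /=; first by rewrite subr_gt0.
move=> y; rewrite -ball_normE /= ltrBrDr => h;
rewrite distrC in h; apply: le_lt_trans h.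
by rewrite (le_trans _ (ler_normD _ _))// addrA subrK.
Qed.

Lemma open_disc_compl (K : numFieldType) (z r : K) : open [set c : K | r < `|c - z|].
Proof.
rewrite openE => c /= cr; rewrite /interior; apply/nbhs_ballP.
exists (`|c - z| - r) => /=; first by rewrite subr_gt0.
move=> y; rewrite -ball_normE /= ltrBrDr addrC -ltrBrDr => h; apply: lt_le_trans h _.
by rewrite lerBlDr -[c - z](subrKA y) [leRHS]addrC ler_normD.
Qed.

Variable R : realType.
Local Notation C := (Cx R).

Lemma closed_disc (r : C) : 0 <= r -> closed [set c : C | `|c| <= r].
Proof.
move=> r0; rewrite (_ : mkset _ = ~` [set c : C | r < `|c - 0|]).
  exact/open_closedC/open_disc_compl.
apply/seteqP; split => c /=; rewrite subr0; first by move=> /le_gtF ->.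
by move/negP; rewrite -real_leNgt ?normr_real// ger0_real.
Qed.

(** The disc is a closed subset of the image of a real square under [(x, y) |-> x + i y]. *)
Lemma closed_disc_compact (r : C) : compact [set c : C | `|c| <= r].
Proof.
(* The radius is a complex number; if it is negative or not real, the disc is empty. *)
have [r0|r0] := boolP (0 <= r); last first.
  rewrite (_ : mkset _ = set0); first exact: compact0.
  by apply/seteqP; split => // c /= cr; rewrite (le_trans _ cr) in r0.
have clK := closed_disc r0.
pose m : R := complex.Re r.
have mE : r = (real_complex R m) by rewrite /m RRe_real// ger0_real.
pose f (p : R * R) : C := (Complex p.1 p.2).
have cf : continuous f.
  move=> [x y] A /nbhs_ballP[e /= e0 eA]; apply/nbhs_ballP.
  have eE : e = (real_complex R (complex.Re e)) by rewrite RRe_real// gtr0_real.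
  have e0' : 0 < complex.Re e by rewrite -ltcR -eE.
  exists (complex.Re e / 2) => /=; first by rewrite divr_gt0.
  move=> [x' y'] [/= hx hy]; apply: eA; rewrite -ball_normE /=.
  rewrite [f _ - _](_ : _ = Complex (x - x') 0 + Complex 0 (y - y')); last first.
    by congr Complex; rewrite ?addr0 ?add0r.
  apply: le_lt_trans (ler_normD _ _) _; rewrite !normc_def /= expr0n add0r addr0.
  rewrite !sqrtr_sqr -(rmorphD (real_complex R)) eE ltcR.
  by rewrite [ltRHS]splitr ltrD.
apply: (subclosed_compact clK (B := f @` (`[- m, m] `*` `[- m, m]))).
  apply: continuous_compact; first exact: continuous_subspaceT.
  by apply: compact_setX; exact: segment_compact.
move=> [x y] /=; rewrite mE normc_def /= lecR => h.
exists (x, y) => //=; split => /=; rewrite in_itv /= -ler_norml.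
- by apply: le_trans h; rewrite -sqrtr_sqr ler_wsqrtr// lerDl sqr_ge0.
- by apply: le_trans h; rewrite -sqrtr_sqr ler_wsqrtr// lerDr sqr_ge0.
Qed.

Local Notation opc := (one_point_compactification C).

Lemma opc_openP (B : set opc) : open B <->
  open [set c : C | B (Some c)] /\
  (B None -> exists2 r : C, 0 < r & forall c : C, r < `|c| -> B (Some c)).
Proof.
split=> [oB|[oB Boo]].
  split.
    apply: open_comp oB => c _.
    exact: one_point_compactification_some_continuous.
  move=> BN; have : nbhs (None : opc) B by exact: open_nbhs_nbhs.
  move=> [K [/compact_near_coveringP cK clK] KB].
  (* A compact set is bounded: near each of its points, [|x| < m] holds for all large [m], hence it
     holds on the whole set for all [m > M]. *)
  have [x _|M [_ HM]] := cK R +oo (fun m (x : C) => `|x| < (real_complex R m)) _.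
    exists (ball x 1, [set m | complex.Re `|x| + 1 < m]).
      split => /=; first by apply/nbhs_ballP; exists 1 => /=.
      by exists (complex.Re `|x| + 1); split; [exact: num_real|].
    move=> [y m] [/= yx]; rewrite -ball_normE /= in yx.
    rewrite -ltcR => mx; apply: le_lt_trans mx.
    rewrite (rmorphD (real_complex R)) rmorph1 -[X in _ <= X + 1]/(`|x|).
    rewrite -[y](subrK x) (le_trans (ler_normD _ _))// addrC lerD2l distrC ltW//.
  (* The radius has to exceed [M] and to be positive. *)
  pose r : R := Num.max M 0 + 1.
  have r0 : 0 < r by rewrite ltr_wpDl// le_max lexx orbT.
  exists (real_complex R r); first by rewrite (_ : 0 = real_complex R 0) ?ltcR.
  move=> c rc; apply: KB; left; exists c => // Kc.
  have /HM/(_ c Kc)/lt_trans/(_ rc) : M < r by rewrite ltr_pwDr// le_max lexx.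
  by rewrite ltxx.
rewrite openE => -[c|] Bc; rewrite /interior.
  by have : nbhs c [set c | B (Some c)] by exact: open_nbhs_nbhs.
have [r r0 rB] := Boo Bc; exists [set c : C | `|c| <= r].
  split; first exact: closed_disc_compact.
  exact: closed_disc (ltW r0).
move=> _ [[c /negP rc <-]|->] //; apply: rB.
by move: rc; rewrite -real_ltNge ?normr_real// gtr0_real.
Qed.

End ComplexPlane.

(** * The body of the sphere as a one-point compactification *)

Section SphereTopology.
Variable R : realType.
Local Notation Lam := (Lam R).
Local Notation C := (Cx R).
Local Notation sphere := (ssphere R).
Local Notation opc := (one_point_compactification C).
Implicit Types (a p q : Lam) (B : set opc) (V : set C) (x : sphere).

Lemma dewitt_inj V V' : dewitt (R := R) V = dewitt V' -> V = V'.
Proof.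
move=> h; apply/seteqP; split => c Vc.
  have : dewitt V' (c%:A : Lam) by rewrite -h /dewitt /= body_alg.
  by rewrite /dewitt /= body_alg.
have : dewitt V (c%:A : Lam) by rewrite h /dewitt /= body_alg.
  by rewrite /dewitt /= body_alg.
Qed.

Definition body_pt (x : sphere) : opc :=
  if x is inl a then Some (body a) else None.

Lemma sinvK a : body a != 0 -> sinv_inv (sinv a) = a.
Proof. by apply: sinv_scaledK; rewrite mulrN -expr2 sqrCi opprK. Qed.

Lemma sinv_invK a : body a != 0 -> sinv (sinv_inv a) = a.
Proof. by apply: sinv_scaledK; rewrite mulNr -expr2 sqrCi opprK. Qed.

Lemma body_sinv a : body a != 0 -> body (sinv a) = (body a)^-1.
Proof. exact: body_sinv_scaled. Qed.

Lemma body_sinv_inv a : body a != 0 -> body (sinv_inv a) = (body a)^-1.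
Proof. exact: body_sinv_scaled. Qed.

(** The set [B] in the coordinate [1/c] at infinity, which is the body of [Upsilon]. *)
Definition infty_trace B : set C :=
  [set c | if c == 0 then B None else B (Some c^-1)].

Lemma Delta_image B :
  @cmap R sphere true @` (body_pt @^-1` B `&` @cdom R sphere true) =
  dewitt [set c | B (Some c)].
Proof.
apply/seteqP; split => [_ [[a|q] [Bx //= _] <-]|a Ba] //.
by exists (inl a).
Qed.

Lemma Upsilon_image B :
  @cmap R sphere false @` (body_pt @^-1` B `&` @cdom R sphere false) =
  dewitt (infty_trace B).
Proof.
apply/seteqP; split => [_ [[a|q] [Bx /= dx] <-]|q Bq] //=.
- by rewrite /dewitt /infty_trace /= body_sinv_inv// invr_eq0 (negbTE dx) invrK.
- by rewrite /dewitt /infty_trace /= (valP q).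
move: Bq; rewrite /dewitt /infty_trace /=; case: ifPn => q0 Bq.
  by exists (inr (exist _ q q0)).
exists (inl (sinv q)); last by rewrite /= sinvK.
by split => /=; rewrite body_sinv// invr_neq0.
Qed.

Lemma srs_open_sphere B : @srs_open R sphere (body_pt @^-1` B) <->
  open [set c : C | B (Some c)] /\ open (infty_trace B).
Proof.
split=> [oB|[oD oU] [|]]; last 2 first.
- by exists [set c | B (Some c)] => //; exact: Delta_image.
- by exists (infty_trace B) => //; exact: Upsilon_image.
split.
  have [V oV] := oB true; rewrite Delta_image => /dewitt_inj ->; exact: oV.
by have [V oV] := oB false; rewrite Upsilon_image => /dewitt_inj ->.
Qed.

(** Inversion exchanges punctured discs around 0 with exteriors of discs, which settles the point 0;
    elsewhere it is continuous. *)
Lemma open_infty_trace B : open [set c : C | B (Some c)] ->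
  open (infty_trace B) <->
  (B None -> exists2 r : C, 0 < r & forall c : C, r < `|c| -> B (Some c)).
Proof.
move=> oB; split => [oU BN|Boo].
  have : nbhs (0 : C) (infty_trace B).
    by apply: open_nbhs_nbhs; split => //; rewrite /infty_trace /= eqxx.
  move=> /nbhs_ballP[e /= e0 eB]; exists e^-1; first by rewrite invr_gt0.
  move=> c ec; have c0 : c != 0.
    by rewrite -normr_gt0 (lt_trans _ ec)// invr_gt0.
  have /eB : ball (0 : C) e c^-1.
    rewrite -ball_normE /= sub0r normrN normfV.
    by rewrite -[ltRHS]invrK ltf_pV2// posrE ?invr_gt0// normr_gt0.
  by rewrite /infty_trace /= invr_eq0 (negbTE c0) invrK.
rewrite openE => c; rewrite /infty_trace /=; case: ifPn => [/eqP ->|c0] Bc.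
  have [r r0 rB] := Boo Bc; apply/nbhs_ballP; exists r^-1 => /=; first by rewrite invr_gt0.
  move=> y; rewrite -ball_normE /= sub0r normrN => yr; case: ifPn => // y0.
  apply: rB; rewrite normfV -[ltLHS]invrK ltf_pV2// posrE ?invr_gt0//.
  by rewrite normr_gt0.
have nV : nbhs c ((fun y : C => y^-1) @^-1` [set c : C | B (Some c)]).
  apply: (@inv_continuous C c c0); apply: open_nbhs_nbhs; split => //.
have n0 : nbhs c [set y : C | y != 0].
  apply/nbhs_ballP; exists `|c|; rewrite /= ?normr_gt0// => y.
  by rewrite -ball_normE /=; apply: contraTneq => ->; rewrite subr0 ltxx.
by apply: filterS2 nV n0 => y /= yB y0; rewrite (negbTE y0).
Qed.

Lemma same_body_sphere x y : body_pt x = body_pt y <-> same_body x y.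
Proof.
case: x y => [a|q] [b|q']; rewrite /same_body; split => //=.
- by case=> ab; exists true.
- case=> -[|] [//= a0 b0] ab; first by rewrite ab.
  by move: ab; rewrite !body_sinv_inv// => /invr_inj ->.
- case=> -[|] [//= a0 _]; rewrite body_sinv_inv// (eqP (valP q')) => /eqP.
  by rewrite invr_eq0 (negbTE a0).
- case=> -[|] [//= _ a0]; rewrite body_sinv_inv// (eqP (valP q)) => /esym/eqP.
  by rewrite invr_eq0 (negbTE a0).
- by exists false; split => //=; rewrite (eqP (valP q)) (eqP (valP q')).
Qed.

Lemma open_body_pt B : open B <-> @srs_open R sphere (body_pt @^-1` B).
Proof.
by rewrite srs_open_sphere opc_openP; split=> -[oB oU]; split => //;
  exact/open_infty_trace.
Qed.

Lemma genus_zero_ssphere : genus_zero_body sphere.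
Proof.
exists body_pt; split.
- case=> [c|]; last by exists (ssphere_oo R).
  by exists (inl c%:A); rewrite /= body_alg.
- exact: same_body_sphere.
- exact: open_body_pt.
Qed.

Lemma srs_openI (S : srs_data R) (A A' : set S) :
  (forall al : chart S, {in cdom al &, injective (cmap al)}) ->
  srs_open A -> srs_open A' -> srs_open (A `&` A').
Proof.
move=> inj oA oA' al; have [V oV AV] := oA al; have [V' oV' AV'] := oA' al.
exists (V `&` V'); first exact: openI.
rewrite [RHS](_ : _ = dewitt V `&` dewitt V')// -AV -AV'.
apply/seteqP; split => [_ [x [[Ax A'x] dx] <-]|y [[x [Ax dx] <-] [x' [A'x' dx'] xx']]].
  by split; exists x.
have xE : x' = x by apply: (inj al); rewrite ?inE.
by exists x => //; split => //; split => //; rewrite -xE.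
Qed.

End SphereTopology.

(** * Translations of the super-Riemann sphere *)

Section SphereTranslations.
Variable R : realType.
Local Notation Lam := (Lam R).
Local Notation C := (Cx R).
Local Notation sphere := (ssphere R).
Implicit Types (a p q : Lam) (x : sphere) (V : set C).

Lemma body_shift_den_oo p q : body q = 0 -> body (shift_den p q) != 0.
Proof. by move=> q0; rewrite body_shift_den q0 mulr0 subr0 oner_neq0. Qed.

Fact body_shift_oo_eq0 p (q : {q : Lam | body q == 0}) :
  body (shift_oo p (val q)) == 0.
Proof.
have q0 := eqP (valP q); rewrite body_shift_oo ?q0 ?mul0r//.
exact: body_shift_den_oo.
Qed.

Definition sph_shift p (x : sphere) : sphere :=
  match x with
  | inl a => inl (sshift p a)
  | inr q => inr (exist _ (shift_oo p (val q)) (body_shift_oo_eq0 p q))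
  end.

Lemma sph_shift_comp p p' x :
  sph_shift p' (sph_shift p x) = sph_shift (spt_add p p') x.
Proof.
case: x => [a|q] /=; first by rewrite sshift_comp.
by congr inr; apply: val_inj; rewrite /= shift_oo_comp// (eqP (valP q)).
Qed.

Lemma sph_shift0 x : sph_shift 0 x = x.
Proof.
case: x => [a|q] /=; first by rewrite sshift0.
by congr inr; apply: val_inj; rewrite /= shift_oo0.
Qed.

Lemma spt_addN p : spt_add p (- p) = 0.
Proof.
have evN : evpart (- p) = - evpart p.
  by apply/grassmannP => I; rewrite evpart_coef !gcoefN evpart_coef; case: ifP; rewrite ?oppr0.
have odN : odpart (- p) = - odpart p.
  by apply/grassmannP => I; rewrite odpart_coef !gcoefN odpart_coef; case: ifP; rewrite ?oppr0.
rewrite /spt_add evN odN mulNr (odd_sqr (is_odd_odpart _)) !subrr ?oppr0 ?addr0.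
by rewrite /spoint ?addr0.
Qed.

Lemma sph_shiftK p : cancel (sph_shift p) (sph_shift (- p)).
Proof. by move=> x; rewrite sph_shift_comp spt_addN sph_shift0. Qed.

Lemma sph_shiftNK p : cancel (sph_shift (- p)) (sph_shift p).
Proof. by move=> x; rewrite -{1}[p]opprK sph_shiftK. Qed.

(** For [s = -1] this is [I o I]. *)
Definition oscale (s : C) a : Lam := spoint (evpart a) (s *: odpart a).

Lemma oscale1 a : oscale 1 a = a.
Proof. by rewrite /oscale scale1r spoint_parts. Qed.

Lemma oscaleK (s : C) : s ^+ 2 = 1 -> involutive (oscale s).
Proof.
move=> s2 a; rewrite /oscale evpart_spoint ?odpart_spoint ?scalerA.
- by rewrite -expr2 s2 scale1r spoint_parts.
- exact: is_even_evpart.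
- by apply: is_oddZ; exact: is_odd_odpart.
- exact: is_even_evpart.
- by apply: is_oddZ; exact: is_odd_odpart.
Qed.

Lemma body_oscale s a : body (oscale s a) = body a.
Proof.
by rewrite body_spoint ?body_evpart//; apply: is_oddZ; exact: is_odd_odpart.
Qed.

(** Scaling the odd component multiplies [psi] and [g] by [s]. They enter the superconformal
    equations only through products of two of them, so [s^2 = 1] leaves these intact; the result is
    again a Moebius map. *)
Lemma superconformal_oscale_mobius (s : C) (a b c d gam del e : Lam) V (H : Lam -> Lam) :
  s ^+ 2 = 1 -> is_even a -> is_even b -> is_even c -> is_even d ->
  is_odd gam -> is_odd del -> is_even e ->
  e ^+ 2 = a * d - b * c + del * gam -> body e != 0 ->
  (forall y : C, V y -> body (y *: c + d) != 0) ->
  (forall p, dewitt V p -> H p = oscale s (mobius a b c d gam del e p)) ->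
  superconformal V H.
Proof.
move=> s2 ea eb ec ed og od ee e2 e0 Vd HE.
have sc : superconformal V (mobius a b c d (s *: gam) (s *: del) (s *: e)).
  apply: superconformal_mobius => //; try exact: is_oddZ; try exact: is_evenZ.
  - by rewrite exprZn s2 scale1r e2 -scalerAl -scalerAr scalerA -expr2 s2 scale1r.
  - by rewrite bodyZ mulf_neq0//; apply: contra_eq_neq s2 => ->; rewrite expr0n eq_sym oner_eq0.
case: sc => f [xi] [psi] [g] [h1 h2 h3 h4 h5].
exists f, xi, psi, g; split => // p Vp w rho; rewrite HE// -h4// /mobius.
set D := (evpart p * c + d)^-1.
have ew : is_even (evpart p) by exact: is_even_evpart.
have or : is_odd (odpart p) by exact: is_odd_odpart.
have eD : is_even D by apply: is_evenV; apply: is_evenD => //; exact: is_evenM.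
have oP : is_odd ((evpart p * gam + del) * D).
  by apply: is_odd_evenM => //; apply: is_oddD => //; exact: is_even_oddM.
have eeD : is_even (e * D) by exact: is_evenM.
rewrite /oscale evpart_spoint ?odpart_spoint.
- have PE : evpart p * (s *: gam) + s *: del = s *: (evpart p * gam + del).
    by rewrite -scalerAr -scalerDr.
  rewrite PE -!scalerAl; congr spoint; last by rewrite -scalerAr -scalerDr.
  by rewrite -!scalerAr scalerA -expr2 s2 scale1r.
- apply: is_evenD; first by apply: is_evenM => //; apply: is_evenD => //; exact: is_evenM.
  by apply: is_oddM => //; exact: is_even_oddM.
- by apply: is_oddD => //; exact: is_odd_evenM.
- apply: is_evenD; first by apply: is_evenM => //; apply: is_evenD => //; exact: is_evenM.
  by apply: is_oddM => //; exact: is_even_oddM.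
- by apply: is_oddD => //; exact: is_odd_evenM.
Qed.

(* Stated for every open [D], because [superconformal] does not restrict to
   smaller sets: see its non-vanishing clause. *)
Lemma superconformal_on_shift p (s : C) (be : bool) (D : set sphere) :
  s ^+ 2 = 1 -> srs_open D -> D `<=` sph_shift p @^-1` @cdom R sphere be ->
  superconformal_on D (oscale s \o (@cmap R sphere be) \o sph_shift p).
Proof.
move=> s2 oD Dbe al; have [V oV DV] := oD al; exists V; split => //.
(* Each [c] in [V] is the body of a point of [D], so that denominators may be examined at points of
   the sphere. *)
have Vx c : V c -> exists x, [/\ D x, @cdom R sphere al x & body (cmap al x) = c].
  move=> Vc; have : dewitt V (c%:A : Lam) by rewrite /dewitt /= body_alg.
  by rewrite -DV => -[x [Dx ax] xc]; exists x; split => //; rewrite xc body_alg.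
have Vp q : dewitt V q -> exists x, [/\ D x, @cdom R sphere al x & cmap al x = q].
  by rewrite -DV => -[x [Dx ax] xc]; exists x.
have ev := @is_even_evpart R; have od := @is_odd_odpart R.
have e0 := @is_even0 R; have e1 := @is_even1 R; have o0 := @is_odd0 R.
have eN := @is_evenN R; have oN := @is_oddN R; have oZ := @is_oddZ R.
have eA := @is_even_alg R.
set z := evpart p; set t := odpart p.
have ezN : is_even (- z) by exact/eN/ev.
have otN : is_odd (- t) by exact/oN/od.
have oit : is_odd ('i *: t) by exact/oZ/od.
have oitN : is_odd (- (- 'i *: t)) by exact/oN/oZ/od.
have key (a b c d gam del e : Lam) :
  is_even a -> is_even b -> is_even c -> is_even d ->
  is_odd gam -> is_odd del -> is_even e ->
  e ^+ 2 = a * d - b * c + del * gam -> body e != 0 ->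
  (forall x, D x -> @cdom R sphere al x ->
     body ((body (cmap al x)) *: c + d) != 0) ->
  (forall x, D x -> @cdom R sphere al x ->
    @cmap R sphere be (sph_shift p x) = mobius a b c d gam del e (cmap al x)) ->
  exists2 H, superconformal V H &
    {in D `&` @cdom R sphere al, forall x,
      (oscale s \o (@cmap R sphere be) \o sph_shift p) x = H (cmap al x)}.
  move=> ea eb ec ed og odel ee e2 be0 h1 h2.
  exists (oscale s \o mobius a b c d gam del e).
    apply: (superconformal_oscale_mobius s2 ea eb ec ed og odel ee e2 be0) => //.
    by move=> c' /Vx[x [Dx ax <-]]; exact: h1.
  by move=> x; rewrite inE => -[Dx ax]; congr (oscale s _); exact: h2.
(* One Moebius map for each pair of charts: [s_p], [s_p o I], [I^-1 o s_p] and [I^-1 o s_p o I], in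
   this order. *)
case: be al Dbe DV Vx Vp key => -[] Dbe DV Vx Vp key.
- apply: (key 1 (- z) 0 1 0 (- t) 1) => //.
  + by rewrite expr1n !mulr0 !mulr1 subr0 addr0.
  + by rewrite body1 oner_neq0.
  + by move=> x _ _; rewrite scaler0 add0r body1 oner_neq0.
  + by move=> [a|//] _ _ /=; rewrite sshift_mobius.
- apply: (key (- z) 1 1 0 (- t) 0 'i%:A) => //.
  + by rewrite exprZn expr1n sqrCi mulr0 mul1r mul0r addr0 sub0r scaleN1r.
  + by rewrite body_alg neq0Ci.
  + move=> [a|q] Dx dx /=; last by have := Dbe _ Dx.
    by rewrite addr0 body_alg body_sinv_inv// invr_eq0.
  + move=> [a|q] Dx dx /=; last by have := Dbe _ Dx.
    by rewrite -sshift_sinv_mobius ?sinv_invK// body_sinv_inv// invr_eq0.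
- have ND a : D (inl a) -> body a != body p.
    by move=> /Dbe /=; rewrite body_sshift subr_eq0.
  apply: (key 0 1 1 (- z) 0 (- (- 'i *: t)) (- 'i)%:A) => //.
  + by rewrite exprZn expr1n sqrrN sqrCi mulr0 mul1r mul0r addr0 sub0r scaleN1r.
  + by rewrite body_alg oppr_eq0 neq0Ci.
  + move=> [a|//] Dx _ /=; rewrite bodyB body_alg body_evpart subr_eq0; exact: ND.
  + move=> [a|//] Dx _ /=; rewrite -sinv_sshift_mobius//; last exact: ND.
    by rewrite sqrrN sqrCi.
- apply: (key 1 0 (- z) 1 ('i *: t) 0 1) => //.
  + by rewrite expr1n !mul1r !mul0r subr0 addr0.
  + by rewrite body1 oner_neq0.
  + move=> [a|q] Dx dx /=.
      rewrite body_sinv_inv// bodyD bodyZ bodyN body1 body_evpart.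
      (* The denominator vanishes only over [body p], whose translate lies over 0, outside the
         domain of [Upsilon]. *)
      have /= := Dbe _ Dx; rewrite body_sshift; apply: contraNN => /eqP h.
      have -> : body a - body p = body a * ((body a)^-1 * - body p + 1).
        by rewrite mulrDr mulrA mulfV// mul1r mulr1 addrC.
      by rewrite h mulr0.
    by rewrite (eqP (valP q)) scale0r add0r body1 oner_neq0.
  + move=> [a|//] Dx dx /=.
    rewrite -[RHS]/(shift_oo p _) -sinv_sshift_sinv ?sinv_invK//.
      by rewrite body_sinv_inv// invr_eq0.
    rewrite body_shift_den body_sinv_inv//.
    have /= := Dbe _ Dx; rewrite body_sshift; apply: contraNN => /eqP h.
    have -> : body a - body p = body a * (1 - body p * (body a)^-1).
      by rewrite mulrBr mulr1 mulrCA mulfV// mulr1.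
    by rewrite h mulr0.
Qed.

End SphereTranslations.

(** * Standard tubes on the sphere *)

Section SphereTubes.
Variable R : realType.
Local Notation Lam := (Lam R).
Local Notation C := (Cx R).
Local Notation sphere := (ssphere R).
Local Notation opc := (one_point_compactification C).
Implicit Types (a p q : Lam) (x y : sphere) (be : bool) (r : C).

Definition sdom be : set sphere := @cdom R sphere be.
Definition smap be : sphere -> Lam := @cmap R sphere be.

Lemma smap_inj be : {in sdom be &, injective (smap be)}.
Proof.
case: be => x y; rewrite !inE; case: x => [a|q]; case: y => [b|q'] //=.
- by move=> _ _; rewrite /smap /= => ->.
- move=> a0 b0 ab; congr inl; rewrite -(sinv_invK a0) -(sinv_invK b0).
  by congr (sinv _).
- move=> a0 _ ab; have /eqP := congr1 (@body R) ab.
  by rewrite /smap /= body_sinv_inv// (eqP (valP q')) invr_eq0 (negbTE a0).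
- move=> _ a0 ab; have /eqP := congr1 (@body R) ab.
  by rewrite /smap /= body_sinv_inv// (eqP (valP q)) eq_sym invr_eq0 (negbTE a0).
- by move=> _ _ ab; congr inr; apply: val_inj.
Qed.

Lemma smap_surj be a : exists2 x, sdom be x & smap be x = a.
Proof.
case: be; first by exists (inl a).
have [a0|a0] := eqVneq (body a) 0.
  by move/eqP: a0 => a0; exists (inr (exist _ a a0)).
exists (inl (sinv a)); last by rewrite /smap /= sinvK.
by rewrite /sdom /= body_sinv// invr_neq0.
Qed.

Definition tube_dom be p r : set sphere :=
  [set x | sdom be (sph_shift p x) /\ `|body (smap be (sph_shift p x))| < r].
(* At infinity this is [I o s_p]; it differs from [Upsilon o F_p] by a sign,
   because [I (I (w, rho)) = (w, - rho)]. *)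
Definition tube_coord be p x : Lam :=
  oscale (if be then 1 else -1) (smap be (sph_shift p x)).

Lemma tube_sign (be : bool) : (if be then 1 else -1 : C) ^+ 2 = 1.
Proof. by case: be; rewrite ?sqrrN expr1n. Qed.

Definition inside p r : set opc :=
  [set c | if c is Some c then `|c - body p| < r else False].
Definition outside p r : set opc :=
  [set c | if c is Some c then r < `|c - body p| else True].

Lemma tube_dom_trueE p r : tube_dom true p r =
  body_pt (R := R) @^-1` inside p r.
Proof.
apply/seteqP; split => -[a|q] //=; rewrite /tube_dom /sdom /smap /= ?body_sshift //; by case.
Qed.

Lemma tube_dom_falseE p r : 0 < r -> tube_dom false p r =
  body_pt (R := R) @^-1` outside p r^-1.
Proof.
move=> r0; have rV a : body a - body p != 0 ->
    (`|(body a - body p)^-1| < r) = (r^-1 < `|body a - body p|).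
  by move=> a0; rewrite normfV -[X in _ < X = _]invrK ltf_pV2// posrE ?invr_gt0// normr_gt0.
apply/seteqP; split => -[a|q] //=; rewrite /tube_dom /sdom /smap /=.
- by rewrite body_sshift => -[a0]; rewrite body_sinv_inv ?body_sshift// rV.
- rewrite body_sshift => h; have a0 : body a - body p != 0.
    by rewrite -normr_gt0 (lt_trans _ h)// invr_gt0.
  by rewrite body_sinv_inv ?body_sshift// rV.
- by move=> _; rewrite (eqP (body_shift_oo_eq0 p q)) normr0.
Qed.

Lemma srs_open_tube_dom be p r : 0 < r -> srs_open (tube_dom be p r).
Proof.
move=> r0; case: be; rewrite ?tube_dom_trueE ?tube_dom_falseE//; apply/srs_open_sphere.
  have oB : open [set c : C | inside p r (Some c)].
    exact: open_disc.
  by split => //; apply/open_infty_trace.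
have oB : open [set c : C | outside p r^-1 (Some c)].
  exact: open_disc_compl.
split => //; apply/open_infty_trace => // _.
exists (r^-1 + `|body p|) => [|c h] /=; first by rewrite ltr_pwDl// invr_gt0.
by rewrite -(ltrD2r `|body p|) (lt_le_trans h)// -{1}[c](subrK (body p)) ler_normD.
Qed.

Lemma tube_coord_inj be p r : {in tube_dom be p r &, injective (tube_coord be p)}.
Proof.
move=> x y; rewrite !inE => -[dx _] [dy _].
move=> /(can_inj (oscaleK (tube_sign be))) /smap_inj; rewrite !inE => /(_ dx dy).
exact: (can_inj (sph_shiftK p)).
Qed.

Lemma tube_coord_image be p r :
  tube_coord be p @` tube_dom be p r = dewitt [set c | `|c| < r].
Proof.
apply/seteqP; split => [_ [x [dx xr] <-]|a ar].
  by rewrite /dewitt /= body_oscale.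
have [y dy ya] := smap_surj be (oscale (if be then 1 else -1) a).
exists (sph_shift (- p) y).
  by rewrite /tube_dom /= sph_shiftNK; split => //; rewrite ya body_oscale.
by rewrite /tube_coord sph_shiftNK ya oscaleK// tube_sign.
Qed.

Lemma superconformal_on_tube be p r D : srs_open D -> D `<=` tube_dom be p r ->
  superconformal_on D (tube_coord be p).
Proof.
move=> oD Dr; apply: (superconformal_on_shift (tube_sign be) oD).
by move=> x /Dr[].
Qed.

Lemma srs_open_shift_sdom p be : srs_open (sph_shift p @^-1` sdom be).
Proof.
have -> : sph_shift p @^-1` sdom be = (body_pt (R := R)) @^-1`
    [set c : opc | if c is Some c then be || (c != body p) else ~~ be].
  by apply/seteqP; rewrite /sdom; case: be; split => -[a|q] //=;
    rewrite body_sshift subr_eq0.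
apply/srs_open_sphere.
have oB : open [set c : C |
    [set c : opc | if c is Some c then be || (c != body p) else ~~ be] (Some c)].
  case: be => /=; first by rewrite (_ : mkset _ = setT); [exact: openT|apply/seteqP].
  rewrite (_ : mkset _ = [set c : C | 0 < `|c - body p|]); first exact: open_disc_compl.
  by apply/seteqP; split => c /=; rewrite normr_gt0 subr_eq0.
split => //; apply/open_infty_trace => // _; exists (1 + `|body p|) => [|c /= hc].
  by rewrite ltr_pwDl.
by apply/orP; right; apply: contraTneq hc => ->; rewrite gtrDr ltr10.
Qed.

Lemma srs_open_sdom be : srs_open (sdom be).
Proof.
have := srs_open_shift_sdom 0 be.
by rewrite (_ : _ @^-1` _ = sdom be)//; apply/seteqP; split => x /=; rewrite sph_shift0.
Qed.

(** The transition maps are the chart expressions of the translation by 0. *)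
Lemma super_riemann_ssphere : super_riemann_surface sphere.
Proof.
split => [[a|q]|be|be]; [by exists true|by exists false|exact: smap_inj|].
have := superconformal_on_shift (p := 0) (expr1n _ 2) (srs_open_sdom be) (be := be).
rewrite (_ : _ \o _ = cmap be); first by apply => x; rewrite /= sph_shift0.
by apply/funext => x /=; rewrite oscale1 sph_shift0.
Qed.

Lemma supersphere_ssphere : supersphere sphere.
Proof. split; [exact: super_riemann_ssphere|exact: genus_zero_ssphere]. Qed.

Definition tube_pt be p : sphere := if be then inl p else ssphere_oo R.

Lemma sshift_self p : sshift p p = 0.
Proof. by rewrite /sshift (odd_sqr (is_odd_odpart _)) !subrr /spoint addr0. Qed.

Lemma tube_ptP be p r : 0 < r ->
  tube_dom be p r (tube_pt be p) /\ tube_coord be p (tube_pt be p) = 0.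
Proof.
have os s : oscale s (0 : Lam) = 0.
  by rewrite /oscale (evpart_even (@is_even0 R)) (odpart_even (@is_even0 R)) scaler0 /spoint addr0.
move=> r0; rewrite /tube_dom /tube_coord /sdom /smap; case: be => /=.
  by rewrite sshift_self body_0 normr0 os.
have -> : shift_oo p 0 = 0.
  rewrite shift_ooE ?body_shift_den_oo ?body_0//.
  rewrite (evpart_even (@is_even0 R)) (odpart_even (@is_even0 R)).
  by rewrite !mulr0 scaler0 addr0 !mul0r /spoint addr0.
by rewrite body_0 normr0 os.
Qed.

(** All the spheres of the proof, the sewn one included, are described by centres and radii. The
    centre of tube 0 changes its coordinate and its domain, but its puncture stays at infinity. *)
Definition sph_tubes n (cs : seq Lam) (rs : seq C) : tubes_data R n :=
  @TubesData R n sphere (fun k => tube_pt (k != 0 :> nat) (nth 0 cs k))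
    (fun k => tube_dom (k != 0 :> nat) (nth 0 cs k) (nth 0 rs k))
    (fun k => tube_coord (k != 0 :> nat) (nth 0 cs k)).

(** Infinity is not over any finite body, so only the positive punctures have to be compared. *)
Lemma sph_tubesP n cs rs : (forall k, (k <= n)%N -> 0 < nth 0 rs k) ->
  (forall j k : nat, (0 < j < k)%N -> (k <= n)%N ->
     body (nth 0 cs j) != body (nth 0 cs k)) ->
  supersphere_with_tubes (sph_tubes n cs rs).
Proof.
move=> rs0 csn; split; first exact: supersphere_ssphere.
- move=> [j jn] [k kn] jk /same_body_sphere; apply/eqP.
  have {}jk : j != k by apply: contra_not_neq jk => jk; exact: val_inj.
  case: j k jn kn jk => [|j] [|k] //= jn kn jk.
  have [kj|kj] := ltnP k j; apply/eqP => -[] /eqP; apply/negP.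
    by rewrite eq_sym csn.
  have jk' : (j < k)%N by rewrite ltn_neqAle kj andbT -eqSS.
  by rewrite csn.
- move=> k; have [h1 h2] := tube_ptP (k != 0 :> nat) (nth 0 cs k) (rs0 k (ltn_ord k)).
  split => //=.
  + exact: tube_coord_inj.
  + exists [set c | `|c| < nth 0 rs k]; last exact: tube_coord_image.
    by have := @open_disc C 0 (nth 0 rs k); under eq_set do rewrite subr0.
  + apply: (@superconformal_on_tube _ _ (nth 0 rs k)) => //.
    by apply: srs_open_tube_dom; apply: rs0; rewrite -ltnS ltn_ord.
Qed.

End SphereTubes.

(** * Exponentials and convergence *)

Section NumericalSeries.
Variable K : numFieldType.
Implicit Types (u v : nat -> K) (l m : K).

Definition sums_to u l : Prop := series u @ \oo --> l.

Lemma eq_sums_to u v l : u =1 v -> sums_to u l -> sums_to v l.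
Proof. by move/funext ->. Qed.

Lemma sums_toD u v l m : sums_to u l -> sums_to v m -> sums_to (fun n => u n + v n) (l + m).
Proof.
move=> hu hv; rewrite /sums_to.
rewrite (_ : series _ = series u + series v); first exact: cvgD.
by apply/funext => n; rewrite /series /= big_split.
Qed.

Lemma sums_toZ u l (k : K) : sums_to u l -> sums_to (fun n => k * u n) (k * l).
Proof.
move=> hu; rewrite /sums_to.
rewrite (_ : series _ = (fun n => k * series u n)).
  exact: (cvgM (cvg_cst k) hu).
by apply/funext => n; rewrite /series /= mulr_sumr.
Qed.

Lemma sums_to0 : sums_to (fun=> 0) 0.
Proof.
rewrite /sums_to (_ : series _ = (fun=> 0)); first exact: cvg_cst.
by apply/funext => n; rewrite /series /= big1.
Qed.

Lemma sums_to_big (T : Type) (r : seq T) (F : T -> nat -> K) (L : T -> K) :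
  (forall t, sums_to (F t) (L t)) ->
  sums_to (fun n => \sum_(t <- r) F t n) (\sum_(t <- r) L t).
Proof.
move=> hF; elim: r => [|t r IH].
  by rewrite big_nil; under eq_fun do rewrite big_nil; exact: sums_to0.
by rewrite big_cons; under eq_fun do rewrite big_cons; exact: sums_toD.
Qed.

Lemma sums_to_shift u l : sums_to u l ->
  sums_to (fun n => if n is m.+1 then u m else 0) l.
Proof.
move=> hu; rewrite /sums_to -cvg_shiftS.
rewrite (_ : (fun n => _) = series u)//.
by apply/funext => n; rewrite /series /= big_nat_recl// add0r.
Qed.

(** A form of absolute convergence that is stable under finite linear combinations and shifts by
    elementary estimates. *)
Definition geom_bounded u : Prop := exists k t : K,
  [/\ 0 <= k, 0 < t < 1 & forall n, `|u n| <= k * t ^+ n].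

Lemma geom_bounded0 : geom_bounded (fun=> 0).
Proof.
exists 0, (2^-1); split => //; first by rewrite invr_gt0 ltr0n invf_lt1// ltr1n.
by move=> n; rewrite normr0 mul0r.
Qed.

Lemma geom_boundedD u v : geom_bounded u -> geom_bounded v ->
  geom_bounded (fun n => u n + v n).
Proof.
move=> [k [t [k0 /andP[t0 t1] hu]]] [j [s [j0 /andP[s0 s1] hv]]].
(* A common ratio, above [t] and [s] and below 1, because [1 - w = (1 - t) (1 - s)]. *)
pose w := t + s * (1 - t).
have tw : t <= w by rewrite lerDl mulr_ge0// ?subr_ge0 ltW.
have wE : w = s + t * (1 - s) by rewrite /w; ring.
have sw : s <= w by rewrite wE lerDl mulr_ge0// ?subr_ge0 ltW.
exists (k + j), w; split; first exact: addr_ge0.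
  rewrite (lt_le_trans t0)//= (_ : w = 1 - (1 - t) * (1 - s)); last by rewrite /w; ring.
  by rewrite gtrBl mulr_gt0// subr_gt0.
move=> n; apply: le_trans (ler_normD _ _) _; rewrite mulrDl lerD//.
  by apply: le_trans (hu n) _; rewrite ler_wpM2l// lerXn2r// nnegrE ?(le_trans _ tw)// ltW.
by apply: le_trans (hv n) _; rewrite ler_wpM2l// lerXn2r// nnegrE ?(le_trans _ sw)// ltW.
Qed.

Lemma geom_boundedZ u (a : K) : geom_bounded u -> geom_bounded (fun n => a * u n).
Proof.
move=> [k [t [k0 t01 hu]]]; exists (`|a| * k), t; split => //; first exact: mulr_ge0.
by move=> n; rewrite normrM -mulrA ler_wpM2l.
Qed.

Lemma geom_bounded_big (T : Type) (r : seq T) (F : T -> nat -> K) :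
  (forall t, geom_bounded (F t)) -> geom_bounded (fun n => \sum_(t <- r) F t n).
Proof.
move=> hF; elim: r => [|t r IH].
  by under eq_fun do rewrite big_nil; exact: geom_bounded0.
by under eq_fun do rewrite big_cons; exact: geom_boundedD.
Qed.

Lemma geom_bounded_shift u : geom_bounded u ->
  geom_bounded (fun n => if n is m.+1 then u m else 0).
Proof.
move=> [k [t [k0 /andP[t0 t1] hu]]]; exists (k / t), t; split.
- by rewrite divr_ge0// ltW.
- by rewrite t0.
- move=> [|n]; first by rewrite normr0 mulr_ge0// ?divr_ge0// ?exprn_ge0// ltW.
  by apply: le_trans (hu n) _; rewrite exprS mulrA mulfVK// gt_eqF.
Qed.

(** For [b = body y] these are the coefficients of [soul y ^+ j] in the powers [y ^+ n]. The ratio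
    [t] lies halfway between [|b|] and 1, and [e] is the gap that pays for the binomial factor. *)
Lemma geom_bounded_binom (b : K) j : `|b| < 1 ->
  geom_bounded (fun n => 'C(n, j)%:R * b ^+ (n - j)).
Proof.
move=> b1; pose t := (1 + `|b|) / 2; pose e := t - `|b|.
have e0 : 0 < e.
  rewrite /e /t (_ : _ - _ = (1 - `|b|) / 2); last by field.
  by rewrite divr_gt0// subr_gt0.
have t1 : t < 1 by rewrite /t ltr_pdivrMr// mul1r -[2]/(1 + 1) ltrD2l.
have t0 : 0 < t by rewrite divr_gt0// ltr_pwDl.
exists (e ^- j), t; split; [by rewrite invr_ge0 exprn_ge0// ltW|by rewrite t0|].
move=> n; rewrite normrM normr_nat normrX ler_pdivlMl ?exprn_gt0//.
have [nj|jn] := ltnP n j.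
  by rewrite bin_small// mul0r mulr0 exprn_ge0// ltW.
(* The left-hand side is one term of the expansion of [(`|b| + e) ^+ n]. *)
have -> : t = `|b| + e by rewrite /e addrC subrK.
have jn' : (j < n.+1)%N by [].
rewrite [leRHS]exprDn (bigD1 (Ordinal jn')) //= mulrCA [e ^+ j * _]mulrC mulr_natl.
rewrite lerDl sumr_ge0// => i _.
by rewrite mulrn_wge0// mulr_ge0// exprn_ge0// ltW.
Qed.

End NumericalSeries.

(** * Geometric series in the Grassmann algebra *)

Section GrassmannSeries.
Variable R : realType.
Local Notation Lam := (Lam R).
Local Notation C := (Cx R).
Implicit Types (a y : Lam) (u v : nat -> Lam) (l m : Lam) (I J L : {fset nat}).

(** Stronger than [abs_sum], and preserved by multiplication by a fixed element, whose coefficients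
    are finite combinations by [gcoefM]. *)
Definition gsum u l : Prop := forall I,
  geom_bounded (fun n => (u n)@_I : C) /\ sums_to (fun n => (u n)@_I : C) (l@_I).

Lemma gsumD u v l m : gsum u l -> gsum v m -> gsum (fun n => u n + v n) (l + m).
Proof.
move=> hu hv I; have [bu su] := hu I; have [bv sv] := hv I.
rewrite gcoefD; split.
  by under eq_fun do rewrite gcoefD; exact: geom_boundedD.
by apply: (eq_sums_to _ (sums_toD su sv)) => n; rewrite gcoefD.
Qed.

Lemma gsumM a u l : gsum u l -> gsum (fun n => a * u n) (a * l).
Proof.
move=> hu I.
have E (x : Lam) : (a * x)@_I = \sum_(J <- fpowerset I) \sum_(L <- fpowerset I)
    (a@_J * (zeta_mul C J L)@_I) * x@_L.
  by rewrite gcoefM; do 2!apply: eq_bigr => ? _; rewrite mulrAC.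
rewrite E; split.
  under eq_fun do rewrite E.
  apply: geom_bounded_big => J; apply: geom_bounded_big => L.
  by apply: geom_boundedZ; have [] := hu L.
apply: (@eq_sums_to _ (fun n => \sum_(J <- fpowerset I) \sum_(L <- fpowerset I)
    (a@_J * (zeta_mul C J L)@_I) * (u n)@_L)) => [n|]; first by rewrite E.
apply: sums_to_big => J; apply: sums_to_big => L.
by apply: sums_toZ; have [] := hu L.
Qed.

Lemma gsumB u v l m : gsum u l -> gsum v m -> gsum (fun n => u n - v n) (l - m).
Proof.
move=> hu /(gsumM (-1)); rewrite mulN1r; under eq_fun do rewrite mulN1r.
exact: gsumD.
Qed.

Lemma gsum_shift u l : gsum u l ->
  gsum (fun n => if n is m.+1 then u m else 0) l.
Proof.
move=> hu I; have [bu su] := hu I.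
rewrite (_ : (fun n => _@_I) = fun n => if n is m.+1 then (u m)@_I else 0); last first.
  by apply/funext => -[|n] //; rewrite gcoef0.
by split; [exact: geom_bounded_shift|exact: sums_to_shift].
Qed.

Lemma geom_bounded_normed_cvg (v : nat -> C) : geom_bounded v ->
  cvgn (series (fun n => `|v n|)).
Proof.
move=> [k [t [k0 /andP[t0 t1] hv]]].
(* The comparison with a geometric series is made over the reals, and its limit is transferred
   back. *)
pose w n : R := complex.Re `|v n|.
have wE n : `|v n| = real_complex R (w n) by rewrite /w RRe_real.
pose k' : R := complex.Re k; pose t' : R := complex.Re t.
have kE : k = real_complex R k' by rewrite /k' RRe_real// ger0_real.
have tE : t = real_complex R t' by rewrite /t' RRe_real// gtr0_real.
have t0' : 0 < t' by rewrite -ltcR -tE.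
have t1' : t' < 1 by rewrite -ltcR -tE.
have cw : cvgn (series w).
  apply: (@series_le_cvg _ w (geometric k' t')).
  - by move=> n; rewrite -lecR -wE normr_ge0.
  - by move=> n; rewrite /geometric /= mulr_ge0// ?exprn_ge0// ?(ltW t0')// -lecR -kE.
  - by move=> n; rewrite /geometric /= -lecR -wE rmorphM rmorphXn /= -kE -tE.
  - by apply: is_cvg_geometric_series; rewrite gtr0_norm.
apply/cvg_ex; exists (real_complex R (limn (series w))).
rewrite (_ : series _ = (fun n => real_complex R (series w n))); last first.
  apply/funext => n; rewrite /series /= rmorph_sum.
  by apply: eq_bigr => i _; rewrite wE.
apply/cvgrPdist_lt => e e0.
have eE : e = real_complex R (complex.Re e) by rewrite RRe_real// gtr0_real.
have e0' : 0 < complex.Re e by rewrite -ltcR -eE.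
move/cvgrPdist_lt : cw => /(_ _ e0'); apply: filterS => n h.
rewrite -rmorphB normc_def /= expr0n addr0 sqrtr_sqr eE ltcR//.
Qed.

Lemma gsum_abs_sum u l : gsum u l -> abs_sum u l.
Proof.
by move=> h I; have [b s] := h I; split; [exact: (geom_bounded_normed_cvg b)|exact: s].
Qed.

Lemma geom_bounded_cvg0 (v : nat -> C) : geom_bounded v -> v @ \oo --> (0 : C).
Proof.
by move=> /geom_bounded_normed_cvg/cvg_series_cvg_0/norm_cvg0.
Qed.

(** The number of terms does not grow with [n]: this reduces the powers of [y] to finitely many
    numerical sequences. *)
Lemma expr_even_binom y N n : is_even y -> soul y ^+ N = 0 ->
  y ^+ n = \sum_(j < N) ('C(n, j)%:R * body y ^+ (n - j)) *: soul y ^+ j.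
Proof.
move=> ey yN; have -> : y ^+ n = ((body y)%:A + soul y) ^+ n by rewrite addrC /soul subrK.
rewrite exprDn_comm; last by apply: even_comm; exact: is_even_alg.
pose F j := ('C(n, j)%:R * body y ^+ (n - j)) *: soul y ^+ j.
rewrite (eq_bigr (fun i : 'I_n.+1 => F i)) => [|i _]; last first.
  rewrite /F exprZn expr1n mulr_algl -scaler_nat scalerA//.
have FN j : (N <= j)%N -> F j = 0.
  by move=> /subnK <-; rewrite /F exprD yN mulr0 scaler0.
have Fn j : (n < j)%N -> F j = 0 by move=> nj; rewrite /F bin_small// mul0r scale0r.
have sum_widen p q : (p <= q)%N -> (forall j, (p <= j)%N -> F j = 0) ->
    \sum_(i < p) F i = \sum_(i < q) F i.
  move=> /subnKC <- h; rewrite big_split_ord /= [X in _ = _ + X]big1 ?addr0// => i _.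
  by rewrite h// leq_addr.
(* The binomial sum stops at [n] and the truncated one at [N]; both agree with the sum of length
   [N + n.+1]. *)
by rewrite (sum_widen _ (N + n.+1)%N)// ?leq_addl// -(sum_widen N)// leq_addr.
Qed.

(** Only the body has to be small. The remainder of the partial sum is [(1 - y)^-1 * y ^+ n], whose
    coefficients tend to 0. *)
Lemma gsum_geometric y : is_even y -> `|body y| < 1 ->
  gsum (fun n => y ^+ n) (1 - y)^-1.
Proof.
move=> ey y1; set N := #|` msupp y|.+1.
have yN : soul y ^+ N = 0 by rewrite soul_nilpotent.
have gb I : geom_bounded (fun n => (y ^+ n)@_I : C).
  under eq_fun do rewrite (expr_even_binom _ ey yN) gcoef_sum.
  apply: geom_bounded_big => j; under eq_fun do rewrite gcoefZ mulrC.
  by apply: geom_boundedZ; exact: geom_bounded_binom.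
have u1y : 1 - y \is a GRing.unit.
  apply: even_unit; first by apply: is_evenD; [exact: is_even1|exact: is_evenN].
  rewrite bodyB body1 subr_eq0; apply: contraTneq y1 => <-.
  by rewrite normr1 ltxx.
move=> I; split => //.
have partial n : \sum_(0 <= k < n) y ^+ k = (1 - y)^-1 - (1 - y)^-1 * y ^+ n.
  rewrite -[LHS](mulKr u1y) big_mkord -[1 - y]opprB mulNr -subrX1 opprB opprB.
  by rewrite mulrBr mulr1.
have gb' : geom_bounded (fun n => ((1 - y)^-1 * y ^+ n)@_I : C).
  under eq_fun do rewrite gcoefM.
  apply: geom_bounded_big => J; apply: geom_bounded_big => L.
  by under eq_fun do rewrite mulrAC; apply: geom_boundedZ.
rewrite /sums_to (_ : series _ = fun n => (1 - y)^-1@_I - ((1 - y)^-1 * y ^+ n)@_I); last first.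
  by apply/funext => n; rewrite /series /= -gcoef_sum partial gcoefD gcoefN.
rewrite -[X in _ --> X]subr0.
exact: (cvgB (cvg_cst _) (geom_bounded_cvg0 gb')).
Qed.

End GrassmannSeries.

(** * Exponentials of the fields [L_1] and [G_(1/2)] *)

Section Exponentials.
Variable R : realType.
Local Notation Lam := (Lam R).
Local Notation C := (Cx R).
Implicit Types (a p : Lam) (s : sseries R).

Variables (A M : Lam).
Hypotheses (eA : is_even A) (oM : is_odd M).
Local Notation E := (expo (csingle A 1 M 1)).

Lemma expo_fst0 s : (E s).1 0%N = 0.
Proof. by rewrite /expo /= big_ord0 oppr0. Qed.

Lemma expo_snd0 s : (E s).2 0%N = 0.
Proof. by rewrite /expo /= big_ord0 oppr0. Qed.

(** [E] is the vector field [A (x^2 d/dx + phi x d/dphi) + M x (d/dphi - phi d/dx)]. In its last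
    term, [M] moves past [phi] and changes the sign. *)
Lemma expo_fstS s n : (E s).1 n.+1 = A * (n%:R *: s.1 n) + M * s.2 n.
Proof.
rewrite /expo /= big_ord_recl big1 => [|i _]; last first.
  by rewrite /= !mul0r addr0.
rewrite addr0 /= /mulX /dX /= subn1 /= !mulrN -opprD opprK.
congr (A * _ + M * _); case: n => [|n] /=; last by rewrite subSS subn1.
by rewrite scale0r.
Qed.

Lemma expo_sndS s n :
  (E s).2 n.+1 = A * (n.+1%:R *: s.2 n) + M * (n.+1%:R *: s.1 n.+1).
Proof.
rewrite /expo /= big_ord_recl big1 => [|i _]; last first.
  by rewrite /= (evpart_even (@is_even0 R)) (odpart_even (@is_even0 R)) subr0 !mul0r addr0.
rewrite addr0 /= (evpart_even eA) (odpart_even eA) (evpart_odd oM) (odpart_odd oM).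
rewrite subr0 sub0r /mulX /dX /= subn1 /= mulrN mulNr -opprD opprK.
congr (A * _ + M * _); rewrite divff ?pnatr_eq0// scale1r.
case: n => [|n] /=; first by rewrite add0r scale1r.
by rewrite subSS subn1 /= -[in RHS]natr1 scalerDl scale1r.
Qed.

Let M2 : M * M = 0. Proof. exact: odd_sqr. Qed.

Let MXM (X : Lam) : is_even X -> M * (M * X) = 0.
Proof. by move=> eX; rewrite mulrA M2 mul0r. Qed.

Lemma AMX n : A * (M * A ^+ n) = M * A ^+ n.+1.
Proof. by rewrite mulrA (even_comm M eA) -mulrA -exprS. Qed.

(** Each application raises the degree in [x] by one, and [M] survives at most once since
    [M * M = 0]. At [k = 0] the factor [k] makes [k.-1] harmless. *)
Lemma iter_expo_xser k :
  (forall n, (iter k E (xser R)).1 n = if n == k.+1 then k`!%:R *: A ^+ k else 0) /\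
  (forall n, (iter k E (xser R)).2 n =
    if n == k then (k`! * k)%:R *: (M * A ^+ k.-1) else 0).
Proof.
elim: k => [|k [IH1 IH2]]; split => n.
- by rewrite /= fact0 expr0 scale1r; case: (n == 1)%N.
- by rewrite /= muln0 scale0r if_same.
- case: n => [|n]; rewrite iterS; first by rewrite expo_fst0.
  rewrite expo_fstS IH1 IH2 eqSS; case: eqP => [->|_].
    rewrite (gtn_eqF (ltnSn k)) mulr0 addr0 scalerA -scalerAr -exprS.
    by rewrite -natrM factS.
  rewrite scaler0 mulr0 add0r; case: eqP => _; last by rewrite mulr0.
  by rewrite -scalerAr MXM ?scaler0//; exact: is_evenX.
- case: n => [|n]; rewrite iterS; first by rewrite expo_snd0.
  rewrite expo_sndS IH1 IH2 eqSS; case: eqP => [->|_]; last first.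
    by rewrite !scaler0 !mulr0 addr0.
  rewrite !scalerA -!scalerAr; case: k {IH1 IH2} => [|k].
    by rewrite muln0 mulr0 scale0r add0r mul1r muln1.
  rewrite AMX /= -scalerDl; congr (_ *: _).
  by rewrite !factS !natrM -!natr1; ring.
Qed.

Lemma iter_expo_phiser k :
  (forall n, (iter k E (phiser R)).1 n =
    if n == k then (if k is j.+1 then k`!%:R *: (M * A ^+ j) else 0) else 0) /\
  (forall n, (iter k E (phiser R)).2 n = if n == k then k`!%:R *: A ^+ k else 0).
Proof.
elim: k => [|k [IH1 IH2]]; split => n.
- by rewrite /= if_same.
- by rewrite /= fact0 expr0 scale1r; case: (n == 0)%N.
- case: n => [|n]; rewrite iterS; first by rewrite expo_fst0.
  rewrite expo_fstS IH1 IH2 eqSS; case: eqP => [->|_]; last first.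
    by rewrite scaler0 !mulr0 addr0.
  case: k {IH1 IH2} => [|k].
    by rewrite scaler0 mulr0 add0r -scalerAr.
  rewrite -!scalerAr AMX scalerA -scalerDl; congr (_ *: _).
  by rewrite [in RHS]factS natrM -[in RHS]natr1; ring.
- case: n => [|n]; rewrite iterS; first by rewrite expo_snd0.
  rewrite expo_sndS IH1 IH2 eqSS [X in _ + X](_ : _ = 0) ?addr0; last first.
    case: eqP => _; last by rewrite scaler0 mulr0.
    case: k {IH1 IH2} => [|k]; first by rewrite scaler0 mulr0.
    by rewrite -!scalerAr MXM ?scaler0//; exact: is_evenX.
  case: eqP => [->|_]; last by rewrite scaler0 mulr0.
  by rewrite -!scalerAr scalerA -exprS factS natrM.
Qed.

Lemma big_ord_single (m j : nat) (F : nat -> Lam) : (j < m)%N ->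
  (forall k, k != j -> F k = 0) -> \sum_(k < m) F k = F j.
Proof.
move=> jm h; rewrite (bigD1 (Ordinal jm)) //= big1 ?addr0// => i ij.
by apply: h; apply: contra_neq ij => ij; apply: val_inj.
Qed.

(** Summed up: [x / (1 - A x) + phi M x / (1 - A x)^2]. For each coefficient a single term of the
    exponential series contributes. *)
Lemma Etilde_fst n :
  ((Etilde (csingle A 1 M 1)).1.1 n = if n is m.+1 then A ^+ m else 0) /\
  ((Etilde (csingle A 1 M 1)).1.2 n = n%:R *: (M * A ^+ n.-1)).
Proof.
have nF m : (m`!%:R : C) != 0 by rewrite pnatr_eq0 -lt0n fact_gt0.
rewrite /= /exp_expo /=; split.
  under eq_bigr do rewrite (iter_expo_xser _).1.
  case: n => [|n]; first by rewrite big1// => i _; rewrite scaler0.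
  rewrite (big_ord_single (j := n) (F := fun k => k`!%:R^-1 *:
    (if n.+1 == k.+1 then k`!%:R *: A ^+ k else 0))).
  - by rewrite eqxx scalerA mulVf// scale1r.
  - by rewrite mulnS; lia.
  - by move=> k kn; rewrite eqSS eq_sym (negbTE kn) scaler0.
under eq_bigr do rewrite (iter_expo_xser _).2.
rewrite (big_ord_single (j := n) (F := fun k => k`!%:R^-1 *:
  (if n == k then (k`! * k)%:R *: (M * A ^+ k.-1) else 0))).
- by rewrite eqxx scalerA natrM mulKf.
- by lia.
- by move=> k kn; rewrite eq_sym (negbTE kn) scaler0.
Qed.

(** Summed up: [(phi + M x) / (1 - A x)]. *)
Lemma Etilde_snd n :
  ((Etilde (csingle A 1 M 1)).2.1 n = if n is m.+1 then M * A ^+ m else 0) /\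
  ((Etilde (csingle A 1 M 1)).2.2 n = A ^+ n).
Proof.
have nF m : (m`!%:R : C) != 0 by rewrite pnatr_eq0 -lt0n fact_gt0.
rewrite /= /exp_expo /=; split.
  under eq_bigr do rewrite (iter_expo_phiser _).1.
  rewrite (big_ord_single (j := n) (F := fun k => k`!%:R^-1 *:
    (if n == k then (if k is j.+1 then k`!%:R *: (M * A ^+ j) else 0) else 0))).
  - by rewrite eqxx; case: n => [|n]; rewrite ?scaler0// scalerA mulVf// scale1r.
  - by lia.
  - by move=> k kn; rewrite eq_sym (negbTE kn) scaler0.
under eq_bigr do rewrite (iter_expo_phiser _).2.
rewrite (big_ord_single (j := n) (F := fun k => k`!%:R^-1 *:
  (if n == k then k`!%:R *: A ^+ k else 0))).
- by rewrite eqxx scalerA mulVf// scale1r.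
- by lia.
- by move=> k kn; rewrite eq_sym (negbTE kn) scaler0.
Qed.

End Exponentials.

(** * Values of the coordinate series *)

Section Values.
Variable R : realType.
Local Notation Lam := (Lam R).
Local Notation C := (Cx R).
Implicit Types (a p A M : Lam).

Lemma eq_gsum (u v : nat -> Lam) l : u =1 v -> gsum u l -> gsum v l.
Proof. by move/funext ->. Qed.

Lemma exprD_sqr0 (x n : Lam) k : is_even x -> n * n = 0 ->
  (x + n) ^+ k = x ^+ k + k%:R *: (n * x ^+ k.-1).
Proof.
move=> ex n2; elim: k => [|k IH]; first by rewrite !expr0 scale0r addr0.
rewrite exprS IH mulrDl !mulrDr -!scalerAr [n * (n * _)]mulrA n2 mul0r scaler0 addr0.
rewrite -exprS -addrA; congr (_ + _); case: k {IH} => [|k].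
  by rewrite scale0r add0r scale1r.
rewrite mulrA (even_comm n ex) -mulrA -exprS /= -[X in _ + X]scale1r -scalerDl.
by rewrite natr1.
Qed.

Lemma map_value_single A M a : is_even A -> is_odd M -> `|body A * body a| < 1 ->
  map_value (Etilde (csingle A 1 M 1)) a
    (spoint (evpart a * (1 - (A * evpart a + odpart a * M))^-1)
            ((M * evpart a + odpart a) * (1 - A * evpart a)^-1)).
Proof.
move=> eA oM Aa1; set x := evpart a; set r := odpart a.
have ex : is_even x := is_even_evpart _; have or : is_odd r := is_odd_odpart _.
have eAx : is_even (A * x) by exact: is_evenM.
have erM : is_even (r * M) by exact: is_oddM.
have n2 : r * M * (r * M) = 0 by exact: odd_mul_sqr0.
have ey : is_even (A * x + r * M) by exact: is_evenD.
have bAx : `|body (A * x)| < 1 by rewrite bodyM body_evpart.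
have by1 : `|body (A * x + r * M)| < 1.
  by rewrite bodyD [body (r * M)]bodyM (body_odd or) mul0r addr0.
have e1y y : is_even y -> is_even (1 - y)^-1.
  by move=> ey'; apply: is_evenV; apply: is_evenD; [exact: is_even1|exact: is_evenN].
rewrite /map_value evpart_spoint ?odpart_spoint; last first.
- by apply: is_odd_evenM; [apply: is_oddD => //; exact: is_odd_evenM|exact: e1y].
- by apply: is_evenM => //; exact: e1y.
- by apply: is_odd_evenM; [apply: is_oddD => //; exact: is_odd_evenM|exact: e1y].
- by apply: is_evenM => //; exact: e1y.
have g1 := gsum_geometric eAx bAx; have g2 := gsum_geometric ey by1.
have AxE k : (A * x) ^+ k = A ^+ k * x ^+ k by rewrite exprMn_comm//; exact: even_comm.
split; apply: gsum_abs_sum.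
  (* As [(r M)^2 = 0], [n r M (A x)^(n-1) = (A x + r M)^n - (A x)^n]. *)
  have := gsumD (gsum_shift (gsumM x g1)) (gsumM x (gsumB g2 g1)).
  rewrite -mulrDr subrKC; apply: eq_gsum => n.
  rewrite (Etilde_fst eA oM n).1 (Etilde_fst eA oM n).2 -/x -/r.
  rewrite exprD_sqr0// [_ ^+ n + _]addrC addrK; case: n => [|n].
    by rewrite !scale0r !mulr0 !addr0 mul0r.
  rewrite /= [RHS]mulrDl; congr (_ + _).
    by rewrite AxE mulrA (even_comm (A ^+ n) ex) -mulrA -exprS.
  rewrite -!scalerAr -scalerAl; congr (_ *: _).
  by rewrite [LHS]even_comm// AxE exprSr !mulrA.
have := gsumD (gsum_shift (gsumM (M * x) g1)) (gsumM r g1).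
rewrite -mulrDl; apply: eq_gsum => n.
rewrite (Etilde_snd eA oM n).1 (Etilde_snd eA oM n).2 -/x -/r mulrDl AxE mulrA.
congr (_ + _); case: n => [|n]; first by rewrite mul0r.
by rewrite AxE exprS !mulrA; congr (_ * _); rewrite -!mulrA; congr (_ * _);
  rewrite even_comm.
Qed.

(** The exponential at infinity turns [I] into [I o s_p]; the factor [-i] is the one that
    [canonical] puts on the odd coefficients. The hypothesis is the condition of convergence at
    [I(a)]. *)
Lemma map_value_sinv p a : `|body p| < `|body a| ->
  map_value (Etilde (csingle (evpart p) 1 (- 'i *: odpart p) 1)) (sinv a)
    (sinv (sshift p a)).
Proof.
move=> pa; have a0 : body a != 0 by rewrite -normr_gt0 (le_lt_trans _ pa).
have ep := is_even_evpart p; have op := is_odd_odpart p.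
have := @map_value_single (evpart p) (- 'i *: odpart p) (sinv a) ep (is_oddZ _ op).
rewrite body_evpart body_sinv// normrM normfV ltr_pdivrMr ?normr_gt0// mul1r.
move=> /(_ pa); congr map_value.
rewrite evpart_sinv_scaled odpart_sinv_scaled /sinv evpart_sshift odpart_sshift.
set w := evpart a; set z := evpart p; set r := odpart a; set t := odpart p.
have ew : is_even w := is_even_evpart _; have or : is_odd r := is_odd_odpart _.
have uw : w \is a GRing.unit by apply: even_unit => //; rewrite body_evpart.
have ewV : is_even w^-1 by exact: is_evenV.
have ed : is_even (w - z) by apply: is_evenD => //; exact: is_evenN.
have d0 : body (w - z) != 0.
  rewrite bodyB !body_evpart subr_eq0; apply: contraTneq pa => ->.
  by rewrite ltxx.
have eE : is_even (w - z - r * t) by apply: is_evenD => //; apply: is_evenN; exact: is_oddM.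
have uE : w - z - r * t \is a GRing.unit.
  by apply: even_unit => //; rewrite bodyB [body (r * t)]bodyM (body_odd or) mul0r subr0.
have -> : 1 - (z * w^-1 + 'i *: (r * w^-1) * (- 'i *: t)) = (w - z - r * t) * w^-1.
  rewrite -scalerAl -scalerAr scalerA mulrN -expr2 sqrCi opprK scale1r !mulrBl mulrV//.
  by rewrite -!mulrA (even_comm t ewV) opprD addrA.
have -> : 1 - z * w^-1 = (w - z) * w^-1 by rewrite mulrBl mulrV.
rewrite !invrM ?unitrV//; last exact: even_unit.
rewrite invrK mulKr//; congr spoint.
rewrite odd_sub_mul_inv// -!scalerAl scaleNr addrC -scalerBr -mulrBl -scalerAl mulrA mulrVK//.
Qed.

(** Makes the identity coordinate an instance of the closed form. *)
Lemma coeffs0E : @coeffs0 R = csingle 0 1 0 1.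
Proof. by rewrite /coeffs0 /csingle; congr pair; apply/funext => j; case: ifP. Qed.

Lemma map_value_id a : map_value (Etilde coeffs0) a a.
Proof.
rewrite coeffs0E; have := @map_value_single 0 0 a (@is_even0 R) (@is_odd0 R).
rewrite body_0 mul0r normr0 ltr01 => /(_ isT).
by rewrite !mul0r mulr0 addr0 add0r subr0 invr1 !mulr1 spoint_parts.
Qed.

Lemma Ehat1 (AM : coeffs R) : Ehat 1 AM = Etilde AM.
Proof.
have p1 (s : sseries R) : pow_2L0 1 s = s.
  by case: s => f g; rewrite /pow_2L0; congr pair; apply/funext => n; rewrite expr1n mulr1.
by rewrite /Ehat !p1.
Qed.

Lemma in_H_single A M : is_even A -> is_odd M -> in_H (csingle A 1 M 1).
Proof.
move=> eA oM; split=> [k|k|].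
- by rewrite /csingle /=; case: ifP => // _; exact: is_even0.
- by rewrite /csingle /=; case: ifP => // _; exact: is_odd0.
have b1 : 0 < 1 + `|body A| by rewrite ltr_pwDl.
(* A radius below [1 / |body A|] that makes sense for [body A = 0], too. *)
exists (1 + `|body A|)^-1; first by rewrite invr_gt0.
move=> a ar; eexists; apply: map_value_single => //.
rewrite normrM; apply: (@le_lt_trans _ _ (`|body A| * (1 + `|body A|)^-1)).
  by rewrite ler_wpM2l// ltW.
by rewrite ltr_pdivrMr// mul1r ltrDr.
Qed.

Lemma in_H0 : in_H (@coeffs0 R).
Proof. by rewrite coeffs0E; apply: in_H_single; [exact: is_even0|exact: is_odd0]. Qed.

Lemma canonical_sph_tubes n (Q : SKdata R n) (p : Lam) (cs : seq Lam) (rs : seq C) :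
  skinf Q = csingle (evpart p) 1 (odpart p) 1 -> nth 0 cs 0 = p ->
  (forall k : 'I_n, nth 0 cs k.+1 = skcenter Q k) ->
  (forall k : 'I_n, tnth (skloc Q) k = (1, coeffs0)) ->
  (forall k, (k <= n)%N -> 0 < nth 0 rs k) ->
  Defs.canonical Q (sph_tubes n cs rs).
Proof.
move=> infE cs0 csS locE rs0.
eexists; eexists; eexists; split; first by [].
- by [].
- by move=> k /=; rewrite /bump /= csS.
(* Beyond this radius the series at infinity converges and the points lie in the domain of tube
   0. *)
- exists (`|body p| + (nth 0 rs 0)^-1).
    by rewrite ltr_wpDl// invr_gt0 rs0.
  move=> a; rewrite /dewitt /= => ha.
  have pa : `|body p| < `|body a| by rewrite (lt_trans _ ha)// ltrDl invr_gt0 rs0.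
  split.
    rewrite cs0 tube_dom_falseE ?rs0//=.
    rewrite -(ltrD2l `|body p|) (lt_le_trans ha)//.
    by rewrite -{1}[body a](subrK (body p)) addrC ler_normD.
  have ME : (fun k => - 'i *: (csingle (evpart p) 1 (odpart p) 1).2 k) =
      (csingle (evpart p) 1 (- 'i *: odpart p) 1).2.
    by apply/funext => k /=; case: ifP => // _; rewrite scaler0.
  rewrite infE cs0 ME.
  have -> : tube_coord false p (inl a) = sinv (sshift p a).
    rewrite /tube_coord /smap /= /oscale evpart_sinv_scaled odpart_sinv_scaled.
    by rewrite scalerA mulrNN mul1r.
  exact: map_value_sinv.
- move=> k; exists (nth 0 rs k.+1); first exact: rs0.
  move=> a; rewrite /dewitt /= => ha; rewrite locE /= Ehat1 /bump /= !add1n csS.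
  split; first by rewrite tube_dom_trueE.
  rewrite /tube_coord /smap /= oscale1; exact: map_value_id.
Qed.

End Values.

(** * Sewing *)

Section Transport.
Variable R : realType.
Local Notation Lam := (Lam R).
Local Notation C := (Cx R).
Local Notation sphere := (ssphere R).
Local Notation opc := (one_point_compactification C).
Implicit Types (a p q : Lam) (be : bool).

Lemma eq_superconformal_on (S : srs_data R) (D : set S) (h h' : S -> Lam) :
  {in D, h =1 h'} -> superconformal_on D h -> superconformal_on D h'.
Proof.
move=> hh sc al; have [V [oV DV [H sH hH]]] := sc al.
exists V; split => //; exists H => // x xD; rewrite -hh ?hH//.
by move: xD; rewrite !inE => -[].
Qed.

Lemma superconformal_map_shift p : superconformal_map (sph_shift p : sphere -> sphere).
Proof.
move=> be; apply: (@eq_superconformal_on sphere _ (oscale 1 \o smap be \o sph_shift p)).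
  by move=> x _ /=; rewrite oscale1.
apply: superconformal_on_shift; first exact: expr1n.
  exact: srs_open_shift_sdom.
by [].
Qed.

Lemma sshift_spt_add c p : sshift c (spt_add c p) = p.
Proof.
rewrite /sshift evpart_spt_add odpart_spt_add -[RHS]spoint_parts; congr spoint.
  rewrite mulrDl (odd_sqr (is_odd_odpart _)) add0r.
  by glin.
by rewrite addrC addKr.
Qed.

Lemma sph_shift_tube_pt be c p :
  sph_shift c (tube_pt be (spt_add c p)) = tube_pt be p.
Proof.
case: be => /=; first by rewrite sshift_spt_add.
congr inr; apply: val_inj => /=.
rewrite shift_ooE ?body_shift_den_oo ?body_0//.
rewrite (evpart_even (@is_even0 R)) (odpart_even (@is_even0 R)).
by rewrite !mulr0 scaler0 addr0 !mul0r /spoint addr0.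
Qed.

(** As [s_p o s_c] is the translation for [spt_add c p], the tubes with centres [cs] are those with
    centres [cs'] pulled back by the translation [c]. *)
Lemma tubes_equiv_shift n c (cs cs' : seq Lam) (rs : seq C) :
  (forall k, (k <= n)%N -> 0 < nth 0 rs k) ->
  (forall k, (k <= n)%N -> nth 0 cs k = spt_add c (nth 0 cs' k)) ->
  tubes_equiv (sph_tubes n cs rs) (sph_tubes n cs' rs).
Proof.
move=> rs0 csE; exists (sph_shift c), (sph_shift (- c)); split.
- exact: sph_shiftK.
- exact: sph_shiftNK.
- exact: superconformal_map_shift.
- exact: superconformal_map_shift.
- move=> k; have kn : (k <= n)%N by rewrite -ltnS.
  split; first by rewrite /= csE// sph_shift_tube_pt.
  exists (tdom (sph_tubes n cs rs) k); split.
  + by apply: srs_open_tube_dom; exact: rs0.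
  + by have [] := tube_ptP (k != 0 :> nat) (nth 0 cs k) (rs0 k kn).
  + move=> x /=; rewrite /tube_dom /tube_coord csE// /= sph_shift_comp => -[h1 h2].
    by split.
Qed.

(* [U] is the sphere up to the bijection [Phi], with charts that are
   restrictions of the charts of the sphere to the sets [W c]. *)
Variables (U : srs_data R) (Phi : U -> sphere) (Psi : sphere -> U).
Hypotheses (PhiK : cancel Phi Psi) (PsiK : cancel Psi Phi).
Variables (kap : chart U -> bool) (B : chart U -> set opc).
Local Notation W c := (body_pt (R := R) @^-1` B c).
Hypothesis cdomE : forall c : chart U, cdom c = Phi @^-1` W c.
Hypothesis cmapE : forall (c : chart U) A, cdom c A -> cmap c A = smap (kap c) (Phi A).
Hypothesis W_open : forall c, @srs_open R sphere (W c).
Hypothesis W_sub : forall c, W c `<=` sdom (kap c).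
Hypothesis W_cover : forall be x, sdom be x -> exists2 c, kap c = be & W c x.

Lemma cmap_imageE c (D : set sphere) :
  cmap c @` (Phi @^-1` D `&` cdom c) = smap (kap c) @` (D `&` W c).
Proof.
apply/seteqP; split => [_ [A [DA dA] <-]|_ [x [Dx Wx] <-]].
  by exists (Phi A); [move: dA; rewrite cdomE|rewrite cmapE].
have dx : cdom c (Psi x) by rewrite cdomE /= PsiK.
by exists (Psi x); [split => //=; rewrite PsiK|rewrite cmapE// PsiK].
Qed.

Lemma srs_openI_sphere (D D' : set sphere) :
  srs_open D -> srs_open D' -> srs_open (D `&` D').
Proof. by apply: srs_openI => be; exact: smap_inj. Qed.

Lemma setI_W_sdom c (D : set sphere) : D `&` W c `&` sdom (kap c) = D `&` W c.
Proof. by apply/setIidPl => x [_ /W_sub]. Qed.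

Lemma superconformal_on_Phi s p be (D : set sphere) : s ^+ 2 = 1 ->
  srs_open D -> D `<=` sph_shift p @^-1` sdom be ->
  superconformal_on (Phi @^-1` D) (oscale s \o smap be \o sph_shift p \o Phi).
Proof.
move=> s2 oD Dbe c.
have Dbe' : D `&` W c `<=` sph_shift p @^-1` sdom be by move=> x [/Dbe].
have := superconformal_on_shift s2 (srs_openI_sphere oD (W_open c)) Dbe' (kap c).
move=> [V [oV DV [H sH hH]]]; exists V; split => //.
  by rewrite cmap_imageE -(setI_W_sdom c D); exact: DV.
exists H => // A; rewrite !inE => -[DA dA]; rewrite cmapE// -hH//.
have WA : (W c) (Phi A) by move: dA; rewrite cdomE.
by rewrite inE; split; [split|exact: W_sub].
Qed.

Lemma srs_open_Phi (D : set sphere) : srs_open D -> srs_open (Phi @^-1` D).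
Proof.
move=> oD c; have [V oV DV] := srs_openI_sphere oD (W_open c) (kap c).
by exists V => //; rewrite cmap_imageE -(setI_W_sdom c D); exact: DV.
Qed.

(** The charts of [U] of type [be] cover the chart [be] of the sphere; the image of [D] is the union
    of their images, each open. *)
Lemma srs_open_PhiP (D : set sphere) : srs_open (Phi @^-1` D) -> srs_open D.
Proof.
move=> oD be; pose V c : set C := sval (cid2 (oD c)).
have oV c : open (V c) by rewrite /V; case: cid2.
have VE c : smap (kap c) @` (D `&` W c) = dewitt (V c).
  by rewrite -cmap_imageE /V; case: cid2.
exists (\bigcup_(c in [set c | kap c = be]) V c).
  by apply: bigcup_open => c _.
apply/seteqP; split => [_ [x [Dx dx] <-]|a [c cbe Va]].
  have [c cbe Wx] := W_cover dx; exists c => //.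
  by rewrite -[V c _]/(dewitt (V c) (cmap be x)) -VE cbe; exists x.
have : dewitt (V c) a by [].
rewrite -VE => -[x [Dx Wx] <-]; rewrite -cbe; exists x => //.
by split => //; exact: W_sub.
Qed.

Lemma super_riemann_surface_Phi : super_riemann_surface U.
Proof.
split.
- move=> A; have [be h] : exists be, sdom be (Phi A).
    by case: (Phi A) => [a|q]; [exists true|exists false].
  by have [c _ Wc] := W_cover h; exists c; rewrite cdomE.
- move=> c A A'; rewrite !inE => dA dA'; rewrite !cmapE// => /smap_inj.
  rewrite !inE => h; apply: (can_inj PhiK); apply: h; apply: W_sub;
    by [move: dA; rewrite cdomE|move: dA'; rewrite cdomE].
- move=> c; rewrite cdomE.
  have sub : W c `<=` sph_shift 0 @^-1` sdom (kap c).
    by move=> x /W_sub; rewrite /= sph_shift0.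
  apply: eq_superconformal_on (superconformal_on_Phi (expr1n _ 2) (W_open c) sub).
  move=> A; rewrite inE => WA; rewrite /= oscale1 sph_shift0 cmapE//.
  by rewrite cdomE.
Qed.

Lemma same_body_Phi A A' : same_body A A' <-> body_pt (Phi A) = body_pt (Phi A').
Proof.
split=> [[c []]|h].
  rewrite cdomE => dA dA'; rewrite !cmapE ?cdomE// => h.
  by apply/same_body_sphere; exists (kap c); split => //; exact: W_sub.
have /same_body_sphere[be [dA dA' e]] := h.
have [c cbe Wc] := W_cover dA; exists c; rewrite !cmapE ?cdomE ?cbe//.
- by rewrite /= -h.
- by rewrite /= -h.
Qed.

Lemma supersphere_Phi : supersphere U.
Proof.
split; first exact: super_riemann_surface_Phi.
exists (body_pt (R := R) \o Phi); split.
- case=> [c|]; last by exists (Psi (ssphere_oo R)); rewrite /= PsiK.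
  by exists (Psi (inl c%:A)); rewrite /= PsiK /= body_alg.
- by move=> A A'; apply: iff_sym; exact: same_body_Phi.
- move=> D; rewrite open_body_pt.
  by split; [exact: srs_open_Phi|exact: srs_open_PhiP].
Qed.

Lemma superconformal_map_Phi : superconformal_map Phi.
Proof.
move=> be.
have sub : sdom be `<=` sph_shift 0 @^-1` sdom be by move=> x xbe; rewrite /preimage /mkset sph_shift0.
apply: (@eq_superconformal_on U _ (oscale 1 \o smap be \o sph_shift 0 \o Phi)).
  by move=> A _; rewrite /comp oscale1 sph_shift0.
apply: superconformal_on_Phi; [exact: expr1n|exact: srs_open_sdom|exact: sub].
Qed.

Lemma superconformal_map_Psi : superconformal_map Psi.
Proof.
move=> c; rewrite (_ : Psi @^-1` _ = W c); last first.
  by rewrite cdomE; apply/seteqP; split => x /=; rewrite PsiK.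
have sub : W c `<=` sph_shift 0 @^-1` sdom (kap c).
  by move=> x /W_sub; rewrite /= sph_shift0.
apply: eq_superconformal_on (superconformal_on_shift (expr1n _ 2) (W_open c) sub).
move=> x; rewrite inE => Wx; rewrite /= oscale1 sph_shift0 cmapE ?PsiK//.
by rewrite cdomE /= PsiK.
Qed.

Lemma transported_tubes n (cs : seq Lam) (rs : seq C) (P : 'I_n.+1 -> U)
    (D : 'I_n.+1 -> set U) (Om : 'I_n.+1 -> U -> Lam) :
  (forall k, (k <= n)%N -> 0 < nth 0 rs k) ->
  (forall j k : nat, (0 < j < k)%N -> (k <= n)%N ->
     body (nth 0 cs j) != body (nth 0 cs k)) ->
  (forall k, Phi (P k) = tpt (sph_tubes n cs rs) k) ->
  (forall k, D k = Phi @^-1` tdom (sph_tubes n cs rs) k) ->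
  (forall k A, D k A -> Om k A = tmap (sph_tubes n cs rs) k (Phi A)) ->
  supersphere_with_tubes (TubesData P D Om) /\
  tubes_equiv (TubesData P D Om) (sph_tubes n cs rs).
Proof.
move=> rs0 csn PE DE OmE; have [_ dist tubes] := sph_tubesP rs0 csn.
have DP k : D k (P k) by rewrite DE /= PE; have [] := tubes k.
split.
  split; first exact: supersphere_Phi.
    by move=> j k jk /same_body_Phi; rewrite /= !PE => /same_body_sphere; exact: dist.
  move=> k /=; have [h1 h2 h3 [V oV DV] _] := tubes k.
  have kn : (k <= n)%N by rewrite -ltnS.
  split => //.
  - by rewrite OmE// PE.
  - move=> A A'; rewrite !inE => dA dA'; rewrite !OmE// => /h3 h.
    by apply: (can_inj PhiK); apply: h; rewrite inE; [move: dA|move: dA']; rewrite DE.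
  - exists V => //; rewrite -DV; apply/seteqP; split => [_ [A dA <-]|_ [x dx <-]].
      by exists (Phi A); [move: dA; rewrite DE|rewrite OmE].
    have dP : D k (Psi x) by rewrite DE /= PsiK.
    by exists (Psi x) => //; rewrite OmE// PsiK.
  - set be := k != 0 :> nat; set p := nth 0 cs k; set r := nth 0 rs k.
    have sub : tube_dom be p r `<=` sph_shift p @^-1` sdom be by move=> x [].
    have oD : srs_open (tube_dom be p r) by apply: srs_open_tube_dom; exact: rs0.
    rewrite DE; apply: eq_superconformal_on (superconformal_on_Phi (tube_sign R be) oD sub).
    by move=> A; rewrite inE => dA; rewrite OmE// DE.
exists Phi, Psi; split => //.
- exact: superconformal_map_Phi.
- exact: superconformal_map_Psi.
- move=> k; split; first exact: PE.
  have kn : (k <= n)%N by rewrite -ltnS.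
  exists (D k); split => //.
    rewrite DE; apply: srs_open_Phi; apply: srs_open_tube_dom; exact: rs0.
  move=> A dA; split => //; last by rewrite /= OmE.
  by move: dA; rewrite DE.
Qed.

End Transport.

(** * Sewing two spheres along tubes with a common centre *)

Section SewnSpheres.
Variable R : realType.
Local Notation Lam := (Lam R).
Local Notation C := (Cx R).
Local Notation sphere := (ssphere R).
Local Notation opc := (one_point_compactification C).

Variables (m n : nat) (cs1 cs2 : seq Lam) (rs1 rs2 : seq C) (i : 'I_m.+1).
Variables (p : Lam) (r1 r2 : C).
Local Notation T1 := (sph_tubes m cs1 rs1).
Local Notation T2 := (sph_tubes n cs2 rs2).
Hypotheses (i0 : (i != 0 :> nat)) (pE1 : nth 0 cs1 i = p) (pE2 : nth 0 cs2 0 = p).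
Hypotheses (r20 : 0 < r2) (r21 : r2 < r1) (r1rs : r1 < nth 0 rs1 i)
  (r2rs : r2^-1 < nth 0 rs2 0).

Let r10 : 0 < r1. Proof. exact: lt_trans r21. Qed.
Let rs20 : 0 < nth 0 rs2 0. Proof. by apply: lt_trans r2rs; rewrite invr_gt0. Qed.

Definition unglue (x : T1 + T2) : sphere := match x with inl x => x | inr x => x end.

Local Notation kept := (@kept R m n T1 T2 i r1 r2).

Lemma tube_coord_true a : tube_coord true p (inl a) = sshift p a.
Proof. by rewrite /tube_coord /smap /= oscale1. Qed.

Lemma tube_coord_false a : tube_coord false p (inl a) = sinv (sshift p a).
Proof.
rewrite /tube_coord /smap /= /oscale evpart_sinv_scaled odpart_sinv_scaled.
by rewrite scalerA mulrNN mul1r.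
Qed.

Lemma real_nle (x y : C) : x \is Num.real -> y \is Num.real -> ~ (x <= y) <-> y < x.
Proof. by move=> rx ry; rewrite real_ltNge//; split=> /negP. Qed.

Lemma kept_left (x : sphere) : kept (inl x) <-> outside p r2 (body_pt x).
Proof.
rewrite /Defs.kept /tube_preim /= i0 pE1 tube_dom_trueE /outside.
case: x => [a|q] /=; last by split => // _ [].
rewrite tube_coord_true /scball /dewitt /= body_sshift.
rewrite -real_nle ?normr_real ?gtr0_real//; split => h h'.
  by apply: h; split => //; apply: le_lt_trans h' _; exact: lt_trans r1rs.
by apply: h; case: h'.
Qed.

Lemma kept_right (x : sphere) : kept (inr x) <-> inside p r1 (body_pt x).
Proof.
rewrite /Defs.kept /tube_preim /= pE2 tube_dom_falseE// /inside.
case: x => [a|q] /=; last first.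
  (* Over infinity the coordinate of tube 0 has body 0, so these points are removed. *)
  split=> // /not_andP[//|]; apply.
  rewrite /tube_coord /scball /dewitt /= body_oscale /smap /=.
  by rewrite (eqP (body_shift_oo_eq0 p q)) normr0 invr_ge0 ltW.
rewrite tube_coord_false /scball /dewitt /=.
have rV : (nth 0 rs2 0)^-1 < r2.
  by rewrite -[ltRHS]invrK ltf_pV2// posrE ?invr_gt0.
split=> h.
  apply/real_nle; rewrite ?normr_real ?gtr0_real// => h'; apply: h.
  have ap : 0 < `|body a - body p| := lt_le_trans r10 h'.
  split; first by apply: lt_le_trans h'; exact: lt_trans r21.
  by rewrite body_sinv body_sshift -?normr_gt0// normfV lef_pV2.
move=> [h1 h2].
move/real_nle : h => h; apply: h; rewrite ?normr_real ?gtr0_real//.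
have ap : 0 < `|body a - body p| by apply: le_lt_trans h1; rewrite invr_ge0 ltW.
by move: h2; rewrite body_sinv body_sshift -?normr_gt0// normfV lef_pV2.
Qed.

Lemma gluedP (x y : sphere) : kept (inl x) -> kept (inr y) ->
  @glued R m n T1 T2 i r1 r2 x y <-> x = y.
Proof.
move=> /kept_left kx /kept_right ky; rewrite /glued /tube_preim /= i0 pE1 pE2.
have rV : (nth 0 rs2 0)^-1 < r2.
  by rewrite -[ltRHS]invrK ltf_pV2// posrE ?invr_gt0.
split.
  case: x kx => [a|q] kx [[dx _] dy xy]; last by move: dx; rewrite tube_dom_trueE.
  (* [I] applied to the first coordinate of [x] is the second coordinate of the same point, and that
     coordinate is injective. *)
  move: xy; rewrite tube_coord_true -tube_coord_false => xy; apply/esym.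
  apply: (tube_coord_inj (be := false) (p := p) (r := nth 0 rs2 0)) => //.
    by rewrite inE.
  by rewrite inE tube_dom_falseE//=; apply: lt_trans kx.
move=> xy; rewrite -xy in ky *; case: x kx ky {xy} => [a|//] /= kx ky.
rewrite tube_dom_trueE tube_dom_falseE//= tube_coord_true tube_coord_false.
split => //; last exact: lt_trans kx.
split; first exact: lt_trans r1rs.
rewrite /sball /scball /dewitt /= body_sshift; split => //.
by apply/real_nle; rewrite ?normr_real ?gtr0_real.
Qed.

Lemma glue_relP (x y : T1 + T2) : kept x -> kept y ->
  glue_rel i r1 r2 x y <-> unglue x = unglue y.
Proof.
case: x => x; case: y => y kx ky //=; first exact: gluedP.
by rewrite (gluedP ky kx); split.
Qed.

Local Notation pt := (sewn_pt T1 T2 i r1 r2).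

Lemma sewn_ex (A : pt) : exists x, kept x /\ sval A = glue_class i r1 r2 x.
Proof. by case: A => A /= [x kx ->]; exists x. Qed.

Definition fold_pt (A : pt) : sphere := unglue (projT1 (cid (sewn_ex A))).

(** Gluing being equality, a point of the sewn surface is the set of kept copies of one point of the
    sphere. *)
Lemma mem_sewn (A : pt) y : sval A y <-> kept y /\ unglue y = fold_pt A.
Proof.
rewrite /fold_pt; case: cid => x [kx AE] /=; rewrite AE /glue_class /=.
by split=> -[ky] h; split => //; [apply/esym/glue_relP|apply/glue_relP].
Qed.

Lemma fold_pt_class (A : pt) x : kept x -> sval A = glue_class i r1 r2 x ->
  fold_pt A = unglue x.
Proof.
move=> kx AE; have : sval A x by rewrite AE; split => //; apply/glue_relP.
by move=> /mem_sewn[_ ->].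
Qed.

Lemma unfold_ex (x : sphere) : exists y : T1 + T2, kept y /\ unglue y = x.
Proof.
(* The two kept regions cover the sphere because [r2 < r1]. *)
have [ox|ix] : outside p r2 (body_pt x) \/ inside p r1 (body_pt x).
  case: x => [a|q]; last by left.
  have : (r2 < `|body a - body p|) || (`|body a - body p| <= r2).
    by rewrite real_ltNge ?normr_real ?gtr0_real// orNb.
  by case/orP => h; [left|right; exact: le_lt_trans r21].
- by exists (inl x); split => //; apply/kept_left.
- by exists (inr x); split => //; apply/kept_right.
Qed.

Definition unfold_pt (x : sphere) : pt :=
  let y := projT1 (cid (unfold_ex x)) in
  exist _ (glue_class i r1 r2 y)
    (ex_intro2 _ _ y (projT2 (cid (unfold_ex x))).1 erefl).

Lemma unfold_ptK : cancel unfold_pt fold_pt.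
Proof.
move=> x; rewrite /unfold_pt; case: cid => y [ky yx] /=.
by rewrite (fold_pt_class (x := y)).
Qed.

Lemma fold_pt_inj : injective fold_pt.
Proof.
move=> A A' AA'; have e : sval A = sval A'.
  by apply/seteqP; split => y /mem_sewn[ky uy]; apply/mem_sewn; split => //;
    rewrite uy.
by case: A A' e {AA'} => [A hA] [A' hA'] /= e; exact: eq_exist.
Qed.

Lemma fold_ptK : cancel fold_pt unfold_pt.
Proof. by move=> A; apply: fold_pt_inj; rewrite unfold_ptK. Qed.

Local Notation sdomain := (@sewn_dom R m n T1 T2 i r1 r2).
Local Notation smapping := (@sewn_map R m n T1 T2 i r1 r2).
Local Notation outside_pts := (body_pt (R := R) @^-1` outside p r2).
Local Notation inside_pts := (body_pt (R := R) @^-1` inside p r1).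

Lemma sewn_dom_left (X : set sphere) :
  sdomain (@inl T1 T2 @` X) = fold_pt @^-1` (X `&` outside_pts).
Proof.
apply/seteqP; split => A /=.
  move=> [y [/mem_sewn[ky uy] [x Xx xy]]]; rewrite -uy -xy; split => //.
  by apply/kept_left; rewrite xy.
move=> [XA oA]; exists (inl (fold_pt A)); split; last by exists (fold_pt A).
by apply/mem_sewn; split => //; apply/kept_left.
Qed.

Lemma sewn_dom_right (X : set sphere) :
  sdomain (@inr T1 T2 @` X) = fold_pt @^-1` (X `&` inside_pts).
Proof.
apply/seteqP; split => A /=.
  move=> [y [/mem_sewn[ky uy] [x Xx xy]]]; rewrite -uy -xy; split => //.
  by apply/kept_right; rewrite xy.
move=> [XA oA]; exists (inr (fold_pt A)); split; last by exists (fold_pt A).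
by apply/mem_sewn; split => //; apply/kept_right.
Qed.

(** The choice made by [xget] is harmless: a class has at most one member on each side. *)
Lemma sewn_map_left (X : set T1) (f : T1 -> Lam) A :
  sdomain (@inl T1 T2 @` X) A ->
  smapping (@inl T1 T2 @` X) (on_left f 0) A = f (fold_pt A).
Proof.
move=> [y [Ay Xy]]; rewrite /sewn_map.
have /(xgetI (0 : Lam)) :
    ((@on_left R m n T1 T2 _ f 0) @` (sval A `&` (@inl T1 T2 @` X)))
      (@on_left R m n T1 T2 _ f 0 y).
  by exists y.
by move=> [y0 [/mem_sewn[_ uy'] [x _ xy]] <-]; rewrite -uy' -xy.
Qed.

Lemma sewn_map_right (X : set T2) (f : T2 -> Lam) A :
  sdomain (@inr T1 T2 @` X) A ->
  smapping (@inr T1 T2 @` X) (on_right f 0) A = f (fold_pt A).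
Proof.
move=> [y [Ay Xy]]; rewrite /sewn_map.
have /(xgetI (0 : Lam)) :
    ((@on_right R m n T1 T2 _ f 0) @` (sval A `&` (@inr T1 T2 @` X)))
      (@on_right R m n T1 T2 _ f 0 y).
  by exists y.
by move=> [y0 [/mem_sewn[_ uy'] [x _ xy]] <-]; rewrite -uy' -xy.
Qed.

Definition sdom_body be : set opc :=
  [set c | if c is Some c then be || (c != 0) else ~~ be].

Lemma sdom_bodyE be : sdom be = body_pt (R := R) @^-1` sdom_body be.
Proof. by apply/seteqP; case: be; split => -[a|q]. Qed.

Local Notation sewn_surf := (@sewn_srs R m n T1 T2 i r1 r2).

Definition chart_type (c : chart sewn_surf) : bool :=
  match c with inl b => b | inr b => b end.
Definition chart_body (c : chart sewn_surf) : set opc :=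
  match c with inl b => sdom_body b `&` outside p r2 | inr b => sdom_body b `&` inside p r1 end.

Lemma srs_open_outside : @srs_open R sphere outside_pts.
Proof.
apply/srs_open_sphere; split; first exact: open_disc_compl.
apply/open_infty_trace; first exact: open_disc_compl.
move=> _; exists (r2 + `|body p|) => [|c h] /=; first by rewrite ltr_pwDl.
by rewrite -(ltrD2r `|body p|) (lt_le_trans h)// -{1}[c](subrK (body p)) ler_normD.
Qed.

Lemma srs_open_inside : @srs_open R sphere inside_pts.
Proof.
apply/srs_open_sphere; split; first exact: open_disc.
by apply/open_infty_trace; first exact: open_disc.
Qed.

Lemma sewn_tubesP l (cs : seq Lam) (rs : seq C) (P : 'I_l.+1 -> pt) D Om :
  (forall k, (k <= l)%N -> 0 < nth 0 rs k) ->
  (forall j k : nat, (0 < j < k)%N -> (k <= l)%N ->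
     body (nth 0 cs j) != body (nth 0 cs k)) ->
  (forall k, fold_pt (P k) = tpt (sph_tubes l cs rs) k) ->
  (forall k, D k = fold_pt @^-1` tdom (sph_tubes l cs rs) k) ->
  (forall k A, D k A -> Om k A = tmap (sph_tubes l cs rs) k (fold_pt A)) ->
  let U := @TubesData R l sewn_surf P D Om in
  supersphere_with_tubes U /\ tubes_equiv U (sph_tubes l cs rs).
Proof.
apply: (@transported_tubes R sewn_surf fold_pt unfold_pt fold_ptK unfold_ptK
  chart_type chart_body).
- move=> [b|b].
    by rewrite [LHS](sewn_dom_left (sdom b)) sdom_bodyE.
  by rewrite [LHS](sewn_dom_right (sdom b)) sdom_bodyE.
- move=> [b|b] A /= dA; [exact: sewn_map_left|exact: sewn_map_right].
- move=> [b|b]; rewrite /= preimage_setI -sdom_bodyE; apply: srs_openI_sphere.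
  + exact: srs_open_sdom.
  + exact: srs_open_outside.
  + exact: srs_open_sdom.
  + exact: srs_open_inside.
- by move=> [b|b] x [/= h _]; rewrite sdom_bodyE.
- move=> be x; rewrite sdom_bodyE => dx.
  have [[y|y] [ky yx]] := unfold_ex x.
    by exists (inl be) => //; split => //; rewrite -yx; apply/kept_left.
  by exists (inr be) => //; split => //; rewrite -yx; apply/kept_right.
Qed.

(** Each surviving tube is required to lie inside the kept region of its sphere, so that restricting
    it to the sewn surface removes nothing. *)
Lemma sewn_sph_tubes (cs : seq Lam) (rs : seq C) :
  (forall k, (k <= m + n - 1)%N -> 0 < nth 0 rs k) ->
  (forall j k : nat, (0 < j < k)%N -> (k <= m + n - 1)%N ->
     body (nth 0 cs j) != body (nth 0 cs k)) ->
  (forall k : 'I_(m + n - 1).+1, match sewn_index n i k with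
   | inl j => [/\ (j != 0 :> nat) = (k != 0 :> nat), nth 0 cs1 j = nth 0 cs k,
                  nth 0 rs1 j = nth 0 rs k & tdom T1 j `<=` outside_pts]
   | inr j => [/\ (j != 0 :> nat) = (k != 0 :> nat), nth 0 cs2 j = nth 0 cs k,
                  nth 0 rs2 j = nth 0 rs k & tdom T2 j `<=` inside_pts]
   end) ->
  exists2 P : 'I_(m + n - 1).+1 -> pt,
    forall k, sval (P k) = glue_class i r1 r2 (sewn_puncture T1 T2 i k) &
    supersphere_with_tubes (sewn_tubes P) /\
    tubes_equiv (sewn_tubes P) (sph_tubes (m + n - 1) cs rs).
Proof.
move=> rs0 csn match_tubes.
have punctureE (k : 'I_(m + n - 1).+1) : kept (sewn_puncture T1 T2 i k) /\
    unglue (sewn_puncture T1 T2 i k) = tpt (sph_tubes (m + n - 1) cs rs) k.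
  have kl : (k <= m + n - 1)%N by rewrite -ltnS.
  have := match_tubes k; rewrite /sewn_puncture.
  case: sewn_index => j [jk jc jr sub] /=; rewrite jk jc; split => //.
    apply/kept_left; apply: sub; rewrite /= jk jc jr.
    by have [] := tube_ptP (k != 0 :> nat) (nth 0 cs k) (rs0 k kl).
  apply/kept_right; apply: sub; rewrite /= jk jc jr.
  by have [] := tube_ptP (k != 0 :> nat) (nth 0 cs k) (rs0 k kl).
exists (fun k => unfold_pt (unglue (sewn_puncture T1 T2 i k))).
  move=> k; have [kk _] := punctureE k; apply/seteqP; split => y.
    by move=> /mem_sewn[ky]; rewrite unfold_ptK => uy; split => //; apply/glue_relP.
  by move=> [ky /glue_relP-/(_ kk ky) uy]; apply/mem_sewn; rewrite unfold_ptK.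
apply: sewn_tubesP => // k.
- by rewrite unfold_ptK (punctureE k).2.
- have := match_tubes k; case: sewn_index => j [jk jc jr sub].
    rewrite (sewn_dom_left (tdom T1 j)) (setIidl sub) /=.
    by rewrite jk jc jr.
  rewrite (sewn_dom_right (tdom T2 j)) (setIidl sub) /=.
  by rewrite jk jc jr.
- have := match_tubes k; case: sewn_index => j [jk jc jr sub] A dA.
    by rewrite sewn_map_left// /= jk jc.
  by rewrite sewn_map_right// /= jk jc.
Qed.

End SewnSpheres.

(** * Classes of translated spheres *)

Section StandardClasses.
Variable R : realType.
Local Notation Lam := (Lam R).
Local Notation C := (Cx R).
Implicit Types (p q : Lam) (r : C).

Lemma spt_add0 p : spt_add 0 p = p.
Proof.
rewrite /spt_add (evpart_even (@is_even0 R)) (odpart_even (@is_even0 R)).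
by rewrite mulr0 addr0 !add0r spoint_parts.
Qed.

Lemma spt_addr0 p : spt_add p 0 = p.
Proof.
rewrite /spt_add (evpart_even (@is_even0 R)) (odpart_even (@is_even0 R)).
by rewrite mul0r !addr0 spoint_parts.
Qed.

(** The canonical representative has centres [cs']; the centres [cs] are those of its pullback by
    the translation [c]. *)
Lemma SKclass_sph_tubes n (Q : SKdata R n) (c p : Lam) (cs cs' : seq Lam) (rs : seq C) :
  skinf Q = csingle (evpart p) 1 (odpart p) 1 -> nth 0 cs' 0 = p ->
  (forall k : 'I_n, nth 0 cs' k.+1 = skcenter Q k) ->
  (forall k : 'I_n, tnth (skloc Q) k = (1, coeffs0)) ->
  (forall k, (k <= n)%N -> 0 < nth 0 rs k) ->
  (forall k, (k <= n)%N -> nth 0 cs k = spt_add c (nth 0 cs' k)) ->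
  (forall j k : nat, (0 < j < k)%N -> (k <= n)%N ->
     body (nth 0 cs' j) != body (nth 0 cs' k)) ->
  SKclass Q (sph_tubes n cs rs).
Proof.
move=> infE cs0 csS locE rs0 csE dist; split.
  apply: sph_tubesP => // j k jk kn; have /andP[j0 jk'] := jk.
  rewrite !csE ?(ltnW (leq_trans jk' kn))// !body_spt_add.
  by rewrite (inj_eq (addrI _)) dist.
exists (sph_tubes n cs' rs); split.
- exact: (canonical_sph_tubes infE cs0 csS locE rs0).
- exact: sph_tubesP.
- exact: tubes_equiv_shift csE.
Qed.

Lemma tube_ball_sph_tubes n (cs : seq Lam) (rs : seq C) (i : 'I_n.+1) r :
  r < nth 0 rs i ->
  (forall l : 'I_n.+1, l != i -> ~ (tube_dom (i != 0 :> nat) (nth 0 cs i) (nth 0 rs i)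
     (tube_pt (l != 0 :> nat) (nth 0 cs l)) /\
     `|body (tube_coord (i != 0 :> nat) (nth 0 cs i)
        (tube_pt (l != 0 :> nat) (nth 0 cs l)))| <= r)) ->
  tube_ball (sph_tubes n cs rs) i r.
Proof.
move=> ri h; split.
  by rewrite [X in _ `<=` X]tube_coord_image => a /= ar; exact: le_lt_trans ri.
by move=> l hl; apply/eqP/negPn/negP => /h; apply.
Qed.

End StandardClasses.

Theorem proposition4p10 (R : realType) (z theta z0 theta0 : Lam R)
    (hz : is_even z) (htheta : is_odd theta)
    (hz0 : is_even z0) (htheta0 : is_odd theta0)
    (z0_gt0 : 0 < `|body z0|) (z0_lt_z : `|body z0| < `|body z|) :
  @SK_sewing R 2 1 1
    (@SKData R 2 [tuple spoint z theta] coeffs0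
       [tuple (1, coeffs0); (1, coeffs0)])
    (@SKData R 1 [tuple] (csingle (- z0) 1 (- theta0) 1)
       [tuple (1, coeffs0)])
    (@SKData R 2
       [tuple spoint (z0 + z + theta0 * theta) (theta + theta0)] coeffs0
       [tuple (1, coeffs0); (1, coeffs0)]).
Proof.
set Q1 := @SKData R 2 [tuple spoint z theta] _ _.
set Q2 := @SKData R 1 [tuple] _ _; set Q := @SKData R 2 _ _ _.
(* The coordinate at infinity of the second canonical sphere is [I o s_p0]. *)
pose p := spoint z theta; pose p0 := spoint (- z0) (- theta0).
pose pp := spoint (z0 + z + theta0 * theta) (theta + theta0).
have epp : is_even (z0 + z + theta0 * theta).
  by apply: is_evenD; [exact: is_evenD|exact: is_oddM].
have opp : is_odd (theta + theta0) by exact: is_oddD.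
have bp : body p = body z by rewrite body_spoint.
have bpp : body pp = body z0 + body z.
  by rewrite body_spoint// !bodyD bodyM (body_odd htheta0) mul0r addr0.
have evp0 : evpart p0 = - z0 by rewrite evpart_spoint//; [exact: is_evenN|exact: is_oddN].
have odp0 : odpart p0 = - theta0 by rewrite odpart_spoint//; [exact: is_evenN|exact: is_oddN].
(* This identity determines [pp]: after the translation by [pp], the negative tube of the second
   sphere has the centre [p]. *)
have pE : p = spt_add pp p0.
  rewrite /spt_add evp0 odp0 evpart_spoint// odpart_spoint//; congr spoint.
    by rewrite mulNr mulrDr (odd_sqr htheta0); glin.
  by rewrite addrK.
have z_gt0 : 0 < `|body z| by exact: lt_trans z0_lt_z.
have bz0 : body z != 0 by rewrite -normr_gt0.
have bpp0 : body pp != 0.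
  rewrite bpp addr_eq0; apply: contraTneq z0_lt_z => ->.
  by rewrite normrN ltxx.
(* [|z0| < r2 < r < r1 < |z|] are equally spaced, at distance [d]. *)
pose d : Cx R := (`|body z| - `|body z0|) / 4.
have d0 : 0 < d by rewrite divr_gt0// subr_gt0.
pose r2 : Cx R := `|body z0| + d; pose r : Cx R := r2 + d; pose r1 : Cx R := r + d.
have zE : `|body z| = r1 + d by rewrite /r1 /r /r2 /d; field.
have r20 : 0 < r2 by rewrite addr_gt0.
have r2r : r2 < r by rewrite ltrDl.
have rr1 : r < r1 by rewrite ltrDl.
have r1z : r1 < `|body z| by rewrite zE ltrDl.
have z0r2 : `|body z0| < r2 by rewrite ltrDl.
have r2z : r2 < `|body z| by apply: lt_trans r1z; exact: lt_trans rr1.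
have r0 : 0 < r by exact: lt_trans r2r.
(* Radii of the surviving tubes. By the triangle inequality, [|c| > R0] and [|c| < e2] avoid the
   disc of radius [r2] around [z], and the disc of radius [e1] around [z0 + z] stays within distance
   [r1] of [z]. *)
pose R0 : Cx R := `|body z| + r2; have R00 : 0 < R0 by rewrite addr_gt0.
pose e1 : Cx R := r1 - `|body z0|; have e10 : 0 < e1.
  by rewrite subr_gt0 (lt_trans z0r2)// (lt_trans r2r).
pose e2 : Cx R := `|body z| - r2; have e20 : 0 < e2 by rewrite subr_gt0.
(* The tubes to be sewn extend as far as the other finite puncture, at distance [|z|] from [z] on
   the first sphere and [|z0|] on the second. *)
pose rs1 := [:: R0^-1; `|body z|; e2]; pose rs2 := [:: `|body z0|^-1; e1].
pose rs := [:: R0^-1; e1; e2].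
have rs1P k : (k <= 2)%N -> 0 < nth 0 rs1 k.
  by case: k => [|[|[|//]]] _ //=; rewrite invr_gt0.
have rs2P k : (k <= 1)%N -> 0 < nth 0 rs2 k.
  by case: k => [|[|//]] _ //=; rewrite invr_gt0.
have rsP k : (k <= 2)%N -> 0 < nth 0 rs k.
  by case: k => [|[|[|//]]] _ //=; rewrite invr_gt0.
pose cs1 := [:: 0; p; 0]; pose cs2 := [:: p; pp]; pose cs := [:: 0; pp; 0].
have csP (q : Lam R) : body q != 0 -> forall j k : nat, (0 < j < k)%N -> (k <= 2)%N ->
    body (nth 0 [:: 0; q; 0] j) != body (nth 0 [:: 0; q; 0] k).
  by move=> q0 [|[|[|j]]] [|[|[|k]]] //= _ _; rewrite body_0.
have coeffsE : @coeffs0 R = csingle (evpart 0) 1 (odpart 0) 1.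
  by rewrite (evpart_even (@is_even0 R)) (odpart_even (@is_even0 R)) coeffs0E.
have loc2 (k : 'I_2) :
    tnth [tuple (1 : Lam R, @coeffs0 R); (1, coeffs0)] k = (1, coeffs0).
  by case: k => -[|[|//]] k2; rewrite (tnth_nth (1, coeffs0)).
have loc1 (k : 'I_1) : tnth [tuple (1 : Lam R, @coeffs0 R)] k = (1, coeffs0).
  by case: k => -[|//] k1; rewrite (tnth_nth (1, coeffs0)).
have inQ (q : Lam R) : body q != 0 -> in_SK (@SKData R 2 [tuple q] coeffs0
    [tuple (1, coeffs0); (1, coeffs0)]).
  move=> q0; split => //=.
  - by case=> -[|//] k1; rewrite (tnth_nth 0).
  - by case=> -[|//] k1 [[|//] k2] /= ne; case: ne; exact: val_inj.
  - exact: in_H0.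
  - move=> k; rewrite loc2; split; [exact: is_even1|exact: unitr1|exact: in_H0].
have inQ2 : in_SK Q2.
  split => //=; try by case.
    by apply: in_H_single; [exact: is_evenN|exact: is_oddN].
  by move=> k; rewrite loc1; split; [exact: is_even1|exact: unitr1|exact: in_H0].
have class1 : SKclass Q1 (sph_tubes 2 cs1 rs1).
  apply: (@SKclass_sph_tubes R 2 Q1 0 0 cs1 cs1 rs1 coeffsE) => //.
  - by case=> -[|[|//]] k2.
  - by move=> k _; rewrite spt_add0.
  - by apply: csP; rewrite bp.
(* The second sphere is pulled back by the translation by [pp]. *)
have class2 : SKclass Q2 (sph_tubes 1 cs2 rs2).
  apply: (@SKclass_sph_tubes R 1 Q2 pp p0 cs2 [:: p0; 0] rs2) => //.
  - by rewrite evp0 odp0.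
  - by case=> -[|//] k2.
  - by case=> [|[|//]] _ /=; rewrite ?spt_addr0.
  - by move=> [|j] [|[|k]].
have i1 : (inord 1 : 'I_3) = 1%N :> nat by rewrite inordK.
have i0 : (inord 1 : 'I_3) != 0 :> nat by rewrite i1.
have pE1 : nth 0 cs1 (inord 1 : 'I_3) = p by rewrite i1.
have r1rs : r1 < nth 0 rs1 (inord 1 : 'I_3) by rewrite i1.
have r2rs : r2^-1 < nth 0 rs2 0 by rewrite /= ltf_pV2.
have r21 : r2 < r1 by exact: lt_trans rr1.
have sub0 : tube_dom false 0 R0^-1 `<=` body_pt (R := R) @^-1` outside p r2.
  rewrite tube_dom_falseE ?invr_gt0// invrK => -[a|//] /=; rewrite body_0 subr0 bp => h.
  rewrite -(ltrD2l `|body z|) (lt_le_trans h)// addrC.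
  by rewrite -{1}[body a](subrK (body z)) ler_normD.
have sub2 : tube_dom true 0 e2 `<=` body_pt (R := R) @^-1` outside p r2.
  rewrite tube_dom_trueE => -[a|//] /=; rewrite body_0 subr0 bp ltrBrDr => h.
  rewrite -(ltrD2l `|body a|) (lt_le_trans h)// distrC.
  by rewrite -{1}[body z](subrK (body a)) addrC ler_normD.
have sub1 : tube_dom true pp e1 `<=` body_pt (R := R) @^-1` inside p r1.
  rewrite tube_dom_trueE => -[a|//] /=; rewrite bpp bp ltrBrDr => h.
  apply: le_lt_trans h; rewrite (le_trans _ (ler_normD _ _))//.
  by rewrite opprD addrA addrAC subrK.
have pE2 : nth 0 cs2 0 = p by [].
have [|P PE [sU eU]] := @sewn_sph_tubes R 2 1 cs1 cs2 rs1 rs2 (inord 1) p r1 r2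
  i0 pE1 pE2 r20 r21 r1rs r2rs cs rs rsP (csP pp bpp0).
  (* Tubes 0 and 2 come from the first sphere, tube 1 from the second. *)
  case=> -[|[|[|//]]] k3; rewrite /sewn_index i1 /= ?inordK//=.
have ball1 t : t < `|body z| -> tube_ball (sph_tubes 2 cs1 rs1) (inord 1) t.
  move=> tz; apply: tube_ball_sph_tubes; rewrite i1 //= => -[[|[|[|//]]] l3] /=.
  - by move=> _ [[]].
  - by move=> /eqP[]; apply: val_inj; rewrite /= i1.
  - move=> _ [_]; rewrite tube_coord_true body_sshift body_0 sub0r normrN bp.
    by move=> /le_lt_trans/(_ tz); rewrite ltxx.
(* In the coordinate at infinity, the closed ball of radius [1/t] consists of the points at distance
   at least [t] from [z], whereas the positive puncture is at distance [|z0|]. *)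
have ball2 t : `|body z0| < t -> tube_ball (sph_tubes 1 cs2 rs2) ord0 t^-1.
  move=> tz; have t0 : 0 < t by exact: lt_trans tz.
  apply: tube_ball_sph_tubes; rewrite /= ?ltf_pV2// => -[[|[|//]] l2] //= _ [_].
  rewrite tube_coord_false body_sinv body_sshift bp bpp addrK -?normr_gt0//.
  by rewrite normfV lef_pV2// => /le_lt_trans/(_ tz); rewrite ltxx.
split; [by apply: inQ; rewrite bp|exact: inQ2|exact: inQ|].
exists (sph_tubes 2 cs1 rs1), (sph_tubes 1 cs2 rs2), (sewn_tubes P).
split; [exact: class1|exact: class2| |].
  split => //; exists r, r1, r2; split.
  - by rewrite r2r rr1.
  - by split; [apply: ball1; exact: lt_trans r1z|apply: ball2; exact: lt_trans r2r].
  - by split; [exact: ball1|exact: ball2].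
  - by exists P.
split; first exact: sU.
exists (sph_tubes 2 cs rs); split; last exact: eU.
  apply: (@canonical_sph_tubes R 2 Q 0 cs rs coeffsE) => //.
  by case=> -[|[|//]] k2.
by apply: sph_tubesP => //; exact: csP.
Qed.
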